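(* Let $X,Y,\partial X,\partial Y$ be Banach spaces and $A,L,B,\tilde B$ operators such that: 1. $Y\hookrightarrow X$. 2. $\partial Y\hookrightarrow\partial X$. 3. $A:D(A)\to X$ is linear with $D(A)\subset Y$ (and $D(A)\subset X$). 4. $L:D(A)\to\partial X$ is linear and surjective. 5. $A_0:=A|_{\ker(L)}$ is densely defined (in $X$) and has nonempty resolvent set. 6. $\begin{pmatrix}A\\ L\end{pmatrix}:D(A)\to X\times\partial X$ is closed as an operator from $X$ to $X\times\partial X$. 7. $B:[D(A)_L]\to\partial X$ is linear and bounded; further, $B$ is bounded either from $[D(A_0)]$ to $\partial Y$, or from $Y$ to $\partial X$. 8. $\tilde B:D(\tilde B)\subset\partial X\to\partial X$ is linear and closed, with $D(\tilde B)\subset\partial Y$. Set $\mathcal{X}:=X\times\partial X$, $\mathcal{Y}:=Y\times\partial Y$. Then the operator matrix on $\mathcal{X}$ $$\tilde{\mathcal{A}}:=\begin{pmatrix}A&0\\ B&\tilde B\end{pmatrix},\qquad D(\tilde{\mathcal{A}}):=\left\{\begin{pmatrix}u\\ w\end{pmatrix}\in D(A)\times D(\tilde B): Lu=w\right\},$$ generates a cosine operator function with associated phase space $\mathcal{Y}\times\mathcal{X}$ if and only if $A_0$ and $\tilde B$ generate cosine operator functions with associated phase spaces $Y\times X$ and $\partial Y\times\partial X$, respectively. In this case, the sine operator function $(S(t,\tilde{\mathcal{A}}))_{t\in\mathbb{R}}$ is compact if and only if the embeddings $[D(A_0)]\hookrightarrow X$ and $[D(\tilde B)]\hookrightarrow\partial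 X$ are both compact.
   Context: For a closed operator $T$ on a Banach space, $[D(T)]$ denotes the domain of $T$ with the graph norm. The symbol $\hookrightarrow$ denotes a continuous embedding. $\partial X$ and $\partial Y$ are just names of Banach spaces (''boundary spaces''). $[D(A)_L]$ denotes the Banach space $D(A)$ endowed with the norm $\|u\|_X+\|Au\|_X+\|Lu\|_{\partial X}$. A cosine operator function (COF) on a Banach space $E$ is a strongly continuous family $(C(t))_{t\in\mathbb{R}}$ of bounded linear operators on $E$ with $C(0)=I$ and $C(t+s)+C(t-s)=2C(t)C(s)$ for all $s,t\in\mathbb{R}$. Its generator is $Tx=\frac{d^2}{dt^2}C(t)x|_{t=0}$ on the set of $x$ for which $t\mapsto C(t)x$ is $C^2$. If $T$ generates a COF it is denoted $(C(t,T))_{t\in\mathbb{R}}$. The associated sine operator function is $S(t,T)x:=\int_0^t C(s,T)x\,ds$. It is called compact if $S(t,T)$ is a compact operator for every $t\in\mathbb{R}$. A closed operator $T$ on $E$ generates a COF on $E$ if and only if there is a Banach space $F$ with $[D(T)]\hookrightarrow F\hookrightarrow E$ such that $\begin{pmatrix}0&I_F\\ T&0\end{pmatrix}$ with domain $D(T)\times F$ generates a $C_0$-semigroup on $F\times E$. Such an $F$ is unique; it is called the Kisyński space, and $F\times E$ is called the associated phase space. ''$T$ generates a COF with associated phase space $F\times E$'' means that $T$ generates a COF on $E$ and its Kisyński space is $F$. *)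

(* Defs.v *)
(* MathComp / MathComp-Analysis. *)
From HB Require Import structures.
From mathcomp Require Import all_boot all_order all_algebra.
From mathcomp Require Import all_classical all_reals all_analysis.
From mathcomp Require Import complex.

Set Implicit Arguments.
Unset Strict Implicit.
Unset Printing Implicit Defensive.

Import Order.TTheory GRing.Theory Num.Theory.
Import numFieldNormedType.Exports.

Local Open Scope classical_set_scope.
Local Open Scope ring_scope.

(* [scalar_field iota]: the field K is R or R[i], and iota : R -> K is the
   canonical inclusion of the reals.  Norms of normed modules over R[i] take
   their values in R[i]; they are nonnegative there, hence real. *)
Variant scalar_field (R : realType) : forall K : numFieldType, (R -> K) -> Prop :=
| real_scalars : @scalar_field R R idfun
| complex_scalars : @scalar_field R R[i] (real_complex R).

(* An unbounded operator is given by its domain D and a total function f whose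
   values outside of D are irrelevant. *)
Section Operators.
Context {K : numFieldType}.
Implicit Types E F G : normedModType K.

Definition linear_operator E F (D : set E) (f : E -> F) : Prop :=
  D 0 /\ forall (a : K) x y, D x -> D y ->
    D (a *: x + y) /\ f (a *: x + y) = a *: f x + f y.

Definition graph E F (D : set E) (f : E -> F) : set (E * F) :=
  [set p | D p.1 /\ p.2 = f p.1].

Definition closed_operator E F (D : set E) (f : E -> F) : Prop :=
  closed (graph D f).

Definition continuous_embedding E F (j : E -> F) : Prop :=
  [/\ linear j, injective j & continuous j].

Definition resolvent_set E (D : set E) (T : E -> E) : set K :=
  [set lam | exists Q : {linear E -> E}, [/\ continuous Q,
     forall y, D (Q y) /\ lam *: Q y - T (Q y) = y
   & forall x, D x -> Q (lam *: x - T x) = x]].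

(* The embedding [D(T)] -> F, where F is a subspace of E via j. *)
Definition domain_embedding E F (j : F -> E) (D : set E) (T : E -> E) : Prop :=
  D `<=` range j /\
  exists M : K, forall f : F, D (j f) -> `|f| <= M * (`|j f| + `|T (j f)|).

Definition compact_operator E F (f : E -> F) : Prop :=
  precompact (f @` [set x | `|x| <= 1]).

Definition compact_domain_embedding E (D : set E) (T : E -> E) : Prop :=
  precompact [set x | D x /\ `|x| + `|T x| <= 1].

(* The graph of the matrix (0, I_F; T, 0) on F * E with domain D(T) * F, where
   F is a subspace of E via j: it maps (f, j g) to (g, T f). *)
Definition reduction_graph E F (j : F -> E) (D : set E) (T : E -> E) :
    set ((F * E) * (F * E)) :=
  [set p | [/\ D (j p.1.1), p.1.2 = j p.2.1 & p.2.2 = T (j p.1.1)]].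

Definition prod_map (E E' F F' : Type) (f : E -> E') (g : F -> F')
    (p : E * F) : E' * F' := (f p.1, g p.2).

End Operators.

Section Generation.
Context {R : realType} {K : numFieldType} (iota : R -> K).
Implicit Types E F : normedModType K.

Definition is_vderivative E (f : R -> E) (t : R) (l : E) : Prop :=
  (iota h)^-1 *: (f (t + h) - f t) @[h --> (0 : R)^'] --> l.

(* Riemann integral for a <= b: tagged subdivisions p_0 <= .. <= p_n of [a, b]
   with tags tau_k. *)
Definition is_riemann_integral E (f : R -> E) (a b : R) (I : E) : Prop :=
  forall eps : K, 0 < eps -> exists2 delta : R, 0 < delta &
    forall (n : nat) (p tau : nat -> R), p 0%N = a -> p n = b ->
      (forall k, (k < n)%N ->
         [/\ p k <= tau k, tau k <= p k.+1 & p k.+1 - p k < delta]) ->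
      `|I - \sum_(k < n) iota (p k.+1 - p k) *: f (tau k)| < eps.

Definition vintegral E (f : R -> E) (a b : R) : E :=
  if a <= b then get (is_riemann_integral f a b)
  else - get (is_riemann_integral f b a).

(* Only the values at times t >= 0 matter. *)
Definition C0_semigroup E (S : R -> {linear E -> E}) : Prop :=
  [/\ forall t, 0 <= t -> continuous (S t),
      forall x, S 0 x = x,
      forall t s x, 0 <= t -> 0 <= s -> S (t + s) x = S t (S s x)
    & forall x, {within [set t | 0 <= t], continuous (fun t => S t x)}].

Definition C0_generator E (S : R -> {linear E -> E}) : set (E * E) :=
  [set p | (iota h)^-1 *: (S h p.1 - p.1) @[h --> (0 : R)^'+] --> p.2].

Definition generates_C0_semigroup E (G : set (E * E)) : Prop :=
  exists S : R -> {linear E -> E}, C0_semigroup S /\ C0_generator S = G.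

Definition cosine_function E (C : R -> {linear E -> E}) : Prop :=
  [/\ forall t, continuous (C t),
      forall x, C 0 x = x,
      forall t s x, C (t + s) x + C (t - s) x = 2%:R *: C t (C s x)
    & forall x, continuous (fun t => C t x)].

Definition cosine_generator E (C : R -> {linear E -> E}) : set (E * E) :=
  [set p | exists f1 f2 : R -> E,
     [/\ forall t, is_vderivative (fun s => C s p.1) t (f1 t),
         forall t, is_vderivative f1 t (f2 t),
         continuous f2
       & p.2 = f2 0]].

Definition cosine_generated_by E (D : set E) (T : E -> E)
    (C : R -> {linear E -> E}) : Prop :=
  cosine_function C /\ cosine_generator C = graph D T.

Definition sine E (C : R -> {linear E -> E}) (t : R) (x : E) : E :=
  vintegral (fun s => C s x) 0 t.

Definition generates_COF E (D : set E) (T : E -> E) : Prop :=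
  exists C : R -> {linear E -> E}, cosine_generated_by D T C.

Definition kisynski_space E F (j : F -> E) (D : set E) (T : E -> E) : Prop :=
  [/\ domain_embedding j D T, continuous_embedding j
    & generates_C0_semigroup (reduction_graph j D T)].

(* T generates a COF with associated phase space F * E, F -> E via j. *)
Definition generates_COF_with_phase_space E F (j : F -> E) (D : set E)
    (T : E -> E) : Prop :=
  generates_COF D T /\ kisynski_space j D T.

End Generation.

Section OperatorMatrix.
Context {K : numFieldType} {X dX : normedModType K}.

Definition opmx_domain (DA : set X) (L : X -> dX) (DBt : set dX) :
    set (X * dX) :=
  [set p | [/\ DA p.1, DBt p.2 & L p.1 = p.2]].

Definition opmx (A : X -> X) (B : X -> dX) (Bt : dX -> dX)
    (p : X * dX) : X * dX := (A p.1, B p.1 + Bt p.2).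

End OperatorMatrix.

(* Main.v *)
(* Let D be the Dirichlet map sending w to the solution u of A u = lam u,
   L u = w, where lam lies in the resolvent set of A_0; it is bounded from dX to
   Y by the closed graph theorem.  The pair (u, w) lies in the domain of the
   matrix iff u - D w lies in D(A_0) and w in D(Bt).  On the phase space, the
   change of variables u -> u - D w, z -> z - k v, where k is bounded from X to
   dY, turns the reduction matrix of the operator matrix into a bounded
   perturbation of the direct sum of the reduction matrices of A_0 and Bt.  If B
   maps [D(A_0)] to dY, then k = - B R(lam, A_0) absorbs the unbounded part of B;
   if B is bounded on Y, then k = 0 works.  Since a reduction matrix is similar
   to its negative, it generates a semigroup iff it generates a group, and
   generation of groups is stable under similarity, direct sums and bounded
   perturbations.  A cosine function is the lower right corner of the group.

   A sine function is compact iff the domain of the generator embeds compactly: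
   S(t)/t approximates the identity uniformly on the unit ball of the domain, and
   S(t) is uniformly approximated by h^-1 (z(t + h) - z(t)), where
   z(t) x is the primitive of S(t) x, which is bounded into the domain. *)

Require Import Defs.
From HB Require Import structures.
From mathcomp Require Import all_boot all_order all_algebra.
From mathcomp Require Import all_classical all_reals all_analysis.
From mathcomp Require Import complex ring lra.

Set Implicit Arguments.
Unset Strict Implicit.
Unset Printing Implicit Defensive.

Import Order.TTheory GRing.Theory Num.Theory.
Import numFieldNormedType.Exports.

Local Open Scope classical_set_scope.
Local Open Scope ring_scope.

(** Where B is only bounded on Y, its extension b from D(A_0) to Y requires D(A_0) to be dense in
    the norm of Y, whereas density is assumed in X. It is recovered from whichever side of the
    equivalence is assumed: the domain of a generator is dense in its phase space, and the
    Y-component of this fact is the density sought. So k and b are constructed inside each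
    implication, once a group is at hand, while D only depends on the resolvent of A_0.

    Groups are compared without resolvents or Laplace transforms: a product such as V(-s) Phi U(s) x
    has right derivative zero for x in the domain of the generator, hence is constant, and density
    extends the identity. Negative times matter also for the perturbation, where U(-t) P U(t) leads
    to a differential equation with bounded, strongly continuous coefficients.

    The existence of the cosine function is itself deduced from the semigroup condition, so that the
    equivalence is proved for Kisynski spaces alone. *)

Lemma eq_leW (d : Order.disp_t) (T : porderType d) (x y : T) :
  x = y -> (x <= y)%O.
Proof. by move=> ->. Qed.

(** * Abelian group identities by reflection *)

Section ZmodReflection.
Variable V : zmodType.

Inductive zexp := ZVar of nat | ZZero | ZAdd of zexp & zexp | ZOpp of zexp.

Fixpoint zeval (env : seq V) (t : zexp) : V :=
  match t with
  | ZVar i => env`_i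
  | ZZero => 0
  | ZAdd t1 t2 => zeval env t1 + zeval env t2
  | ZOpp t1 => - zeval env t1
  end.

Fixpoint zcoef (t : zexp) (i : nat) : int :=
  match t with
  | ZVar j => Posz (i == j)
  | ZZero => 0
  | ZAdd t1 t2 => zcoef t1 i + zcoef t2 i
  | ZOpp t1 => - zcoef t1 i
  end.

Lemma zeval_sum env t :
  zeval env t = \sum_(i < size env) env`_i *~ zcoef t i.
Proof.
elim: t => [j||t1 IH1 t2 IH2|t IH] /=.
- have [jn|nj] := ltnP j (size env).
    rewrite (bigD1 (Ordinal jn)) //= eqxx big1 ?addr0 // => i ij.
    by rewrite -val_eqE /= in ij; rewrite (negPf ij).
  rewrite nth_default // big1 // => i _.
  by rewrite (ltn_eqF (leq_trans (ltn_ord i) nj)).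
- by rewrite big1.
- by rewrite IH1 IH2 -big_split; apply: eq_bigr => i _; rewrite mulrzDr.
- by rewrite IH -sumrN; apply: eq_bigr => i _; rewrite mulrNz.
Qed.

(** By [zeval_sum] each side is the combination of the atoms with its integer coefficients.
    Comparing these is a closed computation, so [zmod] can supply [isT] as the proof. *)
Lemma zmod_reflect env t1 t2 :
  all (fun i => zcoef t1 i == zcoef t2 i) (iota 0 (size env)) ->
  zeval env t1 = zeval env t2.
Proof.
move=> /allP h; rewrite !zeval_sum; apply: eq_bigr => i _.
by rewrite (eqP (h i _)) // mem_iota add0n ltn_ord.
Qed.

End ZmodReflection.

(* [eqv] decides whether two atoms are identified. *)
Ltac zfind eqv x l :=
  lazymatch l with
  | ?y :: ?l' =>
    match tt with
    | _ => let _ := match tt with _ => eqv x y end in constr:(0%N)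
    | _ => let n := zfind eqv x l' in constr:(S n)
    end
  end.
Ltac zadd eqv x l :=
  match tt with
  | _ => let _ := zfind eqv x l in l
  | _ => constr:(x :: l)
  end.
Ltac zatoms eqv t l :=
  lazymatch t with
  | (?a + ?b)%R => let l := zatoms eqv a l in zatoms eqv b l
  | (- ?a)%R => zatoms eqv a l
  | 0%R => l
  | _ => zadd eqv t l
  end.
Ltac zquote eqv t l :=
  lazymatch t with
  | (?a + ?b)%R =>
      let a := zquote eqv a l in let b := zquote eqv b l in constr:(ZAdd a b)
  | (- ?a)%R => let a := zquote eqv a l in constr:(ZOpp a)
  | 0%R => constr:(ZZero)
  | _ => let n := zfind eqv t l in constr:(ZVar n)
  end.
Ltac zmod_with eqv :=
  lazymatch goal with
  | |- @eq ?T ?a ?b =>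
    let l := zatoms eqv a (@nil T) in let l := zatoms eqv b l in
    let ta := zquote eqv a l in let tb := zquote eqv b l in
    exact: (@zmod_reflect _ l ta tb isT)
  end.
Ltac zsyntactic x y := constr_eq x y.
Ltac zconvertible x y := unify x y.
(* Decides identities of abelian groups.  Atoms may differ in the canonical
   instances they mention, hence the second attempt. *)
Ltac zmod := first [zmod_with zsyntactic | zmod_with zconvertible].

(** * Real-valued norms *)

(* K is R or R[i], seen through the inclusion [emb] of the reals and a map [ret]
   that inverts it on nonnegative elements; [ret] turns the K-valued norms into
   real ones. *)
Class scalars (R : realType) (K : numFieldType) := Scalars {
  emb : {rmorphism R -> K};
  ret : K -> R;
  emb_le : forall r s, (emb r <= emb s) = (r <= s);
  retK : forall z, 0 <= z -> emb (ret z) = z }.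

Lemma scalar_field_scalars (R : realType) (K : numFieldType) (iota : R -> K) :
  scalar_field iota -> exists S : scalars R K, iota = @emb _ _ S.
Proof.
case.
  have H1 (r s : R) : (idfun r <= idfun s) = (r <= s) by [].
  have H2 (z : R) : 0 <= z -> idfun (idfun z) = z by [].
  by exists (@Scalars R R idfun idfun H1 H2).
have H1 (r s : R) : (real_complex R r <= real_complex R s) = (r <= s).
  by rewrite lecE /= eqxx.
have H2 (z : R[i]) : 0 <= z -> real_complex R (complex.Re z) = z.
  by case: z => a b; rewrite lecE /= => /andP[/eqP -> _].
by exists (@Scalars R R[i] (real_complex R) (@complex.Re R) H1 H2).
Qed.

Section RealNorm.
Context {R : realType} {K : numFieldType} {S : scalars R K}.
Implicit Types (E F : normedModType K) (r s : R) (a : K).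

Lemma emb_lt r s : (emb r < emb s :> K) = (r < s).
Proof. by rewrite !lt_neqAle emb_le (inj_eq (fmorph_inj emb)). Qed.

Definition rabs a : R := ret `|a|.
Definition rnorm E (x : E) : R := ret `|x|.

Lemma emb_rnorm E (x : E) : emb (rnorm x) = `|x|.
Proof. exact: retK. Qed.

Lemma emb_rabs a : emb (rabs a) = `|a|.
Proof. exact: retK. Qed.

Lemma emb_norm r : `|emb r| = emb `|r| :> K.
Proof.
have [r0|r0] := leP 0 r.
  by rewrite !ger0_norm // -(rmorph0 emb) emb_le.
by rewrite !ltr0_norm ?rmorphN // -(rmorph0 emb) emb_lt.
Qed.

Lemma rabs_emb r : rabs (emb r) = `|r|.
Proof. by apply: (fmorph_inj (@emb _ _ S)); rewrite emb_rabs emb_norm. Qed.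

Lemma rnorm_ge0 E (x : E) : 0 <= rnorm x.
Proof. by rewrite -(@emb_le _ _ S) rmorph0 emb_rnorm. Qed.

Lemma rabs_ge0 a : 0 <= rabs a.
Proof. by rewrite -(@emb_le _ _ S) rmorph0 emb_rabs. Qed.

Lemma rnorm0 E : rnorm (0 : E) = 0.
Proof. by apply: (fmorph_inj (@emb _ _ S)); rewrite emb_rnorm normr0 rmorph0. Qed.

Lemma rnorm_eq0 E (x : E) : rnorm x = 0 -> x = 0.
Proof.
by move=> x0; apply/eqP; rewrite -normr_eq0 -emb_rnorm x0 rmorph0.
Qed.

Lemma rnorm_le0 E (x : E) : rnorm x <= 0 -> x = 0.
Proof.
by move=> x0; apply: rnorm_eq0; apply/eqP; rewrite eq_le x0 rnorm_ge0.
Qed.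

Lemma rnormD E (x y : E) : rnorm (x + y) <= rnorm x + rnorm y.
Proof. by rewrite -(@emb_le _ _ S) rmorphD !emb_rnorm ler_normD. Qed.

Lemma rnormN E (x : E) : rnorm (- x) = rnorm x.
Proof. by rewrite /rnorm normrN. Qed.

Lemma rnormB E (x y : E) : rnorm (x - y) <= rnorm x + rnorm y.
Proof. by rewrite -(rnormN y) rnormD. Qed.

Lemma rdistC E (x y : E) : rnorm (x - y) = rnorm (y - x).
Proof. by rewrite -rnormN opprB. Qed.

Lemma rdistD E (z x y : E) : rnorm (x - y) <= rnorm (x - z) + rnorm (z - y).
Proof. by rewrite -[x - y](subrKA z) rnormD. Qed.

Lemma rnormZ E a (x : E) : rnorm (a *: x) = rabs a * rnorm x.
Proof.
by apply: (fmorph_inj (@emb _ _ S)); rewrite rmorphM emb_rabs !emb_rnorm normrZ.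
Qed.

Lemma rnormZe E r (x : E) : rnorm (emb r *: x) = `|r| * rnorm x.
Proof. by rewrite rnormZ rabs_emb. Qed.

Lemma rnorm_sum E n (x : nat -> E) :
  rnorm (\sum_(k < n) x k) <= \sum_(k < n) rnorm (x k).
Proof.
elim/big_ind2: _ => [|r1 r2 s1 s2 h1 h2|//]; first by rewrite rnorm0.
by apply: le_trans (rnormD _ _) _; exact: lerD.
Qed.

Lemma rnorm_pair E F (p : E * F) : rnorm p = Num.max (rnorm p.1) (rnorm p.2).
Proof.
apply: (fmorph_inj (@emb _ _ S)); rewrite emb_rnorm prod_normE -!emb_rnorm.
by rewrite /Order.max emb_lt; case: (_ < _).
Qed.

Lemma rnorm_fst E F (p : E * F) : rnorm p.1 <= rnorm p.
Proof. by rewrite rnorm_pair le_max lexx. Qed.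

Lemma rnorm_snd E F (p : E * F) : rnorm p.2 <= rnorm p.
Proof. by rewrite rnorm_pair le_max lexx orbT. Qed.

Lemma rnorm_pair_le E F (p : E * F) : rnorm p <= rnorm p.1 + rnorm p.2.
Proof. by rewrite rnorm_pair ge_max lerDl lerDr !rnorm_ge0. Qed.

Lemma normE_le E (x : E) r : (`|x| <= emb r) = (rnorm x <= r).
Proof. by rewrite -emb_rnorm emb_le. Qed.

Lemma normE_lt E (x : E) r : (`|x| < emb r) = (rnorm x < r).
Proof. by rewrite -emb_rnorm emb_lt. Qed.

Lemma pos_emb (e : K) : 0 < e -> exists2 d : R, 0 < d & emb d = e.
Proof.
move=> e0; exists (ret e); last by rewrite retK // ltW.
by rewrite -(@emb_lt) rmorph0 retK // ltW.
Qed.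

Lemma cvg_rnorm E T (F : set_system T) (FF : Filter F) (f : T -> E) (l : E) :
  (f x @[x --> F] --> l) <->
  (forall e : R, 0 < e -> \forall x \near F, rnorm (f x - l) < e).
Proof.
split=> [/cvgrPdist_lt fl e e0|fl].
  have /fl : 0 < emb e :> K by rewrite -(rmorph0 emb) emb_lt.
  by apply: filterS => x; rewrite normE_lt rdistC.
apply/cvgrPdist_lt => _ /pos_emb[e e0 <-].
by apply: filterS (fl _ e0) => x; rewrite normE_lt rdistC.
Qed.

Lemma near_rnorm E (l : E) (P : E -> Prop) :
  (\forall x \near l, P x) <->
  exists2 d : R, 0 < d & forall x, rnorm (x - l) < d -> P x.
Proof.
split=> [/nbhs_normP[_ /= /pos_emb[d d0 <-] dP]|[d d0 dP]].
  by exists d => // x xl; apply: dP => /=; rewrite normE_lt rdistC.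
apply/nbhs_normP; exists (emb d) => /=; first by rewrite -(rmorph0 emb) emb_lt.
by move=> x /=; rewrite normE_lt rdistC; exact: dP.
Qed.

Lemma near_real (t : R) (P : R -> Prop) :
  (\forall s \near t, P s) <->
  exists2 d : R, 0 < d & forall s, `|s - t| < d -> P s.
Proof.
split=> [/nbhs_normP[d /= d0 dP]|[d d0 dP]].
  by exists d => // x xl; apply: dP => /=; rewrite distrC.
by apply/nbhs_normP; exists d => // x /=; rewrite distrC; exact: dP.
Qed.

Lemma near_right (t : R) (P : R -> Prop) :
  (\forall s \near t^'+, P s) <->
  exists2 d : R, 0 < d & forall s, t < s -> s < t + d -> P s.
Proof.
split=> [|[d d0 dP]]; rewrite near_withinE.
  move=> /near_real[d d0 dP]; exists d => // s ts std; apply: dP => //.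
  by rewrite gtr0_norm; lra.
apply/near_real; exists d => // s + ts => /ltr_normlP[_ h].
by apply: dP => //; lra.
Qed.

Lemma near_dnbhs (t : R) (P : R -> Prop) :
  (\forall s \near t^', P s) <->
  exists2 d : R, 0 < d & forall s, s != t -> `|s - t| < d -> P s.
Proof.
split=> [|[d d0 dP]]; rewrite near_withinE.
  by move=> /near_real[d d0 dP]; exists d => // s st std; exact: dP.
by apply/near_real; exists d => // s std st; exact: dP.
Qed.

Lemma continuous_real_rnorm E (f : R -> E) (t : R) :
  {for t, continuous f} <->
  forall e : R, 0 < e -> exists2 d : R, 0 < d &
    forall s, `|s - t| < d -> rnorm (f s - f t) < e.
Proof.
split=> [/cvg_rnorm ft e e0|ft]; first exact/near_real/ft.
by apply/cvg_rnorm => e e0; exact/near_real/ft.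
Qed.

Lemma rnorm_cvg_le E T (F : set_system T) (FF : ProperFilter F) (f : T -> E)
    (l a : E) (c : R) :
  f x @[x --> F] --> l -> (\forall x \near F, rnorm (f x - a) <= c) ->
  rnorm (l - a) <= c.
Proof.
move=> /cvg_rnorm fl fc; apply/ler_addgt0Pr => e e0.
have [x [h1 h2]] := filter_ex (filterI (fl _ e0) fc).
apply: le_trans (rdistD (f x) _ _) _; rewrite addrC lerD //.
by rewrite rdistC ltW.
Qed.

Lemma bounded_continuous E F (f : {linear E -> F}) (M : R) :
  (forall x, rnorm (f x) <= M * rnorm x) -> continuous f.
Proof.
move=> fM l; apply/cvg_rnorm => e e0; apply/near_rnorm.
exists (e / (`|M| + 1)); first by rewrite divr_gt0 // ltr_wpDl.
move=> x; rewrite ltr_pdivlMr ?ltr_wpDl // => xl; rewrite -linearB.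
apply: le_lt_trans (fM _) _; apply: le_lt_trans xl; rewrite mulrC.
by apply: ler_wpM2l; rewrite ?rnorm_ge0 // ler_wpDr // ler_norm.
Qed.

Lemma continuous_bounded E F (f : {linear E -> F}) : continuous f ->
  exists2 M : R, 0 <= M & forall x, rnorm (f x) <= M * rnorm x.
Proof.
move=> /(_ 0) /cvg_rnorm/(_ 1 ltr01) /near_rnorm[d d0 df].
exists (2 / d); first by rewrite divr_ge0 // ltW.
have {}df z : rnorm z < d -> rnorm (f z) < 1.
  by move=> zd; have /(_ z) := df; rewrite subr0 linear0 subr0; exact.
move=> x; have [x0|] := eqVneq (rnorm x) 0.
  by rewrite (rnorm_eq0 x0) linear0 !rnorm0 mulr0.
move=> x0; have {}x0 : 0 < rnorm x by rewrite lt_neqAle eq_sym x0 rnorm_ge0.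
have := df (@emb _ _ S (d / 2 / rnorm x) *: x).
rewrite linearZ !rnormZe gtr0_norm ?divr_gt0 //.
rewrite divfK ?gt_eqF // => /(_ ltac:(lra)) /ltW.
rewrite -ler_pdivlMl ?divr_gt0 // mulr1 => /le_trans; apply.
by apply: eq_leW; field; rewrite !gt_eqF.
Qed.

Lemma cvg_seqP E (u : nat -> E) (l : E) :
  u @ \oo --> l <->
  forall e : R, 0 < e -> exists n, forall p, (n <= p)%N -> rnorm (u p - l) < e.
Proof.
split=> [/cvg_rnorm ul e /ul [n _ nP]|ul]; first by exists n => p np; exact: nP.
by apply/cvg_rnorm => e /ul[n nP]; exists n.
Qed.

(** Completeness is a predicate here because phase spaces are products of normed modules;
    [banach_prod] transfers it to them. *)
Definition banach E := forall u : nat -> E,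
  (forall e : R, 0 < e -> exists n, forall p q, (n <= p)%N -> (n <= q)%N ->
     rnorm (u p - u q) < e) ->
  exists l : E, u @ \oo --> l.

Lemma complete_banach (E : completeNormedModType K) : banach E.
Proof.
move=> u uC; suff : cvg (u @ \oo) by move=> /cvg_ex.
apply/cauchy_cvgP/cauchy_exP => _ /pos_emb[e e0 <-].
have [n nP] := uC _ e0; exists (u n); exists n => // p /= np.
by rewrite -ball_normE /= normE_lt; apply: nP.
Qed.

Lemma banach_prod E F : banach E -> banach F -> banach (E * F)%type.
Proof.
move=> hE hF u uC.
have [e e0|l ul] := hE (fun n => (u n).1).
  have [n nP] := uC _ e0; exists n => p q np nq.
  by apply: le_lt_trans (nP _ _ np nq); exact: (rnorm_fst (u p - u q)).
have [e e0|m um] := hF (fun n => (u n).2).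
  have [n nP] := uC _ e0; exists n => p q np nq.
  by apply: le_lt_trans (nP _ _ np nq); exact: (rnorm_snd (u p - u q)).
exists (l, m); rewrite (_ : u = fun n => ((u n).1, (u n).2)).
  exact: cvg_pair.
by apply/funext => n; case: (u n).
Qed.

(** The subtracted tail makes the bound exact for a geometric sum, which is what lets the induction
    on p close. *)
Lemma telescope_geometric E (u : nat -> E) (c : R) :
  (forall n, rnorm (u n.+1 - u n) <= c / 2 ^+ n) ->
  forall n p, rnorm (u (n + p)%N - u n) <= c * 2 / 2 ^+ n - c * 2 / 2 ^+ (n + p).
Proof.
move=> uc n; elim=> [|p IH]; first by rewrite addn0 subrr rnorm0 subrr.
apply: le_trans (rdistD (u (n + p)%N) _ _) _; rewrite addnS.
apply: le_trans (lerD (uc _) IH) _; rewrite exprS invfM.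
by apply: eq_leW; field; rewrite !expf_neq0.
Qed.

Lemma small_inverse (e : R) : 0 < e ->
  exists n, forall m, (n <= m)%N -> m.+1%:R^-1 < e.
Proof.
move=> e0; exists (Num.truncn e^-1) => m nm.
rewrite -[e]invrK ltf_pV2 ?posrE ?invr_gt0 //.
by apply: lt_le_trans (truncnS_gt _) _; rewrite ler_nat.
Qed.

Lemma small_geometric (c e : R) : 0 < e -> exists n, c / 2 ^+ n < e.
Proof.
move=> e0; exists (Num.truncn (c / e)).+1.
rewrite ltr_pdivrMr ?exprn_gt0 // mulrC -ltr_pdivrMr //.
apply: lt_trans (truncnS_gt _) _; rewrite -natrX ltr_nat; exact: ltn_expl.
Qed.

Lemma geometric_cvg E (u : nat -> E) (c : R) : banach E ->
  (forall n, rnorm (u n.+1 - u n) <= c / 2 ^+ n) ->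
  exists2 l : E, u @ \oo --> l & forall n, rnorm (l - u n) <= c * 2 / 2 ^+ n.
Proof.
move=> hE uc.
have c0 : 0 <= c.
  by have := le_trans (rnorm_ge0 _) (uc 0%N); rewrite expr0 divr1.
have cn p : 0 <= c * 2 / 2 ^+ p by rewrite divr_ge0 ?mulr_ge0 ?exprn_ge0.
have ub n p : rnorm (u (n + p)%N - u n) <= c * 2 / 2 ^+ n.
  by apply: le_trans (telescope_geometric uc n p) _; rewrite gerBl.
have [e e0|l ul] := hE u.
  have [n ne] := small_geometric (c * 4) e0; exists n => p q np nq.
  apply: le_lt_trans (rdistD (u n) _ _) _; rewrite (rdistC (u n)).
  rewrite -(subnKC np) -(subnKC nq); apply: le_lt_trans (lerD (ub _ _) (ub _ _)) _.
  by apply: le_lt_trans ne; rewrite -mulrDl ler_wpM2r ?invr_ge0 ?exprn_ge0 //; lra.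
exists l => // n; apply: rnorm_cvg_le ul _; exists n => // p /= np.
by rewrite -(subnKC np).
Qed.

End RealNorm.

(** * Closed graph and uniform boundedness *)

Section Zabreiko.
Context {R : realType} {K : numFieldType} {S : scalars R K}.
Variables (E : normedModType K) (hE : banach E) (p : E -> R).
Hypotheses (pD : forall x y, p (x + y) <= p x + p y)
  (pZ : forall (r : R) x, p (emb r *: x) <= `|r| * p x)
  (p_series : forall (u : nat -> E) x (c : R), u 0%N = 0 -> u @ \oo --> x ->
     (forall n, p (u n.+1 - u n) <= c / 2 ^+ n) -> p x <= c * 2).

Let pN x : p (- x) = p x.
Proof.
have h y : p (- y) <= p y.
  by have := pZ (-1) y; rewrite rmorphN rmorph1 scaleN1r normrN1 mul1r.
by apply/eqP; rewrite eq_le h -[leLHS](congr1 p (opprK x)) h.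
Qed.

(** The Baire category step of Zabreiko's lemma: some level set of p is dense in a ball. Otherwise
    nested balls can be chosen, the n-th step avoiding the set where p is at most n, and p could
    have no finite value at their common point. *)
Lemma seminorm_ball : exists (n : nat) (x0 : E) (r : R), 0 < r /\
  forall x, rnorm (x - x0) < r ->
    forall e : R, 0 < e -> exists2 y, p y <= n%:R & rnorm (y - x) < e.
Proof.
apply: contrapT => nex.
(* From a level n and a ball, a ball of at most half the radius inside it on which p exceeds n. The
   guard on the radius makes the relation total, so that [choice] applies. *)
have step (a : nat * (E * R)) : exists b : E * R, 0 < a.2.2 ->
    [/\ 0 < b.2, rnorm (b.1 - a.2.1) + b.2 <= a.2.2, b.2 <= a.2.2 / 2
      & forall y, rnorm (y - b.1) <= b.2 -> a.1%:R < p y].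
  case: a => n [x r] /=; have [r0|r0] := ltP 0 r; last by exists (x, r); lra.
  have : exists x', rnorm (x' - x) < r / 2 /\ exists2 e : R, 0 < e &
      forall y, p y <= n%:R -> e <= rnorm (y - x').
    apply: contrapT => h; apply: nex; exists n, x, (r / 2); split; first by lra.
    move=> x' xx' e e0; apply: contrapT => h'; apply: h; exists x'; split => //.
    by exists e => // y yn; rewrite leNgt; apply/negP => ye; apply: h'; exists y.
  move=> [x' [xx' [e e0 he]]]; exists (x', Num.min (e / 2) (r / 2)) => _ /=.
  have h1 : Num.min (e / 2) (r / 2) <= e / 2 by rewrite ge_min lexx.
  have h2 : Num.min (e / 2) (r / 2) <= r / 2 by rewrite ge_min lexx orbT.
  split=> //; [by rewrite lt_min; apply/andP; split; lra|lra|].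
  move=> y yx'; rewrite ltNge; apply/negP => /he; lra.
have [f fP] := choice step.
pose s := fix s n := if n is m.+1 then f (m, s m) else (0, 1 : R).
have s0 n : 0 < (s n).2.
  by elim: n => [|n IH] /=; [exact: ltr01|case: (fP (n, s n) IH)].
have sP n := fP (n, s n) (s0 n).
have r2 n : (s n).2 <= 1 / 2 ^+ n.
  elim: n => [|n IH]; first by rewrite expr0 divr1.
  have [_ _ + _] := sP n; rewrite exprS invfM mulrCA /=; lra.
have inc n m : rnorm ((s (n + m)%N).1 - (s n).1) + (s (n + m)%N).2 <= (s n).2.
  elim: m => [|m IH]; first by rewrite addn0 subrr rnorm0 add0r.
  have [_ h _ _] := sP (n + m)%N; rewrite addnS.
  have := @rdistD _ _ S _ (s (n + m)%N).1 (s (n + m).+1).1 (s n).1.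
  by move: h IH => /=; lra.
have [|l ul _] := @geometric_cvg _ _ _ _ (fun n => (s n).1) 1 hE.
  move=> n; apply: le_trans (r2 n); have := inc n 1%N; rewrite addn1.
  by have := s0 n.+1; lra.
have ln n : rnorm (l - (s n).1) <= (s n).2.
  apply: rnorm_cvg_le ul _; exists n => // m /= nm.
  by have := inc n (m - n)%N; rewrite subnKC //; have := s0 m; lra.
have : (Num.truncn (p l)).+1%:R < p l.
  by have [_ _ _ /(_ l (ln _.+1))] := sP (Num.truncn (p l)).+1.
by rewrite ltNge ltW // truncnS_gt.
Qed.

(** Zabreiko's lemma: on a Banach space a countably subadditive seminorm is bounded; [p_series] is
    countable subadditivity for geometrically small increments. As in the open mapping theorem,
    density of a level set in a ball is iterated to write x as a series. *)
Lemma seminorm_bounded : exists2 M : R, 0 <= M & forall x, p x <= M * rnorm x.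
Proof.
have p_ge0 x : 0 <= p x.
  have := pD x (- x); have := pD 0 0; rewrite addr0 subrr pN; lra.
have p0 : p 0 <= 0.
  by have := pZ 0 0; rewrite rmorph0 scale0r normr0 mul0r.
have [n [x0 [r [r0 h0]]]] := seminorm_ball.
have h1 k x : rnorm x < r / 2 ^+ k ->
    exists2 y, p y <= n%:R / 2 ^+ k & rnorm (x - y) < r / 2 ^+ k.+1.
  have k0 : 0 < 2 ^+ k :> R by rewrite exprn_gt0.
  have k0' : 2 ^+ k != 0 :> R by rewrite gt_eqF.
  move=> xr; set x' := @emb _ _ S (2 ^+ k) *: x.
  have x'r : rnorm x' < r.
    by rewrite rnormZe ger0_norm ?ltW // mulrC -ltr_pdivlMr.
  (* Half the difference of approximations of x0 + x' and x0 - x' approximates x', which moves the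
     centre of the ball to the origin; the factor 2^-k then undoes the dilation. *)
  have [|y1 p1 n1] := h0 (x0 + x') _ (r / 2) ltac:(lra); first by rewrite addrC addKr.
  have [|y2 p2 n2] := h0 (x0 - x') _ (r / 2) ltac:(lra).
    by rewrite addrC addKr rnormN.
  exists (@emb _ _ S (2^-1 / 2 ^+ k) *: (y1 - y2)).
    apply: le_trans (pZ _ _) _; rewrite gtr0_norm ?divr_gt0 //.
    have h : p (y1 - y2) <= n%:R * 2 by have := pD y1 (- y2); rewrite pN; lra.
    apply: le_trans (ler_wpM2l _ h) _; first by rewrite ltW // divr_gt0.
    by apply: eq_leW; field.
  have -> : x - @emb _ _ S (2^-1 / 2 ^+ k) *: (y1 - y2) =
      @emb _ _ S (2^-1 / 2 ^+ k) *: ((y2 - (x0 - x')) - (y1 - (x0 + x'))).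
    rewrite {1}(_ : x = @emb _ _ S (2^-1 / 2 ^+ k) *: (x' + x')); last first.
      rewrite /x' -scalerDl -rmorphD scalerA -rmorphM.
      by rewrite [X in emb X](_ : _ = 1) ?rmorph1 ?scale1r //; field.
    by rewrite -scalerBr; congr (_ *: _); zmod.
  rewrite rnormZe gtr0_norm ?divr_gt0 //.
  have h : rnorm (y2 - (x0 - x') - (y1 - (x0 + x'))) < r.
    by have := @rnormB _ _ S _ (y2 - (x0 - x')) (y1 - (x0 + x')); lra.
  apply: lt_le_trans (_ : 2^-1 / 2 ^+ k * r <= _).
    by rewrite ltr_pM2l // divr_gt0.
  by apply: eq_leW; rewrite exprS; field.
have /choice[g gP] (a : nat * E) : exists y, rnorm a.2 < r / 2 ^+ a.1 ->
    p y <= n%:R / 2 ^+ a.1 /\ rnorm (a.2 - y) < r / 2 ^+ a.1.+1.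
  case: a => k x; have [/h1[y py yx]|xr] := ltP (rnorm x) (r / 2 ^+ k).
    by exists y.
  by exists 0.
have h2 x : rnorm x < r -> p x <= n%:R * 2.
  (* s k is the remainder after k approximations, so x - s k are the partial sums to which
     [p_series] applies. *)
  move=> xr; pose s := fix s k := if k is m.+1 then s m - g (m, s m) else x.
  have sr k : rnorm (s k) < r / 2 ^+ k.
    elim: k => [|k IH]; first by rewrite expr0 divr1.
    by have [_] := gP (k, s k) IH.
  apply: (p_series (u := fun k => x - s k)) => [||k]; first by rewrite subrr.
    apply/cvg_seqP => e e0; have [m me] := small_geometric r e0.
    exists m => k mk; rewrite addrAC subrr add0r rnormN.
    apply: lt_trans (sr k) _; apply: le_lt_trans me; rewrite ler_pM2l //.
    by rewrite lef_pV2 ?posrE ?exprn_gt0 // ler_weXn2l // ler1n.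
  rewrite [X in p X](_ : _ = g (k, s k)); last by rewrite /=; zmod.
  by have [] := gP (k, s k) (sr k).
exists (n%:R * 4 / r); first by rewrite divr_ge0 ?mulr_ge0 // ltW.
move=> x; have [/eqP x0'|x_neq0] := eqVneq (rnorm x) 0.
  by rewrite (rnorm_eq0 (eqP x0')) rnorm0 mulr0.
have {}x_neq0 : 0 < rnorm x by rewrite lt_neqAle eq_sym x_neq0 rnorm_ge0.
have [c c0 cE] : exists2 c : R, 0 < c & c = rnorm x * 2 / r.
  by exists (rnorm x * 2 / r); rewrite ?divr_gt0 ?mulr_gt0.
have /h2 h : rnorm (@emb _ _ S c^-1 *: x) < r.
  rewrite rnormZe gtr0_norm ?invr_gt0 // cE.
  rewrite [ltLHS](_ : _ = r / 2); first by lra.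
  by field; rewrite !gt_eqF.
have := pZ c (@emb _ _ S c^-1 *: x).
rewrite scalerA -rmorphM divff ?gt_eqF // rmorph1 scale1r gtr0_norm //.
move=> /le_trans; apply; apply: le_trans (ler_wpM2l (ltW c0) h) _.
by apply: eq_leW; rewrite cE; field; rewrite gt_eqF.
Qed.

End Zabreiko.

Section BanachTheorems.
Context {R : realType} {K : numFieldType} {S : scalars R K}.
Variables (E F : normedModType K) (hE : banach E).

Lemma uniform_boundedness I (A : I -> {linear E -> F}) (P : set I) :
  (forall i, P i -> continuous (A i)) ->
  (forall x, exists M : R, forall i, P i -> rnorm (A i x) <= M) ->
  exists2 M : R, 0 <= M & forall i, P i -> forall x, rnorm (A i x) <= M * rnorm x.
Proof.
move=> Ac Ab.
(* The value 0 is adjoined so that the supremum is taken over a nonempty set even when P is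
   empty. *)
pose s x := [set r : R | r = 0 \/ exists2 i, P i & r = @rnorm _ _ S _ (A i x)].
have s_sup x : has_sup (s x).
  split; first by exists 0; left.
  have [M hM] := Ab x; exists `|M| => _ [->|[i Pi ->]] //.
  by apply: le_trans (hM i Pi) (ler_norm _).
have s_ub x i : P i -> rnorm (A i x) <= sup (s x).
  by move=> Pi; apply: ub_le_sup; [case: (s_sup x)|right; exists i].
have s_le x (c : R) : 0 <= c -> (forall i, P i -> rnorm (A i x) <= c) ->
    sup (s x) <= c.
  by move=> c0 h; apply: ge_sup; [exists 0; left|move=> _ [->//|[i Pi ->]]; exact: h].
have s_ge0 x : 0 <= sup (s x).
  by apply: ub_le_sup; [case: (s_sup x)|left].
have [|||M M0 hM] := seminorm_bounded hE (p := fun x => sup (s x)).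
- move=> x y; apply: s_le; first by rewrite addr_ge0.
  move=> i Pi; rewrite linearD; apply: le_trans (rnormD _ _) _.
  by rewrite lerD // s_ub.
- move=> r x; apply: s_le; first by rewrite mulr_ge0.
  by move=> i Pi; rewrite linearZ rnormZe ler_wpM2l // s_ub.
- move=> u x c u0 ux uc.
  have c0 : 0 <= c.
    by have := le_trans (s_ge0 _) (uc 0%N); rewrite expr0 divr1.
  apply: s_le => [|i Pi]; first by rewrite mulr_ge0.
  have Au : A i (u n) @[n --> \oo] --> A i x.
    by apply: continuous_cvg ux; exact: Ac.
  rewrite -[A i x]subr0; apply: rnorm_cvg_le Au _; exists 0%N => // n _ /=.
  have := @telescope_geometric _ _ S _ (fun n => A i (u n)) c _ 0%N n.
  rewrite add0n u0 linear0; move=> h; apply: le_trans (h _) _ => [k|].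
    by apply: le_trans (uc k); rewrite -linearB s_ub.
  by rewrite expr0 divr1 gerBl divr_ge0 ?mulr_ge0 ?exprn_ge0.
by exists M => // i Pi x; apply: le_trans (s_ub _ _ Pi) (hM x).
Qed.

Lemma closed_graph (hF : banach F) (f : {linear E -> F}) :
  (forall (u : nat -> E) x y, u @ \oo --> x -> f (u n) @[n --> \oo] --> y ->
     y = f x) ->
  exists2 M : R, 0 <= M & forall x, rnorm (f x) <= M * rnorm x.
Proof.
move=> fcl; apply: seminorm_bounded => // [x y|r x|u x c u0 ux uc].
- by rewrite linearD rnormD.
- by rewrite linearZ rnormZe.
have [n|l ul /(_ 0%N)] := @geometric_cvg _ _ S _ (fun n => f (u n)) c hF.
  by rewrite -linearB.
by rewrite u0 linear0 subr0 expr0 divr1 (fcl _ _ _ ux ul).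
Qed.

End BanachTheorems.

(** * Vector-valued calculus *)

Section Calculus.
Context {R : realType} {K : numFieldType} {S : scalars R K}.
Local Notation em := (@emb R K S).
Local Notation N := (@rnorm R K S _).
Implicit Types E F : normedModType K.

(** Continuous induction: by continuity the supremum of the times where phi is at most phi a is such
    a time, and the local hypothesis would push it further to the right if it were below b. *)
Lemma right_nonincreasing (phi : R -> R) (a b : R) : a <= b -> continuous phi ->
  (forall t, a <= t < b -> exists2 d : R, 0 < d &
     forall h, 0 < h < d -> phi (t + h) <= phi t) ->
  phi b <= phi a.
Proof.
move=> ab phic loc.
pose A := [set t | a <= t <= b /\ phi t <= phi a].
have Aa : A a by split => //; rewrite lexx.
have supA : has_sup A by split; [exists a|exists b => t [/andP[]]].
have as_ : a <= sup A by apply: ub_le_sup => //; case: supA.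
have sb : sup A <= b by apply: ge_sup; [exists a|move=> t [/andP[]]].
have phis : phi (sup A) <= phi a.
  rewrite leNgt; apply/negP => lt_phi.
  have e0 : 0 < phi (sup A) - phi a by lra.
  have /cvgrPdist_lt/(_ _ e0)/near_real[d d0 dP] := phic (sup A).
  have [r Ar rs] := sup_adherent d0 supA.
  have rs' : r <= sup A by apply: ub_le_sup => //; case: supA.
  have /ltr_normlP[] : `|phi (sup A) - phi r| < phi (sup A) - phi a.
    by apply: dP; apply/ltr_normlP; split; lra.
  by case: Ar => _; lra.
have [<-//|nsb] := eqVneq (sup A) b.
have {}sb : sup A < b by rewrite lt_neqAle nsb.
have [|d d0 dP] := loc (sup A); first by rewrite as_.
pose h := Num.min (d / 2) (b - sup A).
have h1 : h <= d / 2 by rewrite ge_min lexx.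
have h2 : h <= b - sup A by rewrite ge_min lexx orbT.
have h0 : 0 < h by rewrite lt_min; apply/andP; split; lra.
have : sup A + h <= sup A.
  apply: ub_le_sup; first by case: supA.
  split; first by apply/andP; split; lra.
  by apply: le_trans phis; apply: dP; apply/andP; split; lra.
lra.
Qed.

Definition der E (f : R -> E) (t : R) (l : E) := is_vderivative em f t l.

(** One-sided, because the generator of a semigroup only controls difference quotients from the
    right. *)
Definition rder E (f : R -> E) (t : R) (l : E) :=
  (em h)^-1 *: (f (t + h) - f t) @[h --> 0^'+] --> l.

Lemma quotient_dist E (h : R) (x l : E) : h != 0 ->
  N ((em h)^-1 *: x - l) = `|h|^-1 * N (x - em h *: l).
Proof.
move=> h0; rewrite -normfV -[RHS](@rnormZe _ _ S) scalerBr scalerA.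
by rewrite fmorphV mulVf ?scale1r // fmorph_eq0.
Qed.

Lemma rderP E (f : R -> E) t l : rder f t l <->
  forall e : R, 0 < e -> exists2 d : R, 0 < d &
    forall h : R, 0 < h -> h < d -> N (f (t + h) - f t - em h *: l) <= e * h.
Proof.
split=> [/(@cvg_rnorm _ _ S) fl e e0|fl].
  have /near_right[d d0 dP] := fl _ e0; exists d => // h h0 hd.
  have := dP h h0; rewrite add0r => /(_ hd); rewrite quotient_dist ?gt_eqF //.
  by rewrite gtr0_norm // ltr_pdivrMl // => /ltW; rewrite mulrC.
apply/(@cvg_rnorm _ _ S) => e e0; have [d d0 dP] := fl (e / 2) ltac:(lra).
apply/near_right; exists d => // h h0; rewrite add0r => hd.
rewrite quotient_dist ?gt_eqF // gtr0_norm // ltr_pdivrMl //.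
by apply: le_lt_trans (dP _ h0 hd) _; rewrite mulrC ltr_pM2l //; lra.
Qed.

Lemma derP E (f : R -> E) t l : der f t l <->
  forall e : R, 0 < e -> exists2 d : R, 0 < d &
    forall h : R, `|h| < d -> N (f (t + h) - f t - em h *: l) <= e * `|h|.
Proof.
split=> [/(@cvg_rnorm _ _ S) fl e e0|fl].
  have /near_dnbhs[d d0 dP] := fl _ e0; exists d => // h hd.
  have [->|h0] := eqVneq h 0.
    by rewrite addr0 subrr rmorph0 scale0r subrr rnorm0 normr0 mulr0.
  have := dP h h0; rewrite subr0 => /(_ hd); rewrite quotient_dist //.
  by rewrite ltr_pdivrMl ?normr_gt0 // => /ltW; rewrite mulrC.
apply/(@cvg_rnorm _ _ S) => e e0; have [d d0 dP] := fl (e / 2) ltac:(lra).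
apply/near_dnbhs; exists d => // h h0; rewrite subr0 => hd.
rewrite quotient_dist // ltr_pdivrMl ?normr_gt0 //.
apply: le_lt_trans (dP _ hd) _; rewrite mulrC ltr_pM2l ?normr_gt0 //; lra.
Qed.

Lemma der_rder E (f : R -> E) t l : der f t l -> rder f t l.
Proof.
move=> /derP fl; apply/rderP => e /fl[d d0 dP]; exists d => // h h0 hd.
by have := dP h; rewrite gtr0_norm //; exact.
Qed.

Lemma der_continuous E (f : R -> E) t l : der f t l -> {for t, continuous f}.
Proof.
move=> /derP/(_ 1 ltr01)[d d0 dP]; apply/(@continuous_real_rnorm _ _ S) => e e0.
have c0 : 0 < 1 + N l by rewrite ltr_pwDl // rnorm_ge0.
exists (Num.min d (e / (1 + N l))); first by rewrite lt_min d0 divr_gt0.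
move=> s; rewrite lt_min ltr_pdivlMr // => /andP[sd se].
apply: le_lt_trans se; have := dP _ sd; rewrite subrKC mul1r.
have := @rdistD _ _ S _ (em (s - t) *: l) (f s - f t) 0.
by rewrite !subr0 rnormZe; lra.
Qed.

Lemma rnorm_continuous E (f : R -> E) (x : E) :
  continuous f -> continuous (fun t => N (f t - x)).
Proof.
move=> fc t; apply/cvgrPdist_lt => e e0; apply/near_real.
have /(@continuous_real_rnorm _ _ S)/(_ e e0)[d d0 dP] := fc t.
exists d => // s /dP; apply: le_lt_trans; apply/ler_normlP.
have := @rdistD _ _ S _ (f s) (f t) x; have := @rdistD _ _ S _ (f t) (f s) x.
by rewrite (rdistC (f t) (f s)); split; lra.
Qed.

(* Only a Dini-type bound from the right is required, so that one-sided
   derivatives of orbits suffice. *)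
Lemma mean_value_right E (f : R -> E) (g : R -> R) (a b : R) : a <= b ->
  continuous f -> continuous g ->
  (forall t, a <= t < b -> forall e : R, 0 < e -> exists2 d : R, 0 < d &
    forall h : R, 0 < h -> h < d -> N (f (t + h) - f t) <= g (t + h) - g t + e * h) ->
  N (f b - f a) <= g b - g a.
Proof.
move=> ab fc gc loc; apply/ler_addgt0Pr => e e0.
have ba0 : 0 < b - a + 1 by lra.
pose k : R := e / (b - a + 1); have k0 : 0 < k by rewrite divr_gt0.
have := @right_nonincreasing (fun t => N (f t - f a) - g t - k * t) a b ab.
rewrite subrr rnorm0 => h.
suff : N (f b - f a) - g b - k * b <= 0 - g a - k * a.
  have : k * (b - a + 1) = e by rewrite /k divfK ?gt_eqF.
  by have := k0; rewrite mulrDr mulrBr mulr1; lra.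
apply: h => [t|t tab].
  apply: cvgB; last by apply: cvgM; [exact: cvg_cst|exact: cvg_id].
  by apply: cvgB; [exact: rnorm_continuous|exact: gc].
have [d d0 dP] := loc t tab k k0; exists d => // h /andP[h0 hd].
have := dP h h0 hd; have := @rdistD _ _ S _ (f t) (f (t + h)) (f a).
by rewrite mulrDr; lra.
Qed.

(** The comparison function needs only supporting lines to the right, not a derivative. For the
    exponentials of the Picard estimates this is [expR_ge1Dx]. *)
Lemma mean_value_convex E (f f' : R -> E) (g g' : R -> R) (a b : R) : a <= b ->
  continuous f -> continuous g ->
  (forall t, a <= t < b -> rder f t (f' t)) ->
  (forall t, a <= t < b -> N (f' t) <= g' t) ->
  (forall t h, a <= t < b -> 0 < h -> g t + h * g' t <= g (t + h)) ->
  N (f b - f a) <= g b - g a.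
Proof.
move=> ab fc gc ff' f'g' gg'; apply: mean_value_right => // t tab e e0.
have /rderP/(_ e e0)[d d0 dP] := ff' t tab; exists d => // h h0 hd.
have := dP h h0 hd; have := gg' t h tab h0.
have := @rdistD _ _ S _ (em h *: f' t) (f (t + h) - f t) 0.
rewrite !subr0 rnormZe gtr0_norm //.
by have := ler_wpM2l (ltW h0) (f'g' t tab); lra.
Qed.

Lemma mean_value E (f f' : R -> E) (M a b : R) : a <= b -> continuous f ->
  (forall t, a <= t < b -> rder f t (f' t)) ->
  (forall t, a <= t < b -> N (f' t) <= M) ->
  N (f b - f a) <= M * (b - a).
Proof.
move=> ab fc ff' fM; rewrite mulrBr.
apply: (@mean_value_convex _ f f' (fun t => M * t) (fun=> M)) => //.
  by move=> t; apply: cvgM; [exact: cvg_cst|exact: cvg_id].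
by move=> t h _ _; lra.
Qed.

Lemma rder0_eq E (f : R -> E) (a b : R) : a <= b -> continuous f ->
  (forall t, a <= t < b -> rder f t 0) -> f b = f a.
Proof.
move=> ab fc f0; apply/eqP; rewrite -subr_eq0; apply/eqP/rnorm_le0.
rewrite -(mul0r (b - a)); apply: (@mean_value _ f (fun=> 0)) => // t _.
by rewrite rnorm0.
Qed.

Lemma rder0_const E (f : R -> E) : continuous f -> (forall t, rder f t 0) ->
  forall s t, f s = f t.
Proof.
move=> fc f0 s t; have [st|/ltW ts] := leP s t; last exact: rder0_eq.
by apply/esym; exact: rder0_eq.
Qed.

End Calculus.

(** * Primitives and Riemann integrals of continuous vector-valued functions *)

Section Primitive.
Context {R : realType} {K : numFieldType} {S : scalars R K}.
Local Notation em := (@emb R K S).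
Local Notation N := (@rnorm R K S _).
Variable E : normedModType K.
Implicit Types f F : R -> E.

Lemma uniform_continuity f (T e : R) : continuous f -> 0 < e ->
  exists2 d : R, 0 < d & forall s t : R, `|s| <= T -> `|t - s| < d -> N (f t - f s) < e.
Proof.
move=> fc e0.
have /compact_near_coveringP cov := @segment_compact R (- T) T.
have : \forall d \near 0^'+, `[- T, T] `<=`
    (fun s => forall t, `|t - s| < d -> N (f t - f s) < e).
  apply: cov => x _.
  have /(@continuous_real_rnorm _ _ S)/(_ (e / 2))[|d d0 dP] := fc x; first by lra.
  exists ([set s | `|s - x| < d / 2], [set r | r < d / 2]) => /=.
    split; first by apply/near_real; exists (d / 2) => //; lra.
    by apply/near_right; exists (d / 2) => [|r _ /=]; lra.
  move=> [s r] /= [sx rd] t ts.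
  have h1 : N (f s - f x) < e / 2 by apply: dP; lra.
  have h2 : N (f t - f x) < e / 2.
    by apply: dP; have := ler_distD s t x; lra.
  have := @rdistD _ _ S _ (f x) (f t) (f s).
  by rewrite (@rdistC _ _ S _ (f x) (f s)); lra.
move=> /near_right[d d0 dP]; exists (d / 2); first by lra.
move=> s t sT ts; apply: (dP (d / 2)) => //; try lra.
by rewrite /= in_itv /= -ler_norml.
Qed.

(** Estimates proportional to the length of an interval are stable under concatenation, so proving
    them on short intervals is enough. *)
Lemma chain_ind (P : R -> R -> Prop) (a b d : R) : 0 < d -> a <= b ->
  (forall s t : R, a <= s -> s <= t -> t <= b -> t - s < d -> P s t) ->
  (forall r s t : R, a <= r -> r <= s -> s <= t -> t <= b -> P r s -> P s t -> P r t) ->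
  P a b.
Proof.
move=> d0 ab Pd Ptr.
suff h n t : a <= t -> t <= b -> t - a <= n%:R * (d / 2) -> P a t.
  apply: (h (Num.truncn ((b - a) / (d / 2))).+1) => //.
  by rewrite -ler_pdivrMr ?divr_gt0 // ltW // truncnS_gt.
elim: n t => [|n IH] t at_ tb tn; first by apply: Pd => //; lra.
rewrite -natr1 mulrDl mul1r in tn; have := ler0n R n => n0.
have [ta|ta] := leP (t - d / 2) a; first by apply: Pd => //; lra.
by apply: (Ptr _ (t - d / 2)); [..|apply: IH|apply: Pd]; lra.
Qed.

(** w is the length of the intersection of [s, t] and [y, z]. *)
Lemma min_increment (s t y z : R) : s <= t -> y <= z ->
  let w := (Num.min t z - Num.min t y) - (Num.min s z - Num.min s y) in
  0 <= w /\ (0 < w -> y <= t /\ s <= z).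
Proof.
move=> st yz /=; case: (leP t z); case: (leP t y); case: (leP s z);
  by case: (leP s y); split; lra.
Qed.

Section Polygon.
Variables (f : R -> E) (n : nat).
(** The grid has mesh 1/(n+1) and 2(n+1)^2 cells, hence covers [-(n+1), n+1]: as n grows it is
    refined and exhausts the line. *)
Let h : R := n.+1%:R^-1.
Let x (k : nat) : R := k%:R * h - n.+1%:R.
Let m := (n.+1 * n.+1).*2.

(* The primitive of the step function equal to [f (x k)] on [x k, x k.+1[. *)
Definition polygon (t : R) : E :=
  \sum_(k < m) em (Num.min t (x k.+1) - Num.min t (x k)) *: f (x k).

(** The increment over [s, t] is a sum of node values with weights of total mass t - s. A cell with
    positive weight meets [s, t], so its left node lies in [s - h, t]; hence the window in the
    hypothesis. *)
Lemma polygon_approx (s t : R) (v : E) (e : R) :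
  - n.+1%:R <= s -> s <= t -> t <= n.+1%:R ->
  (forall r : R, s - h <= r -> r <= t -> N (f r - v) <= e) ->
  N (polygon t - polygon s - em (t - s) *: v) <= e * (t - s).
Proof.
move=> ns st tn fv.
have h0 : 0 < h by rewrite invr_gt0.
have xS k : x k.+1 = x k + h by rewrite /x -natr1 mulrDl mul1r; ring.
pose w k := (Num.min t (x k.+1) - Num.min t (x k)) -
            (Num.min s (x k.+1) - Num.min s (x k)).
have x_le k : x k <= x k.+1 by rewrite xS lerDl ltW.
have w_ge0 k : 0 <= w k by case: (min_increment st (x_le k)).
have wf k : w k * N (f (x k) - v) <= w k * e.
  have [wk|wk] := ltP 0 (w k); last first.
    have -> : w k = 0 by apply/eqP; rewrite eq_le wk w_ge0.
    by rewrite !mul0r.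
  have [_ /(_ wk)[xt sx]] := min_increment st (x_le k).
  by rewrite ler_pM2l //; apply: fv => //; rewrite lerBlDr -xS.
have sum_w : \sum_(k < m) w k = t - s.
  rewrite sumrB -!(big_mkord xpredT (fun k => Num.min _ (x k.+1) - Num.min _ (x k))).
  rewrite !telescope_sumr //.
  have -> : x m = n.+1%:R.
    rewrite /x /m /h -muln2 !natrM; field.
    by rewrite addrC natr1 pnatr_eq0.
  have -> : x 0%N = - n.+1%:R by rewrite /x mul0r sub0r.
  rewrite !(min_l tn) !(min_r (le_trans ns st)) !(min_r ns) min_l ?(le_trans st) //.
  ring.
rewrite -sum_w.
rewrite /polygon -sumrB rmorph_sum scaler_suml -sumrB.
rewrite [X in N X](_ : _ = \sum_(k < m) em (w k) *: (f (x k) - v)); last first.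
  by apply: eq_bigr => k _; rewrite -scalerBl -rmorphB scalerBr.
apply: le_trans (@rnorm_sum _ _ S _ m (fun k => em (w k) *: (f (x k) - v))) _.
by rewrite mulr_sumr; apply: ler_sum => k _; rewrite rnormZe ger0_norm // mulrC [leRHS]mulrC mulrC.
Qed.

End Polygon.
Lemma polygon_local f (T e : R) : continuous f -> 0 < e ->
  exists2 d : R, 0 < d & exists m, forall n, (m <= n)%N ->
    forall s r t : R, - T <= s -> s <= r -> r <= t -> t <= T -> t - s < d ->
    N (polygon f n t - polygon f n s - em (t - s) *: f r) <= e * (t - s).
Proof.
move=> fc e0; have [d d0 dP] := uniform_continuity T fc e0.
exists (d / 2); first by lra.
(* n+1 above T makes the grid cover the interval; n+1 above 2/d makes the mesh smaller than d/2, so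
   that the window of [polygon_approx] is shorter than d. *)
pose c := Num.max T (2 / d).
have cT : T <= c by rewrite le_max lexx.
have cd : 2 / d <= c by rewrite le_max lexx orbT.
exists (Num.truncn c) => n mn s r t Ts sr rt tT tsd.
have cn : c < n.+1%:R by apply: lt_le_trans (truncnS_gt _) _; rewrite ler_nat.
have hd : n.+1%:R^-1 < d / 2.
  by rewrite -[ltRHS]invf_div ltf_pV2 ?posrE ?divr_gt0 //; lra.
apply: polygon_approx; try lra.
move=> q sq qt; apply/ltW/dP; first by rewrite ler_norml; lra.
by rewrite ltr_norml; move: (n.+1%:R^-1) hd sq => h hd sq; lra.
Qed.

(** On a short interval both polygons are compared with the same affine function of slope f s;
    [chain_ind] makes the bound global. *)
Lemma polygon_cauchy f (T e : R) : continuous f -> 0 < e ->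
  exists m, forall n p, (m <= n)%N -> (m <= p)%N ->
    forall s t : R, - T <= s -> s <= t -> t <= T ->
    N ((polygon f n t - polygon f n s) - (polygon f p t - polygon f p s)) <=
      e * (t - s).
Proof.
move=> fc e0; have [|d d0 [m mP]] := @polygon_local f T (e / 2) fc; first by lra.
exists m => n p mn mp s t Ts st tT.
apply: (chain_ind (P := fun s t => N ((polygon f n t - polygon f n s) -
    (polygon f p t - polygon f p s)) <= e * (t - s)) d0 st).
  move=> s' t' ss' st' tt' td.
  have h q : (m <= q)%N -> N (polygon f q t' - polygon f q s' -
      em (t' - s') *: f s') <= e / 2 * (t' - s').
    by move=> mq; apply: mP => //; lra.
  apply: le_trans (@rdistD _ _ S _ (em (t' - s') *: f s') _ _) _.
  by rewrite (rdistC (em _ *: _)); have := h n mn; have := h p mp; lra.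
move=> r' s' t' _ _ _ _ h1 h2.
have := @rnormD _ _ S _ (polygon f n s' - polygon f n r' -
  (polygon f p s' - polygon f p r')) (polygon f n t' - polygon f n s' -
  (polygon f p t' - polygon f p s')).
rewrite [X in N X <= _ -> _](_ : _ = polygon f n t' - polygon f n r' -
  (polygon f p t' - polygon f p r')); last by zmod.
lra.
Qed.

(** The limit of the polygons, normalised at 0, inherits the estimate of [polygon_local], which is
    differentiability. As the tag r is any point of [s, q], taking r = s and r = q covers increments
    to the right and to the left. *)
Lemma primitive_exists f : banach E -> continuous f ->
  exists F : R -> E, F 0 = 0 /\ forall t, der F t (f t).
Proof.
move=> hE fc.
pose u t n := polygon f n t - polygon f n 0.
have uC (T e : R) : 0 < e -> exists m, forall n p, (m <= n)%N -> (m <= p)%N ->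
    forall t : R, `|t| <= T -> N (u t n - u t p) <= e.
  move=> e0; have T1 : 0 < `|T| + 1 by rewrite ltr_wpDl.
  have [|m mP] := @polygon_cauchy f `|T| (e / (`|T| + 1)) fc.
    by rewrite divr_gt0.
  exists m => n p mn mp t tT.
  have {}tT : `|t| <= `|T| by apply: le_trans tT (ler_norm _).
  have tT' := tT; rewrite ler_norml in tT'; case/andP: tT' => T1' T2'.
  have Tge0 := normr_ge0 T.
  apply: le_trans (_ : e / (`|T| + 1) * `|t| <= _); last first.
    by rewrite mulrAC ler_pdivrMr // ler_pM2l //; lra.
  have [t0|t0] := leP 0 t.
    by rewrite (ger0_norm t0) -[t in leRHS]subr0; apply: mP => //; lra.
  rewrite rdistC (ltr0_norm t0) -[- t]add0r.
  rewrite [X in N X](_ : _ = polygon f n 0 - polygon f n t -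
    (polygon f p 0 - polygon f p t)); last by rewrite /u; zmod.
  by apply: mP => //; lra.
have /choice[F FP] t : exists l : E, u t @ \oo --> l.
  apply: hE => e e0; have [|m mP] := uC `|t| (e / 2); first by lra.
  exists m => p q mp mq; apply: le_lt_trans (mP _ _ mp mq t _) _ => //; lra.
have F0 : F 0 = 0.
  apply: rnorm_le0; rewrite -[F 0]subr0; apply: rnorm_cvg_le (FP 0) _.
  by exists 0%N => // n _ /=; rewrite /u subrr subr0 rnorm0.
exists F; split => // t; apply/derP => e e0.
have [d d0 [m mP]] := @polygon_local f (`|t| + 1) e fc e0.
have loc (s r q : R) : - (`|t| + 1) <= s -> s <= r -> r <= q -> q <= `|t| + 1 ->
    q - s < d -> N (F q - F s - em (q - s) *: f r) <= e * (q - s).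
  move=> h1 h2 h3 h4 h5; have Fqs : u q n - u s n @[n --> \oo] --> F q - F s.
    by apply: cvgB.
  apply: rnorm_cvg_le Fqs _; exists m => // n /= mn.
  by rewrite /u opprB addrA subrK; exact: mP.
have := ler_norm t; have := ler_norm (- t); rewrite normrN => t1 t2.
exists (Num.min d 1); first by rewrite lt_min d0 ltr01.
move=> h; rewrite lt_min => /andP[]; have [h0|h0] := leP 0 h.
  rewrite ger0_norm // => hd h1; have := loc t t (t + h).
  by rewrite [t + h - t]addrC addKr; apply; lra.
rewrite ltr0_norm // => hd h1; have := loc (t + h) t t.
rewrite [t - _](_ : _ = - h); last by ring.
rewrite rmorphN scaleNr opprK => loc'.
by rewrite -rnormN opprD opprB opprK; apply: loc'; lra.
Qed.

(** A total function, with the zero function as default value if f has no primitive; [primP] is its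
    specification for continuous f. *)
Definition prim f : R -> E :=
  xget (fun=> 0) [set F : R -> E | F 0 = 0 /\ forall t, der F t (f t)].

Lemma primP f : banach E -> continuous f ->
  prim f 0 = 0 /\ forall t, der (prim f) t (f t).
Proof.
move=> hE fc; rewrite /prim; case: xgetP => [F _ //|noF].
by have [F FP] := primitive_exists hE fc; case: (noF F).
Qed.

Lemma eq_fun_cvg T (G : set_system T) (f g : T -> E) (l : E) :
  f =1 g -> g x @[x --> G] --> l -> f x @[x --> G] --> l.
Proof. by move=> /funext ->. Qed.

Lemma derB f F (l m : E) t : der f t l -> der F t m ->
  der (fun t => f t - F t) t (l - m).
Proof.
move=> fl Fm; apply: eq_fun_cvg (cvgB fl Fm) => h.
by rewrite -[RHS]scalerBr; congr (_ *: _); zmod.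
Qed.

Lemma der_line (c : E) (t : R) : der (fun t => em t *: c) t c.
Proof.
apply/derP => e e0; exists 1 => // h _.
rewrite [X in N X](_ : _ = 0); last by rewrite rmorphD scalerDl; zmod.
by rewrite rnorm0 mulr_ge0 // ltW.
Qed.

Lemma rderB f F (l m : E) t : rder f t l -> rder F t m ->
  rder (fun t => f t - F t) t (l - m).
Proof.
move=> fl Fm; apply: eq_fun_cvg (cvgB fl Fm) => h.
by rewrite -[RHS]scalerBr; congr (_ *: _); zmod.
Qed.

Lemma prim_continuous f : banach E -> continuous f -> continuous (prim f).
Proof.
by move=> hE fc t; have [_ /(_ t)] := primP hE fc; exact: der_continuous.
Qed.

Lemma prim_unique f F : banach E -> continuous f -> continuous F ->
  (forall t, rder F t (f t)) -> forall s t, F t - F s = prim f t - prim f s.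
Proof.
move=> hE fc Fc Ff s t; have [_ pf] := primP hE fc.
have h : F t - prim f t = F s - prim f s.
  apply: (@rder0_const _ _ S _ (fun t => F t - prim f t)).
    by move=> r; apply: cvgB; [exact: Fc|exact: prim_continuous].
  by move=> r; rewrite -(subrr (f r)); apply: rderB => //; apply: der_rder.
by rewrite -[F t](subrK (prim f t)) h; zmod.
Qed.

(** A continuous right derivative is a two-sided one, since F differs from [prim f] by a constant.
    This turns one-sided generator information into derivatives of orbits. *)
Lemma prim_der_rder f F t : banach E -> continuous f -> continuous F ->
  (forall t, rder F t (f t)) -> der F t (f t).
Proof.
move=> hE fc Fc Ff; have [_ /(_ t) pf] := primP hE fc.
by apply: eq_fun_cvg pf => h; rewrite (prim_unique hE fc Fc Ff).
Qed.

(** The increments of the primitive telescope. On each cell, [prim f] minus the line of slope f (tau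
    k) has derivative f t - f (tau k), which uniform continuity makes small. *)
Lemma riemann_integral_prim f (a b : R) : banach E -> continuous f -> a <= b ->
  is_riemann_integral em f a b (prim f b - prim f a).
Proof.
move=> hE fc ab _ /(@pos_emb _ _ S)[e e0 <-].
have [_ pf] := primP hE fc.
have c0 : 0 < b - a + 1 by lra.
pose e' : R := e / (b - a + 1); have e'0 : 0 < e' by rewrite divr_gt0.
have e'ba : e' * (b - a) < e.
  by rewrite mulrAC ltr_pdivrMr // ltr_pM2l //; lra.
have [d d0 dP] := uniform_continuity (Num.max `|a| `|b|) fc e'0.
exists d => // n p tau p0 pn ptau.
have le_p i : (i <= n)%N -> a <= p i.
  elim: i => [|i IH] iN; first by rewrite p0.
  have [h1 h2 _] := ptau i iN; apply: le_trans (IH (ltnW iN)) _.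
  exact: le_trans h1 h2.
have p_le i : (i <= n)%N -> p (n - i)%N <= b.
  elim: i => [|i IH] iN; first by rewrite subn0 pn.
  apply: le_trans (IH (ltnW iN)); have [|h1 h2 _] := ptau (n - i.+1)%N.
    by rewrite -subSn // subSS leq_subr.
  by rewrite -subSn // subSS in h2; exact: le_trans h1 h2.
rewrite (normE_lt (S := S)) -{1}pn -{1}p0.
rewrite -(telescope_sumr (fun k => prim f (p k)) (leq0n n)) big_mkord -sumrB.
apply: le_lt_trans (@rnorm_sum _ _ S _ n (fun k => prim f (p k.+1) -
  prim f (p k) - em (p k.+1 - p k) *: f (tau k))) _.
apply: le_lt_trans e'ba; rewrite -[in leRHS]pn -[in leRHS]p0.
rewrite -(telescope_sumr p (leq0n n)) big_mkord mulr_sumr.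
apply: ler_sum => k _; have [h1 h2 h3] := ptau k (ltn_ord k).
have h4 := le_p k (ltnW (ltn_ord k)).
have h5 : p k.+1 <= b by rewrite -(subKn (ltn_ord k)) p_le // leq_subr.
pose c := f (tau k).
rewrite rmorphB scalerBl [X in N X](_ : _ = (prim f (p k.+1) - em (p k.+1) *: c) -
  (prim f (p k) - em (p k) *: c)); last by zmod.
have cder t : der (fun t => prim f t - em t *: c) t (f t - c).
  by apply: derB => //; exact: der_line.
apply: (@mean_value _ _ S _ (fun t => prim f t - em t *: c) (fun t => f t - c)).
- exact: le_trans h1 h2.
- by move=> t; exact: der_continuous (cder t).
- by move=> t _; exact: der_rder.
move=> t /andP[pt tp]; apply/ltW/dP.
  rewrite le_max; case: (leP 0 (tau k)) => tau0.
    by rewrite orbC ger0_norm // (le_trans _ (ler_norm b)) //; lra.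
  by rewrite ltr0_norm // -[`|a|]normrN (le_trans _ (ler_norm (- a))) //; lra.
by rewrite ltr_norml; lra.
Qed.

(** Both values are close to one and the same Riemann sum: equidistant nodes, left tags, mesh below
    both moduli. *)
Lemma riemann_integral_unique f (a b : R) (I J : E) : a <= b ->
  is_riemann_integral em f a b I -> is_riemann_integral em f a b J -> I = J.
Proof.
move=> ab fI fJ; apply/eqP; rewrite -subr_eq0; apply/eqP/rnorm_le0.
apply/ler_addgt0Pr => e e0; rewrite add0r.
have e20 : 0 < em (e / 2) by rewrite -(rmorph0 em) emb_lt; lra.
have [d d0 dI] := fI _ e20; have [d' d'0 dJ] := fJ _ e20.
pose c := Num.min d d'; have c0 : 0 < c by rewrite lt_min d0.
have cd : c <= d by rewrite ge_min lexx.
have cd' : c <= d' by rewrite ge_min lexx orbT.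
pose n := (Num.truncn ((b - a) / c)).+1.
have nc : (b - a) / n%:R < c.
  by rewrite ltr_pdivrMr ?ltr0n // mulrC -ltr_pdivrMr // truncnS_gt.
have n0 : n%:R != 0 :> R by rewrite pnatr_eq0.
pose p k := a + k%:R * ((b - a) / n%:R).
have pS k : p k.+1 = p k + (b - a) / n%:R by rewrite /p -natr1; ring.
have step0 : 0 <= (b - a) / n%:R by rewrite divr_ge0 // subr_ge0.
have p0 : p 0%N = a by rewrite /p mul0r addr0.
have pn : p n = b by rewrite /p; field.
have h k : (k < n)%N -> [/\ p k <= p k, p k <= p k.+1 & p k.+1 - p k < c].
  by move=> _; rewrite pS; split; lra.
have h1 : N (I - \sum_(k < n) em (p k.+1 - p k) *: f (p k)) < e / 2.
  rewrite -(normE_lt (S := S)); apply: dI => // k /h[? ? kc]; split=> //.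
  exact: lt_le_trans kc cd.
have h2 : N (J - \sum_(k < n) em (p k.+1 - p k) *: f (p k)) < e / 2.
  rewrite -(normE_lt (S := S)); apply: dJ => // k /h[? ? kc]; split=> //.
  exact: lt_le_trans kc cd'.
rewrite rdistC in h2; apply: le_trans (rdistD _ _ _) _.
by apply/ltW; apply: lt_le_trans (ltrD h1 h2) _; lra.
Qed.

Lemma vintegral_prim f (t : R) : banach E -> continuous f ->
  vintegral em f 0 t = prim f t.
Proof.
move=> hE fc; have [p0 _] := primP hE fc; rewrite /vintegral.
case: (leP 0 t) => t0; case: xgetP => [I _ fI|noI].
- by rewrite (riemann_integral_unique t0 fI (riemann_integral_prim hE fc t0)) p0 subr0.
- by case: (noI _ (riemann_integral_prim hE fc t0)).
- move/ltW in t0.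
  rewrite (riemann_integral_unique t0 fI (riemann_integral_prim hE fc t0)) p0.
  by rewrite sub0r opprK.
- by case: (noI _ (riemann_integral_prim hE fc (ltW t0))).
Qed.

End Primitive.

(** * Semigroups and groups *)

Section Semigroups.
Context {R : realType} {K : numFieldType} {S : scalars R K}.
Local Notation em := (@emb R K S).
Local Notation N := (@rnorm R K S _).
Local Notation banach := (@banach R K S).
Local Notation der := (@der R K S _).
Local Notation rder := (@rder R K S _).
Local Notation prim := (@prim R K S _).
Implicit Types E F : normedModType K.

Lemma eq_right_cvg E (f g : R -> E) (l : E) :
  (forall h, 0 < h -> f h = g h) ->
  g h @[h --> 0^'+] --> l -> f h @[h --> 0^'+] --> l.
Proof.
move=> fg /(@cvg_rnorm _ _ S) gl; apply/(@cvg_rnorm _ _ S) => e /gl.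
move=> /near_right[d d0 dP]; apply/near_right; exists d => // h h0 hd.
by rewrite fg //; exact: dP.
Qed.

Lemma bounded_real (f : R -> R) (T : R) : continuous f ->
  exists M : R, forall t, `|t| <= T -> f t <= M.
Proof.
move=> fc; have [T0|T0] := leP 0 T; last first.
  by exists 0 => t tT; have := normr_ge0 t; lra.
have [||c _ cM] := @EVT_max R f (- T) T; first by lra.
  exact: continuous_subspaceT.
by exists (f c) => t tT; apply: cM; rewrite in_itv /= -ler_norml.
Qed.

Definition strong_family E F (A : R -> {linear E -> F}) :=
  (forall t, continuous (A t)) /\ forall x, continuous (fun t => A t x).

Lemma strong_family_bound E F (A : R -> {linear E -> F}) (T : R) :
  banach E -> strong_family A ->
  exists2 M : R, 0 <= M & forall t, `|t| <= T -> forall x, N (A t x) <= M * N x.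
Proof.
move=> hE [Ac Ax]; apply: (uniform_boundedness hE (P := fun t => `|t| <= T)) => //.
move=> x; apply: (bounded_real (f := fun t => N (A t x))).
have := @rnorm_continuous _ _ S _ _ 0 (Ax x).
by rewrite (_ : (fun t => _) = (fun t => N (A t x))) //; apply/funext => t; rewrite subr0.
Qed.

(** Joint continuity in time and vector: local uniform boundedness controls the moving vector,
    strong continuity the moving time. *)
Lemma family_cvg E F (A : R -> {linear E -> F}) I (G : set_system I)
    (FG : Filter G) (s : I -> R) (f : I -> E) (s0 : R) (y : E) :
  banach E -> strong_family A -> s i @[i --> G] --> s0 -> f i @[i --> G] --> y ->
  A (s i) (f i) @[i --> G] --> A s0 y.
Proof.
move=> hE Afam ss0 fy.
have [M M0 AM] := strong_family_bound (`|s0| + 1) hE Afam.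
have M1 : 0 < M + 1 by rewrite ltr_wpDl.
apply/(@cvg_rnorm _ _ S) => e e0.
have f1 : \forall i \near G, N (f i - y) < e / 2 / (M + 1).
  by move: fy => /(@cvg_rnorm _ _ S); apply; rewrite !divr_gt0.
have f2 : \forall i \near G, N (A (s i) y - A s0 y) < e / 2.
  have := @continuous_cvg _ _ _ G _ s (fun t => A t y) s0 (Afam.2 y s0) ss0.
  move=> /(_ FG) /(@cvg_rnorm _ _ S).
  by apply; lra.
have f3 : \forall i \near G, `|s i| <= `|s0| + 1.
  move: ss0 => /cvgrPdist_lt/(_ 1 ltr01); apply: filterS => i si.
  by have := lerB_dist (s i) s0; rewrite distrC; lra.
apply: filterS3 f1 f2 f3 => i h1 h2 h3.
rewrite ltr_pdivlMr // in h1.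
have := AM _ h3 (f i - y); rewrite linearB.
have := @rdistD _ _ S _ (A (s i) y) (A (s i) (f i)) (A s0 y).
by have := @rnorm_ge0 _ _ S _ (f i - y); rewrite mulrDr mulr1 mulrC in h1; lra.
Qed.

Lemma linear_cvg E F (A : {linear E -> F}) I (G : set_system I) (FG : Filter G)
  (f : I -> E) (y : E) :
  continuous A -> f i @[i --> G] --> y -> A (f i) @[i --> G] --> A y.
Proof. by move=> Ac fy; apply: continuous_cvg fy; exact: Ac. Qed.

Lemma family_continuous E F (A : R -> {linear E -> F}) (s : R -> R) (f : R -> E) :
  banach E -> strong_family A -> continuous s -> continuous f ->
  continuous (fun t => A (s t) (f t)).
Proof. by move=> hE Afam sc fc t; apply: family_cvg => //; [exact: sc|exact: fc]. Qed.

Lemma eq_on_dense E F (f g : {linear E -> F}) (D : set E) :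
  continuous f -> continuous g ->
  (forall x (e : R), 0 < e -> exists2 x', D x' & N (x' - x) < e) ->
  (forall x, D x -> f x = g x) -> forall x, f x = g x.
Proof.
move=> /(@continuous_bounded _ _ S)[a a0 fa] /(@continuous_bounded _ _ S)[b b0 gb] Dd fg x.
apply/eqP; rewrite -subr_eq0; apply/eqP/(@rnorm_le0 _ _ S)/ler_addgt0Pr => e e0.
have ab : 0 < a + b + 1 by lra.
have [x' Dx' xx'] := Dd x _ (divr_gt0 e0 ab); rewrite ltr_pdivlMr // in xx'.
have := fa (x' - x); have := gb (x' - x); rewrite !linearB (fg _ Dx').
have := @rdistD _ _ S _ (g x') (f x) (g x); rewrite (rdistC (f x) (g x')).
by have := @rnorm_ge0 _ _ S _ (x' - x); rewrite !mulrDr mulr1 in xx'; lra.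
Qed.

Lemma der_linear E F (f : R -> E) t l (A : {linear E -> F}) : continuous A ->
  der f t l -> der (fun t => A (f t)) t (A l).
Proof.
move=> Ac fl; apply: eq_fun_cvg (linear_cvg _ Ac fl) => h.
by rewrite -linearB -linearZ.
Qed.

Lemma rder_linear E F (f : R -> E) t l (A : {linear E -> F}) : continuous A ->
  rder f t l -> rder (fun t => A (f t)) t (A l).
Proof.
move=> Ac fl; apply: eq_fun_cvg (linear_cvg _ Ac fl) => h.
by rewrite -linearB -linearZ.
Qed.

Lemma der_shift E (f : R -> E) t r l :
  der f (t + r) l -> der (fun t => f (t + r)) t l.
Proof. by move=> fl; apply: eq_fun_cvg fl => h; rewrite addrAC. Qed.

Lemma rder_cst E (c : E) t : rder (fun=> c) t 0.
Proof.
apply/rderP => e e0; exists 1 => // h h0 _.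
by rewrite subrr scaler0 subrr rnorm0 mulr_ge0 // ltW.
Qed.

Section OneSemigroup.
Variables (E : normedModType K) (hE : banach E) (U : R -> {linear E -> E}).
Hypothesis hU : C0_semigroup U.

Let U0 x : U 0 x = x. Proof. by case: hU. Qed.
Let Uc (t : R) : 0 <= t -> continuous (U t). Proof. by case: hU => h _ _ _; exact: h. Qed.
Let UD (t s : R) x : 0 <= t -> 0 <= s -> U (t + s) x = U t (U s x).
Proof. by case: hU => _ _ h _; exact: h. Qed.

Lemma max0_continuous : continuous (fun t : R => Num.max 0 t).
Proof. by move=> t; apply: continuous_max; [exact: cst_continuous|exact: cvg_id]. Qed.

(** Freezing the semigroup at negative times gives orbits continuous on the whole line, to which
    [prim] and the two-sided lemmas apply. *)
Lemma semigroup_family : strong_family (fun t => U (Num.max 0 t)).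
Proof.
split=> [t|x t]; first by apply: Uc; rewrite le_max lexx.
case: hU => _ _ _ /(_ x) /subspace_continuousP Ux.
have t0 : 0 <= Num.max 0 t by rewrite le_max lexx.
have /(_ (Num.max 0 t) t0) := Ux; move=> /(@cvg_rnorm _ _ S) Ut.
apply/(@cvg_rnorm _ _ S) => e e0; have := Ut e e0.
rewrite near_withinE => /near_real[d d0 dP].
have /cvgrPdist_lt/(_ d d0) := @max0_continuous t; apply: filterS => s st.
by apply: dP => /=; rewrite ?le_max ?lexx // distrC.
Qed.

Lemma generator_linear a x y x' y' : C0_generator em U (x, y) ->
  C0_generator em U (x', y') ->
  C0_generator em U (a *: x + x', a *: y + y').
Proof.
rewrite /C0_generator /= => xy x'y'.
apply: eq_fun_cvg (cvgD (cvgZ (cvg_cst a) xy) x'y') => h.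
rewrite scalerA [a * _]mulrC -scalerA -scalerDr; congr (_ *: _).
by rewrite linearP scalerBr; zmod.
Qed.

Lemma generator_orbit x y (t : R) : 0 <= t -> C0_generator em U (x, y) ->
  C0_generator em U (U t x, U t y).
Proof.
move=> t0 xy; have Utc : continuous (U t) by exact: Uc.
have xy' := linear_cvg _ Utc xy.
rewrite /C0_generator /=; apply/(@cvg_rnorm _ _ S) => e e0.
move: xy' => /(_ _) /(@cvg_rnorm _ _ S)/(_ e e0)/near_right[d d0 dP].
apply/near_right; exists d => // h h0 hd; have := dP h h0 hd.
by rewrite /= linearZ linearB /= -(UD x t0 (ltW h0)) [t + h]addrC (UD x (ltW h0) t0).
Qed.

(** The identity [transl] says that U r applied to the integral over [0, t] is the integral over
    [r, t + r]. The difference quotient in r is thus one of primitives. *)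
Lemma prim_orbit_generator x (t : R) : 0 <= t ->
  C0_generator em U (prim (fun s => U (Num.max 0 s) x) t, U t x - x).
Proof.
move=> t0; have fc := semigroup_family.2 x.
set f := fun s => _; have [p0 pf] := primP hE fc; have pc : continuous (prim f) by exact: prim_continuous.
have transl (r : R) : 0 <= r -> U r (prim f t) = prim f (t + r) - prim f r.
  move=> r0; apply/eqP; rewrite -subr_eq0; apply/eqP.
  pose g s := U r (prim f s) - (prim f (s + r) - prim f r).
  have gc : continuous g.
    move=> s; apply: cvgB.
      by apply: continuous_cvg; [exact: Uc|exact: pc].
    apply: cvgB; last exact: cvg_cst.
    apply: (@cvg_comp _ _ _ (fun s => s + r) (prim f) _ (nbhs (s + r))); last exact: pc.
    by apply: cvgD; [exact: cvg_id|exact: cvg_cst].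
  rewrite -/(g t) (@rder0_eq _ _ S _ g 0 t t0 gc) /g ?p0 ?linear0 ?add0r ?subrr ?oppr0 //.
  move=> s /andP[s0 _].
  rewrite -(subrr (U r (f s))); apply: rderB.
    by apply: rder_linear; [exact: Uc|exact: der_rder].
  rewrite -[U r (f s)]subr0; apply: rderB; last exact: rder_cst.
  apply: der_rder; apply: der_shift.
  by have := pf (s + r); rewrite /f !max_r ?addr_ge0 // -UD // [r + s]addrC.
have dk : rder (fun h => prim f (h + t) - prim f h) 0 (f t - f 0).
  by apply: rderB; apply: der_rder; [apply: der_shift; rewrite add0r|]; exact: pf.
rewrite /f maxxx max_r // U0 in dk.
apply: eq_right_cvg dk => h h0; rewrite /= transl ?(ltW h0) //.
by rewrite !add0r p0 subr0 [t + h]addrC.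
Qed.

Lemma generator_dense x (e : R) : 0 < e ->
  exists2 p, C0_generator em U p & N (p.1 - x) < e.
Proof.
move=> e0; have fc := semigroup_family.2 x.
set f := fun s => _ in fc; have [p0 pf] := primP hE fc.
have /(@cvg_rnorm _ _ S)/(_ e e0)/near_right[d d0 dP] := der_rder (pf 0).
have d20 : 0 < d / 2 by lra.
exists ((em (d / 2))^-1 *: prim f (d / 2),
        (em (d / 2))^-1 *: (U (d / 2) x - x)).
  have gx : C0_generator em U (prim f (d / 2), U (d / 2) x - x).
    by apply: prim_orbit_generator; exact: ltW.
  have g0 : C0_generator em U (0, 0).
    rewrite /C0_generator /=; apply: eq_fun_cvg (cvg_cst 0) => h.
    by rewrite linear0 subrr scaler0.
  by have := generator_linear (a := (em (d / 2))^-1) gx g0; rewrite !addr0.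
by have := dP (d / 2) d20; rewrite !add0r p0 subr0 /f maxxx U0 /=; apply; lra.
Qed.

End OneSemigroup.

End Semigroups.

(** * Groups assembled from two semigroups with opposite generators *)

Section Groups.
Context {R : realType} {K : numFieldType} {S : scalars R K}.
Local Notation em := (@emb R K S).
Local Notation N := (@rnorm R K S _).
Local Notation banach := (@banach R K S).
Local Notation der := (@der R K S _).
Local Notation rder := (@rder R K S _).
Local Notation prim := (@prim R K S _).
Implicit Types E F : normedModType K.

Definition C0_group E (U : R -> {linear E -> E}) :=
  [/\ forall t, continuous (U t), forall x, U 0 x = x,
      forall t s x, U (t + s) x = U t (U s x)
    & forall x, continuous (fun t => U t x)].

(** [C0_generator] only sees positive times, so semigroups and groups share one notion of generator;
    [group_der] recovers the two-sided derivative. *)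
Definition generates_group E (G : set (E * E)) :=
  exists2 U : R -> {linear E -> E}, C0_group U & C0_generator em U = G.

Section InverseSemigroups.
Variables (E : normedModType K) (hE : banach E) (U V : R -> {linear E -> E}).
Hypotheses (hU : C0_semigroup U) (hV : C0_semigroup V)
  (genUV : forall x y, C0_generator em U (x, y) <-> C0_generator em V (x, - y)).

(** For x in the domain of the generator of V, the right derivative of s -> U s (V s x) is U s
    applied to w - w = 0, because the generators are opposite. *)
Lemma semigroup_inverse (t : R) x : 0 <= t -> U t (V t x) = x.
Proof.
move=> t0.
have [Uc U0 UD _] := hU; have [Vc V0 VD _] := hV.
have Ufam := @semigroup_family _ _ S _ _ hU.
have Vfam := @semigroup_family _ _ S _ _ hV.
have [Utc Vtc] : continuous (U t) /\ continuous (V t) by split; [exact: Uc|exact: Vc].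
have Uc' : continuous (U t \o V t).
  by move=> z; apply: continuous_comp; [exact: Vtc|exact: Utc].
apply: (@eq_on_dense _ _ S _ _ (U t \o V t : {linear E -> E}) idfun
  [set x | exists y, C0_generator em V (x, y)]) => //.
  by move=> z; exact: cvg_id.
  move=> z e e0; have [[x' y'] xy' xz] := generator_dense hE hV z e0.
  by exists x' => //; exists y'.
move=> {}x [y Vxy]; rewrite /=.
pose f (s : R) := U (Num.max 0 s) (V (Num.max 0 s) x).
have fc : continuous f.
  apply: (family_continuous (A := fun t => U (Num.max 0 t)) (s := id)) => //.
    by move=> s; exact: cvg_id.
  exact: Vfam.2.
suff : f t = f 0 by rewrite /f maxxx U0 V0 max_r.
apply: (@rder0_eq _ _ S _ f 0 t) => // s /andP[s0 _].
have Usc : continuous (U s) by exact: Uc.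
have := generator_orbit hV s0 Vxy; set z := V s x; set w := V s y => Vz.
have Uz : C0_generator em U (z, - w) by apply/genUV; rewrite opprK.
(* Product rule: U h (V h z) - z is the sum of U h (V h z - z) and U h z - z. In the first term both
   time and vector move. *)
have lim1 : U (Num.max 0 h) ((em h)^-1 *: (V h z - z)) @[h --> 0^'+] --> U 0 w.
  rewrite -[in U 0](maxxx 0).
  apply: (family_cvg (A := fun t => U (Num.max 0 t))) => //.
  by apply: cvg_at_right_filter; exact: cvg_id.
have : U s (U (Num.max 0 h) ((em h)^-1 *: (V h z - z)) +
    (em h)^-1 *: (U h z - z)) @[h --> 0^'+] --> U s (U 0 w - w).
  by apply: linear_cvg => //; exact: cvgD lim1 Uz.
rewrite U0 subrr linear0.
apply: eq_right_cvg => h h0; have h0' := ltW h0.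
have -> : f (s + h) - f s = U s (U h (V h z) - z).
  by rewrite /f !max_r ?addr_ge0 // UD // [s + h]addrC VD // linearB.
rewrite (max_r h0') [U h (_ *: _)]linearZ -scalerDr [RHS]linearZ.
by congr (_ *: U s _); rewrite linearB; zmod.
Qed.

End InverseSemigroups.

Section GroupOfSemigroups.
Variables (E : normedModType K) (hE : banach E) (U V : R -> {linear E -> E}).
Hypotheses (hU : C0_semigroup U) (hV : C0_semigroup V)
  (genUV : forall x y, C0_generator em U (x, y) <-> C0_generator em V (x, - y)).

Definition glue_semigroups (t : R) : {linear E -> E} := if 0 <= t then U t else V (- t).

Let UV (t : R) x : 0 <= t -> U t (V t x) = x.
Proof. exact: semigroup_inverse. Qed.

Let VU (t : R) x : 0 <= t -> V t (U t x) = x.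
Proof.
by apply: semigroup_inverse => // y z; rewrite genUV opprK.
Qed.

(** The operator with the longer time is split by its semigroup law, and the part of the shorter
    length cancels against the other operator. *)
Let UVglue (t s : R) x : 0 <= t -> 0 <= s ->
  U t (V s x) = glue_semigroups (t - s) x /\ V s (U t x) = glue_semigroups (t - s) x.
Proof.
have [_ U0 UD _] := hU; have [_ V0 VD _] := hV.
move=> t0 s0; rewrite /glue_semigroups subr_ge0; case: leP => ts.
  have ts0 : 0 <= t - s by rewrite subr_ge0.
  have e : U t = U (t - s + s) by rewrite subrK.
  by split; [rewrite e UD // UV|rewrite e [t - s + s]addrC UD // VU].
have st0 : 0 <= s - t by rewrite subr_ge0 ltW.
have e : V s = V (s - t + t) by rewrite subrK.
by rewrite opprB; split; [rewrite e [s - t + t]addrC VD // UV|rewrite e VD // VU].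
Qed.

Lemma glue_group : C0_group glue_semigroups.
Proof.
have [Uc U0 UD _] := hU; have [Vc V0 VD _] := hV.
have [_ Ux] := @semigroup_family _ _ S _ _ hU.
have [_ Vx] := @semigroup_family _ _ S _ _ hV.
split=> [t|x|t s x|x].
- rewrite /glue_semigroups; case: leP => t0; first exact: Uc.
  by apply: Vc; rewrite oppr_ge0 ltW.
- by rewrite /glue_semigroups lexx U0.
- have [t0|t0] := leP 0 t; have [s0|s0] := leP 0 s.
  + by rewrite /glue_semigroups addr_ge0 // t0 s0 UD.
  + have := (UVglue x t0 (_ : 0 <= - s)).1; rewrite opprK => <-; last by lra.
    by rewrite /glue_semigroups t0 leNgt s0.
  + have := (UVglue x s0 (_ : 0 <= - t)).2; rewrite opprK addrC => <-; last by lra.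
    by rewrite /glue_semigroups s0 leNgt t0.
  + rewrite /glue_semigroups !leNgt t0 s0 /= ifN; last by rewrite -leNgt; lra.
    by rewrite opprD VD //; lra.
(* At every time one of the first two terms equals x, so continuity at 0 requires no case
   distinction. *)
have -> : (fun t => glue_semigroups t x) =
    (fun t => U (Num.max 0 t) x + V (Num.max 0 (- t)) x - x).
  apply/funext => t; rewrite /glue_semigroups; case: leP => t0.
    by rewrite max_l ?oppr_le0 // V0 addrK.
  by rewrite max_r ?oppr_ge0 ?ltW // U0 addrC addKr.
move=> t; apply: cvgB; last exact: cvg_cst.
apply: cvgD; first exact: Ux.
apply: (@cvg_comp _ _ _ (fun s => - s) (fun s => V (Num.max 0 s) x) _ (nbhs (- t))).
  by apply: cvgN; exact: cvg_id.
exact: Vx.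
Qed.

Lemma glue_generator : C0_generator em glue_semigroups = C0_generator em U.
Proof.
apply/seteqP; split=> -[x y]; rewrite /C0_generator /=;
  by apply: eq_right_cvg => h h0; rewrite /glue_semigroups ltW.
Qed.

End GroupOfSemigroups.

Section OneGroup.
Variables (E : normedModType K) (hE : banach E) (U : R -> {linear E -> E}).
Hypothesis hU : C0_group U.

Lemma group_family : strong_family U.
Proof. by case: hU. Qed.

Lemma group_semigroup : C0_semigroup U.
Proof.
have [Uc U0 UD Ux] := hU; split=> // x.
exact: continuous_subspaceT.
Qed.

Lemma groupNK (t : R) x : U t (U (- t) x) = x.
Proof. by have [_ U0 UD _] := hU; rewrite -UD addrN U0. Qed.

Lemma group_generator_orbit x y (t : R) :
  C0_generator em U (x, y) -> C0_generator em U (U t x, U t y).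
Proof.
have [Uc _ UD _] := hU; move=> xy; have Utc : continuous (U t) by exact: Uc.
rewrite /C0_generator /=; apply: eq_fun_cvg (linear_cvg _ Utc xy) => h /=.
by rewrite [RHS]linearZ [in RHS]linearB -(UD h t x) -(UD t h x) [h + t]addrC.
Qed.

Lemma group_rder x y (t : R) :
  C0_generator em U (x, y) -> rder (fun t => U t x) t (U t y).
Proof.
have [_ _ UD _] := hU; move=> /(group_generator_orbit (t := t)).
by apply: eq_fun_cvg => h; rewrite /= -(UD h t x) [h + t]addrC.
Qed.

Lemma group_der x y (t : R) :
  C0_generator em U (x, y) -> der (fun t => U t x) t (U t y).
Proof.
have [_ _ _ Ux] := hU; move=> xy.
apply: (prim_der_rder (f := fun t => U t y)) => //; try exact: Ux.
by move=> s; exact: group_rder.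
Qed.

(** The integrated form of the generator relation passes to limits, which yields
    [generator_closed]. *)
Lemma generator_prim x y :
  C0_generator em U (x, y) <->
  forall t : R, 0 <= t -> U t x - x = prim (fun s => U s y) t.
Proof.
have [_ U0 _ Ux] := hU; have [p0 pf] := primP hE (Ux y); split=> [xy t _|h].
  have := prim_unique hE (Ux y) (Ux x) (fun s => group_rder (t := s) xy) 0 t.
  by rewrite U0 p0 subr0.
have := der_rder (pf 0); rewrite U0; apply: eq_right_cvg => t t0 /=.
by rewrite h ?ltW // add0r p0 subr0.
Qed.

Lemma generator_closed (p : E * E) :
  (forall e : R, 0 < e -> exists2 q, C0_generator em U q &
     N (q.1 - p.1) < e /\ N (q.2 - p.2) < e) ->
  C0_generator em U p.
Proof.
case: p => x y /= h; have [_ U0 _ Ux] := hU; apply/generator_prim => t t0.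
have [M M0 UM] := strong_family_bound t hE group_family.
apply/eqP; rewrite -subr_eq0; apply/eqP/(@rnorm_le0 _ _ S)/ler_addgt0Pr => e e0.
(* The residual at time t is at most (M + 1) N(x' - x) + M t N(y' - y). *)
have c0 : 0 < M + 1 + M * t by have := mulr_ge0 M0 t0; lra.
have e20 : 0 < e / 2 by lra.
have [[x' y'] xy' [/= xx' yy']] := h _ (divr_gt0 e20 c0).
rewrite ltr_pdivlMr // in xx'; rewrite ltr_pdivlMr // in yy'.
have [p0 pf] := primP hE (Ux y); have [p0' pf'] := primP hE (Ux y').
have pp : N (prim (fun s => U s y') t - prim (fun s => U s y) t) <=
    M * N (y' - y) * t.
  have := @mean_value _ _ S _ (fun t => prim (fun s => U s y') t - prim (fun s => U s y) t)
    (fun s => U s y' - U s y) (M * N (y' - y)) 0 t t0.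
  rewrite p0 p0' !subr0; apply.
  - by move=> s; apply: cvgB; apply: prim_continuous.
  - by move=> s _; apply: der_rder; apply: derB.
  move=> s /andP[s0 st]; rewrite -linearB; apply: UM.
  by rewrite !ger0_norm // ltW.
have Ux' : N (U t (x' - x)) <= M * N (x' - x) by apply: UM; rewrite ger0_norm.
have eq' := (generator_prim x' y').1 xy' t t0.
rewrite [X in N X](_ : _ = (x' - x) - U t (x' - x) +
  (prim (fun s => U s y') t - prim (fun s => U s y) t)); last first.
  by rewrite -eq' linearB; zmod.
apply: le_trans (rnormD _ _) _; have := @rnormB _ _ S _ (x' - x) (U t (x' - x)).
have a0 := @rnorm_ge0 _ _ S _ (x' - x); have b0 := @rnorm_ge0 _ _ S _ (y' - y).
have := mulr_ge0 a0 M0; have := mulr_ge0 b0 M0.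
have := mulr_ge0 (mulr_ge0 a0 M0) t0; have := mulr_ge0 (mulr_ge0 b0 M0) t0.
lra.
Qed.

End OneGroup.

End Groups.

(** * Intertwining operators, retracts and direct sums of groups *)

Section GroupConstructions.
Context {R : realType} {K : numFieldType} {S : scalars R K}.
Local Notation em := (@emb R K S).
Local Notation banach := (@banach R K S).
Local Notation C0_group := (@C0_group R K _).
Local Notation generates_group := (@generates_group R K S _).
Implicit Types E F : normedModType K.

Definition mk_linear E F (f : E -> F) (lf : linear f) : {linear E -> F} :=
  HB.pack f (GRing.isLinear.Build _ _ _ _ _ lf).

Lemma continuous_opp_real (t : R) : -%R @ t --> - t.
Proof. by apply: cvgN; exact: cvg_id. Qed.

Lemma group_intertwine E F (U : R -> {linear E -> E}) (V : R -> {linear F -> F})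
    (Phi : {linear E -> F}) : banach E -> banach F -> C0_group U -> C0_group V ->
  continuous Phi ->
  (forall x y, C0_generator em U (x, y) -> C0_generator em V (Phi x, Phi y)) ->
  forall t x, Phi (U t x) = V t (Phi x).
Proof.
move=> hE hF hU hV Phic UV t.
have Ufam := group_family hU; have Vfam := group_family hV.
have c1 : continuous (Phi \o U t).
  by move=> z; apply: continuous_comp; [exact: Ufam.1|exact: Phic].
have c2 : continuous (V t \o Phi).
  by move=> z; apply: continuous_comp; [exact: Phic|exact: Vfam.1].
apply: (@eq_on_dense _ _ S _ _ (Phi \o U t : {linear E -> F})
  (V t \o Phi : {linear E -> F}) [set x | exists y, C0_generator em U (x, y)]) => //.
  move=> z e e0; have [[x' y'] xy' xz] := generator_dense hE (group_semigroup hU) z e0.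
  by exists x' => //; exists y'.
move=> x [y Uxy]; rewrite /=.
pose f (s : R) := V (- s) (Phi (U s x)).
have fc : continuous f.
  apply: (family_continuous (A := V) (s := -%R)) => //.
    by move=> s; exact: continuous_opp_real.
  by move=> s; apply: linear_cvg => //; exact: Ufam.2.
suff : f t = f 0.
  have [_ U0 _ _] := hU; have [_ V0 _ _] := hV.
  by rewrite /f oppr0 U0 V0 => <-; rewrite groupNK.
apply: (@rder0_const _ _ S _ f) => // s.
have := group_generator_orbit hU (t := s) Uxy.
set z := U s x; set w := U s y => Uz; have Vz := UV _ _ Uz.
have [_ U0 UD _] := hU; have [_ V0 VD _] := hV.
have lim1 : Phi ((em h)^-1 *: (U h z - z)) - (em h)^-1 *: (V h (Phi z) - Phi z)
    @[h --> 0^'+] --> Phi w - Phi w.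
  by apply: cvgB; [apply: linear_cvg|exact: Vz].
rewrite subrr in lim1.
have lim2 : V (- (s + h)) (Phi ((em h)^-1 *: (U h z - z)) -
    (em h)^-1 *: (V h (Phi z) - Phi z)) @[h --> 0^'+] --> V (- (s + 0)) 0.
  apply: (@family_cvg _ _ S _ _ V _ _ _ (fun h => - (s + h))) => //.
  apply: cvgN; apply: cvgD; first exact: cvg_cst.
  by apply: cvg_at_right_filter; exact: cvg_id.
rewrite linear0 in lim2; apply: eq_fun_cvg lim2 => h.
rewrite /f [U (s + h) x](_ : _ = U h z); last by rewrite -UD addrC.
(* Both terms of the increment of f then carry the same outer factor V (- (s + h)), inside which the
   two generator quotients cancel in the limit. *)
have -> : V (- s) (Phi (U s x)) = V (- (s + h)) (V h (Phi z)).
  by rewrite -VD opprD subrK.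
rewrite -linearB -linearZ; congr (V _ _); rewrite [Phi (_ *: _)]linearZ /= [Phi (_ - _)]linearB -scalerBr.
by congr (_ *: _); zmod.
Qed.

(* [Phi] and [Psi] identify [F] with a complemented subspace of [E] whose
   projection [Psi \o Phi] commutes with the generator. *)
Lemma group_retract E F (G : set (E * E)) (Phi : {linear E -> F})
    (Psi : {linear F -> E}) : banach E -> continuous Phi -> continuous Psi ->
  cancel Psi Phi -> (forall x y, G (x, y) -> G (Psi (Phi x), Psi (Phi y))) ->
  generates_group G -> generates_group [set p | G (Psi p.1, Psi p.2)].
Proof.
move=> hE Phic Psic PsiK PG [U hU UG].
have [Uc U0 UD Ux] := hU.
have Pc : continuous (Psi \o Phi).
  by move=> z; apply: continuous_comp; [exact: Phic|exact: Psic].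
have comm t x : Psi (Phi (U t x)) = U t (Psi (Phi x)).
  apply: (@group_intertwine _ _ U U (Psi \o Phi : {linear E -> E})) => // y z.
  by rewrite UG; exact: PG.
exists (fun t => Phi \o (U t \o Psi)).
  split.
  - move=> t z; apply: continuous_comp; last exact: Phic.
    by apply: continuous_comp; [exact: Psic|exact: Uc].
  - by move=> x; rewrite /= U0 PsiK.
  - by move=> t s x; rewrite /= comm PsiK UD.
  - by move=> x t; apply: linear_cvg => //; exact: Ux.
rewrite -UG; apply/seteqP; split=> -[x y]; rewrite /C0_generator /= => xy.
  apply: eq_fun_cvg (linear_cvg _ Psic xy) => h.
  by rewrite [RHS]linearZ /= [Psi (_ - _)]linearB comm PsiK.
have : Phi ((em h)^-1 *: (U h (Psi x) - Psi x)) @[h --> 0^'+] --> Phi (Psi y).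
  exact: linear_cvg.
rewrite PsiK => xy'.
apply: eq_fun_cvg xy' => h.
by rewrite [RHS]linearZ /= [Phi (_ - _)]linearB PsiK.
Qed.

Definition sum_graph E F (G : set (E * E)) (H : set (F * F)) :
    set ((E * F) * (E * F)) :=
  [set p | G (p.1.1, p.2.1) /\ H (p.1.2, p.2.2)].

Lemma fst_linear E F : linear (@fst E F). Proof. by []. Qed.
Lemma snd_linear E F : linear (@snd E F). Proof. by []. Qed.
Lemma inl_linear E F : linear (fun x : E => (x, 0 : F)).
Proof. by move=> a x y; congr (_, _); rewrite /= scaler0 addr0. Qed.
Lemma inr_linear E F : linear (fun y : F => (0 : E, y)).
Proof. by move=> a x y; congr (_, _); rewrite /= scaler0 addr0. Qed.

Lemma pair_cvg E F I (G : set_system I) (FG : Filter G) (f : I -> E * F)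
    (x : E) (y : F) :
  (f i).1 @[i --> G] --> x -> (f i).2 @[i --> G] --> y -> f i @[i --> G] --> (x, y).
Proof.
move=> fx fy; rewrite (_ : f = fun i => ((f i).1, (f i).2)); first exact: cvg_pair.
by apply/funext => i; case: (f i).
Qed.

Lemma fst_cvg E F I (G : set_system I) (FG : Filter G) (f : I -> E * F) (p : E * F) :
  f i @[i --> G] --> p -> (f i).1 @[i --> G] --> p.1.
Proof. by move=> fp; apply: cvg_comp fp _; exact: cvg_fst. Qed.

Lemma snd_cvg E F I (G : set_system I) (FG : Filter G) (f : I -> E * F) (p : E * F) :
  f i @[i --> G] --> p -> (f i).2 @[i --> G] --> p.2.
Proof. by move=> fp; apply: cvg_comp fp _; exact: cvg_snd. Qed.

Lemma generates_group0 E (G : set (E * E)) : generates_group G -> G (0, 0).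
Proof.
move=> [U _ <-]; rewrite /C0_generator /=; apply: eq_fun_cvg (cvg_cst 0) => h.
by rewrite linear0 subrr scaler0.
Qed.

(** Each summand is a retract of the sum along a projection and its section. That G and H contain
    (0, 0) puts the image of the section into the sum graph. *)
Lemma group_sum E F (G : set (E * E)) (H : set (F * F)) :
  banach E -> banach F ->
  generates_group (sum_graph G H) <-> generates_group G /\ generates_group H.
Proof.
move=> hE hF; have hEF := banach_prod hE hF; split=> [GH|[[U hU UG] [V hV VH]]].
  have [G0 H0] : G (0, 0) /\ H (0, 0) by have := generates_group0 GH.
  split.
    have := group_retract (Phi := mk_linear (@fst_linear E F))
      (Psi := mk_linear (@inl_linear E F)) hEF _ _ _ _ GH.
    rewrite (_ : [set p | _] = G); last first.
      by apply/seteqP; split=> -[x y] //= [].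
    apply => //.
    - by move=> p; exact: cvg_fst.
    - by move=> x; apply: pair_cvg; [exact: cvg_id|exact: cvg_cst].
    - by move=> p q [].
  have := group_retract (Phi := mk_linear (@snd_linear E F))
    (Psi := mk_linear (@inr_linear E F)) hEF _ _ _ _ GH.
  rewrite (_ : [set p | _] = H); last first.
    by apply/seteqP; split=> -[x y] //= [].
  apply => //.
  - by move=> p; exact: cvg_snd.
  - by move=> x; apply: pair_cvg; [exact: cvg_cst|exact: cvg_id].
  - by move=> p q [].
have [Uc U0 UD Ux] := hU; have [Vc V0 VD Vx] := hV.
have lin t : linear (fun p : E * F => (U t p.1, V t p.2)).
  by move=> a p q; congr (_, _); rewrite /= linearP.
exists (fun t => mk_linear (lin t)).
  split=> [t p|[x y]|t s x|x t] /=.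
  - apply: pair_cvg => /=; apply: linear_cvg => //; [exact: cvg_fst|exact: cvg_snd].
  - by rewrite U0 V0.
  - by rewrite UD VD.
  - by apply: pair_cvg => /=; [exact: Ux|exact: Vx].
rewrite -UG -VH; apply/seteqP; split=> -[[x y] [x' y']] /=.
  rewrite /C0_generator /= => xy; split.
    by apply: eq_fun_cvg (fst_cvg _ xy) => h.
  by apply: eq_fun_cvg (snd_cvg _ xy) => h.
by move=> [xx' yy']; rewrite /C0_generator /=; apply: pair_cvg.
Qed.

End GroupConstructions.

(** * Evolution equations with bounded, strongly continuous coefficients *)

Section Evolution.
Context {R : realType} {K : numFieldType} {S : scalars R K}.
Local Notation N := (@rnorm R K S _).
Local Notation banach := (@banach R K S).
Local Notation der := (@der R K S _).
Local Notation prim := (@prim R K S _).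
Variables (E : normedModType K) (hE : banach E).

Lemma der_reflect (f : R -> E) (t : R) l :
  der f (- t) l -> der (fun s => f (- s)) t (- l).
Proof.
move=> /derP fl; apply/derP => e /fl[d d0 dP]; exists d => // h hd.
have := dP (- h); rewrite normrN => /(_ hd).
by rewrite opprD rmorphN scaleNr scalerN.
Qed.

Lemma der_cst (c : E) (t : R) : der (fun=> c) t 0.
Proof.
apply/derP => e e0; exists 1 => // h _.
by rewrite subrr scaler0 subrr rnorm0 mulr_ge0 // ltW.
Qed.

Lemma bounded_rnorm (w : R -> E) (T : R) : continuous w ->
  exists M : R, forall t, `|t| <= T -> N (w t) <= M.
Proof.
move=> wc; have [M wM] := bounded_real T (@rnorm_continuous _ _ S _ _ 0 wc).
by exists M => t tT; rewrite -[w t]subr0; exact: wM.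
Qed.

Lemma mean_value_sym (v v' : R -> E) (g g' : R -> R) (T : R) : v 0 = 0 ->
  (forall t, der v t (v' t)) -> continuous g ->
  (forall t h : R, 0 <= t -> 0 < h -> g t + h * g' t <= g (t + h)) ->
  (forall t, `|t| <= T -> N (v' t) <= g' `|t|) ->
  forall t, `|t| <= T -> N (v t) <= g `|t| - g 0.
Proof.
move=> v0 vv' gc gg' v'g' t tT; have [t0|/ltW t0] := leP 0 t.
  rewrite ger0_norm // in tT *; rewrite -[v t]subr0 -v0.
  apply: (@mean_value_convex _ _ S _ v v' g g') => //.
  - by move=> s; apply: der_continuous (vv' s).
  - by move=> s _; apply: der_rder.
  - move=> s /andP[s0 st]; rewrite -{2}(ger0_norm s0); apply: v'g'.
    by rewrite ger0_norm //; lra.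
  - by move=> s h /andP[s0 _]; exact: gg'.
rewrite ler0_norm // in tT *.
have nt0 : 0 <= - t by rewrite oppr_ge0.
have dv s : der (fun s => v (- s)) s (- v' (- s)) by apply: der_reflect.
have := @mean_value_convex _ _ S _ (fun s => v (- s)) (fun s => - v' (- s)) g g' _ _ nt0.
rewrite opprK oppr0 v0 subr0; apply => //.
- by move=> s; apply: der_continuous (dv s).
- by move=> s _; apply: der_rder.
- move=> s /andP[s0 st]; rewrite rnormN -{2}(ger0_norm s0) -normrN; apply: v'g'.
  by rewrite normrN ger0_norm //; lra.
- by move=> s h /andP[s0 _]; exact: gg'.
Qed.

(** Integrating C B exp(2 C s) from 0 to |t| gives at most (B / 2) exp(2 C |t|): the weight 2 C is
    chosen so that each Picard step halves the constant, whatever the length of the interval. *)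
Lemma picard_step (v v' : R -> E) (B C T : R) : 0 <= B -> 0 <= C -> v 0 = 0 ->
  (forall t, der v t (v' t)) ->
  (forall t, `|t| <= T -> N (v' t) <= C * (B * expR (2 * C * `|t|))) ->
  forall t, `|t| <= T -> N (v t) <= B / 2 * expR (2 * C * `|t|).
Proof.
move=> B0 C0 v0 vv' v'C t tT.
have := @mean_value_sym v v' (fun t => B / 2 * expR (2 * C * t))
  (fun t => C * (B * expR (2 * C * t))) T v0 vv' _ _ v'C t tT.
move=> h; apply: le_trans (h _ _) _.
- move=> s; apply: cvgM; first exact: cvg_cst.
  apply: continuous_cvg; first exact: continuous_expR.
  by apply: cvgM; [exact: cvg_cst|exact: cvg_id].
- move=> s r s0 r0; rewrite mulrDr expRD.
  have e0 := expR_gt0 (2 * C * s); have := expR_ge1Dx (2 * C * r).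
  have : 0 <= B / 2 * expR (2 * C * s) by rewrite mulr_ge0 ?divr_ge0 // ltW.
  move=> p0 p1; rewrite [leRHS]mulrA; apply: le_trans (ler_wpM2l p0 p1).
  by apply: eq_leW; field.
- by rewrite gerBl mulr_ge0 ?divr_ge0 // expR_ge0.
Qed.

Variable A : R -> {linear E -> E}.
Hypothesis hA : strong_family A.

Lemma expR_ge1 (x : R) : 0 <= x -> 1 <= expR x.
Proof. by move=> x0; apply: le_trans (expR_ge1Dx x); lra. Qed.

(** [picard_step] applied to w itself halves its bound again and again. *)
Lemma evolution_unique (w : R -> E) : w 0 = 0 ->
  (forall t, der w t (A t (w t))) -> forall t, w t = 0.
Proof.
move=> w0 wA t.
have wc : continuous w by move=> s; apply: der_continuous (wA s).
have [C C0 bA] := strong_family_bound `|t| hE hA.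
have [M wM] := bounded_rnorm `|t| wc.
have M0 : 0 <= M by apply: le_trans (rnorm_ge0 _) (wM t (lexx _)).
have wn n s : `|s| <= `|t| -> N (w s) <= M / 2 ^+ n * expR (2 * C * `|s|).
  elim: n s => [|n IH] s st.
    rewrite expr0 divr1; apply: le_trans (wM s st) _.
    by rewrite ler_peMr // expR_ge1 // !mulr_ge0.
  rewrite exprSr invfM mulrA; apply: (@picard_step w (fun s => A s (w s)) _ _ `|t|) => //.
    by rewrite divr_ge0 // exprn_ge0.
  move=> r rt; apply: le_trans (bA r rt _) _; apply: ler_wpM2l => //; exact: IH.
apply: (@rnorm_le0 _ _ S); apply/ler_addgt0Pr => e e0.
have [n ne] := small_geometric (M * expR (2 * C * `|t|)) e0.
apply: le_trans (wn n t (lexx _)) _; rewrite add0r mulrAC; exact: ltW.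
Qed.

(** Picard iteration. The last clause bounds w t - x by a multiple of N x; it makes the solution
    operators bounded in [evolution_family]. *)
Lemma evolution_exists (x : E) : exists w : R -> E,
  [/\ w 0 = x, forall t, der w t (A t (w t)) &
   forall T C : R, 0 <= C -> (forall t, `|t| <= T -> forall y, N (A t y) <= C * N y) ->
     forall t, `|t| <= T -> N (w t - x) <= N x * expR (2 * C * `|T|) * 2].
Proof.
pose Y := fix Y n : R -> E :=
  if n is m.+1 then fun t => x + prim (fun s => A s (Y m s)) t else fun=> x.
have Yc n : continuous (Y n).
  elim: n => [|n IH] t; first exact: cvg_cst.
  apply: cvgD; first exact: cvg_cst.
  by apply: prim_continuous => //; apply: (family_continuous (s := id)) => // s; exact: cvg_id.
have AYc n : continuous (fun s => A s (Y n s)).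
  by apply: (family_continuous (s := id)) => // s; exact: cvg_id.
have Yd n t : der (Y n.+1) t (A t (Y n t)).
  have [_ pf] := primP hE (AYc n); apply: eq_fun_cvg (pf t) => h.
  by rewrite /=; congr (_ *: _); zmod.
have Y0 n : Y n 0 = x.
  by case: n => [//|n] /=; have [-> _] := primP hE (AYc n); rewrite addr0.
have Ystep (T C : R) : 0 <= C ->
    (forall t, `|t| <= T -> forall y, N (A t y) <= C * N y) ->
    forall n t, `|t| <= T ->
      N (Y n.+1 t - Y n t) <= N x / 2 ^+ n * expR (2 * C * `|t|).
  move=> C0 bA n t tT.
  (* [picard_step] gains the factor 1/2 already at the first iterate. Keeping it gives the induction
     hypothesis the form that the next step consumes. *)
  apply: le_trans (_ : N x / 2 ^+ n / 2 * expR (2 * C * `|t|) <= _); last first.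
    apply: ler_wpM2r; first exact: expR_ge0.
    have : 0 <= N x / 2 ^+ n by rewrite divr_ge0 ?rnorm_ge0 ?exprn_ge0.
    by lra.
  elim: n t tT => [|n IH] t tT.
    rewrite expr0 divr1.
    apply: (@picard_step (fun t => Y 1%N t - Y 0%N t) (fun t => A t x) _ _ T) => //.
    - exact: rnorm_ge0.
    - by rewrite !Y0 subrr.
    - by move=> s; rewrite -[A s x]subr0; apply: derB; [exact: Yd|exact: der_cst].
    move=> s sT; apply: le_trans (bA s sT x) _; apply: ler_wpM2l => //.
    by rewrite ler_peMr ?rnorm_ge0 // expR_ge1 // !mulr_ge0.
  apply: (@picard_step (fun t => Y n.+2 t - Y n.+1 t)
    (fun t => A t (Y n.+1 t) - A t (Y n t)) _ _ T) => //.
  - by rewrite divr_ge0 ?rnorm_ge0 ?exprn_ge0.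
  - by rewrite !Y0 subrr.
  - by move=> s; apply: derB; exact: Yd.
  move=> s sT; rewrite -linearB; apply: le_trans (bA s sT _) _.
  apply: ler_wpM2l => //; apply: le_trans (IH s sT) _.
  by rewrite exprSr invfM mulrA.
have Ygeo (T C : R) : 0 <= C ->
    (forall t, `|t| <= T -> forall y, N (A t y) <= C * N y) ->
    forall n t, `|t| <= T ->
      N (Y n.+1 t - Y n t) <= N x * expR (2 * C * `|T|) / 2 ^+ n.
  move=> C0 bA n t tT; apply: le_trans (Ystep T C C0 bA n t tT) _.
  rewrite mulrAC ler_wpM2r ?invr_ge0 ?exprn_ge0 // ler_wpM2l ?rnorm_ge0 //.
  by rewrite ler_expR ler_wpM2l ?mulr_ge0 // (le_trans tT) // ler_norm.
have /choice[w wP] t : exists l : E, Y n t @[n --> \oo] --> l.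
  have [C C0 bA] := strong_family_bound `|t| hE hA.
  have [|l Yl _] := @geometric_cvg _ _ S _ (Y^~ t) (N x * expR (2 * C * `| `|t| |)) hE.
    by move=> n; apply: Ygeo.
  by exists l.
have wY (T C : R) : 0 <= C ->
    (forall t, `|t| <= T -> forall y, N (A t y) <= C * N y) ->
    forall n t, `|t| <= T ->
      N (w t - Y n t) <= N x * expR (2 * C * `|T|) * 2 / 2 ^+ n.
  move=> C0 bA n t tT; apply: rnorm_cvg_le (wP t) _; exists n => // p /= np.
  have := @telescope_geometric _ _ S _ (Y^~ t) (N x * expR (2 * C * `|T|)) _ n (p - n)%N.
  rewrite subnKC // => h; apply: le_trans (h _) _ => [k|]; first exact: Ygeo.
  by rewrite gerBl divr_ge0 ?mulr_ge0 ?rnorm_ge0 ?expR_ge0 ?exprn_ge0.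
have wc : continuous w.
  move=> t; have [C C0 bA] := strong_family_bound (`|t| + 1) hE hA.
  apply/(@continuous_real_rnorm _ _ S) => e e0.
  have e4 : 0 < e / 4 by lra.
  have [n ne] := small_geometric (N x * expR (2 * C * `| `|t| + 1|) * 2) e4.
  have /(@continuous_real_rnorm _ _ S)/(_ _ e4)[d d0 dP] := Yc n t.
  exists (Num.min d 1); first by rewrite lt_min d0 ltr01.
  move=> s; rewrite lt_min => /andP[sd s1].
  have sT : `|s| <= `|t| + 1 by have := lerB_dist s t; lra.
  have h1 := wY _ C C0 bA n s sT.
  have h2 : N (w t - Y n t) <= _ := wY _ C C0 bA n t _.
  have {}h2 := h2 (ler_wpDr ler01 (lexx _)).
  have := @rdistD _ _ S _ (Y n s) (w s) (w t); have := dP s sd.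
  by have := @rdistD _ _ S _ (Y n t) (Y n s) (w t); rewrite (rdistC (Y n t) (w t)); lra.
have Awc : continuous (fun s => A s (w s)).
  by apply: (family_continuous (s := id)) => // s; exact: cvg_id.
have [p0 pf] := primP hE Awc.
have w0 : w 0 = x.
  have Yx : Y n 0 @[n --> \oo] --> x.
    by apply: eq_fun_cvg (cvg_cst x) => n; exact: Y0.
  by apply: cvg_unique (wP 0) Yx.
(* Y n.+1 is x plus the primitive of A s (Y n s). Since Y n is geometrically close to w uniformly up
   to time |t|, the integral equation passes to the limit. *)
have weq t : w t = x + prim (fun s => A s (w s)) t.
  have [C C0 bA] := strong_family_bound `|t| hE hA.
  apply/eqP; rewrite -subr_eq0; apply/eqP/(@rnorm_le0 _ _ S)/ler_addgt0Pr => e e0.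
  have c0 : 0 < C * `|t| + 1 by rewrite ltr_wpDl // mulr_ge0.
  have [n ne] := small_geometric (N x * expR (2 * C * `| `|t| |) * 2) (divr_gt0 e0 c0).
  set q := _ / _ in ne; have wYn s : `|s| <= `|t| -> N (w s - Y n s) <= q by exact: wY.
  have wYn1 : N (w t - Y n.+1 t) <= q.
    apply: le_trans (wY `|t| C C0 bA n.+1 t (lexx _)) _.
    rewrite /q ler_wpM2l ?mulr_ge0 ?rnorm_ge0 ?expR_ge0 //.
    by rewrite lef_pV2 ?posrE ?exprn_gt0 // ler_weXn2l // ler1n.
  have [p0' pf'] := primP hE (AYc n).
  have := @mean_value_sym (fun t => prim (fun s => A s (Y n s)) t -
    prim (fun s => A s (w s)) t) (fun s => A s (Y n s) - A s (w s))
    (fun s => C * q * s) (fun=> C * q) `|t| _ _ _ _ _ t (lexx _).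
  rewrite p0 p0' subrr mulr0 subr0 => h.
  have {}h : N (prim (fun s => A s (Y n s)) t - prim (fun s => A s (w s)) t) <= C * q * `|t|.
    apply: h => //.
    - by move=> s; apply: derB.
    - by move=> s; apply: cvgM; [exact: cvg_cst|exact: cvg_id].
    - by move=> s r _ _; lra.
    move=> s st; rewrite -linearB; apply: le_trans (bA s st _) _.
    by rewrite ler_wpM2l // rdistC; exact: wYn.
  rewrite ltr_pdivlMr // in ne.
  rewrite [X in N X](_ : _ = (w t - Y n.+1 t) +
    (prim (fun s => A s (Y n s)) t - prim (fun s => A s (w s)) t)); last first.
    by rewrite /=; zmod.
  apply: le_trans (rnormD _ _) _; move: ne; rewrite mulrDr mulr1; lra.
exists w; split=> // [t|T C C0 bA t tT].
  apply: eq_fun_cvg (pf t) => h; rewrite !weq.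
  by congr (_ *: _); zmod.
by have := wY T C C0 bA 0%N t tT; rewrite expr0 divr1.
Qed.

Lemma der_lincomb (f g : R -> E) (t : R) (a : K) (l m : E) :
  der f t l -> der g t m -> der (fun t => a *: f t + g t) t (a *: l + m).
Proof.
move=> fl gm; apply: eq_fun_cvg (cvgD (cvgZ (cvg_cst a) fl) gm) => h.
rewrite scalerA [a * _]mulrC -scalerA -scalerDr; congr (_ *: _).
by rewrite scalerBr; zmod.
Qed.

Lemma evolution_family : exists W : R -> {linear E -> E},
  [/\ strong_family W, forall x, W 0 x = x &
   forall t x, der (fun t => W t x) t (A t (W t x))].
Proof.
have /choice[w wP] := evolution_exists.
have wlin t : linear (fun x => w x t).
  move=> a x y; have [wa da _] := wP (a *: x + y).
  have [wx dx _] := wP x; have [wy dy _] := wP y.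
  apply/eqP; rewrite -subr_eq0; apply/eqP.
  apply: (@evolution_unique (fun t => w (a *: x + y) t - (a *: w x t + w y t))).
    by rewrite wa wx wy subrr.
  move=> s; rewrite linearB linearP; apply: derB => //; exact: der_lincomb.
exists (fun t => mk_linear (wlin t)); split=> /= [|x|t x].
- split=> [t|x t]; last by have [_ dx _] := wP x; apply: der_continuous (dx t).
  have [C C0 bA] := strong_family_bound `|t| hE hA.
  apply: (@bounded_continuous _ _ S _ _ _ (expR (2 * C * `| `|t| |) * 2 + 1)) => x /=.
  have [_ _ /(_ _ _ C0 bA t (lexx _)) h] := wP x.
  have := @rnormD _ _ S _ (w x t - x) x; rewrite subrK => /le_trans; apply.
  by rewrite mulrDl mul1r lerD2r; apply: le_trans h _; apply: eq_leW; ring.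
- by have [] := wP x.
- by have [_ dx _] := wP x; exact: dx.
Qed.

End Evolution.

(** * Bounded perturbations of group generators *)

Section Perturbation.
Context {R : realType} {K : numFieldType} {S : scalars R K}.
Local Notation em := (@emb R K S).
Local Notation banach := (@banach R K S).
Local Notation der := (@der R K S _).
Local Notation C0_group := (@C0_group R K _).
Local Notation generates_group := (@generates_group R K S _).

(* With [A t = U (- t) \o P \o U t] and [W] the evolution family of
   [w' = A t w], the perturbed group is [U t \o W t]. *)
Theorem group_perturbation (E : normedModType K) (G : set (E * E))
    (P : {linear E -> E}) : banach E -> continuous P -> generates_group G ->
  generates_group [set p | G (p.1, p.2 - P p.1)].
Proof.
move=> hE Pc [U hU UG]; have Ufam := group_family hU.
have [_ U0 UD Ux] := hU.
pose A t : {linear E -> E} := U (- t) \o (P \o U t).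
have Afam : strong_family A.
  split=> [t z|x].
    apply: continuous_comp; last exact: Ufam.1.
    by apply: continuous_comp; [exact: Ufam.1|exact: Pc].
  apply: (family_continuous (A := U) (s := -%R) (f := fun t => P (U t x))) => //.
    by move=> s; exact: continuous_opp_real.
  by move=> s; apply: linear_cvg => //; exact: Ux.
have [W [Wfam W0 WA]] := evolution_family hE Afam.
have Wuniq (w : R -> E) : (forall t, der w t (A t (w t))) -> forall t, w t = W t (w 0).
  move=> wA t; apply/eqP; rewrite -subr_eq0; apply/eqP.
  apply: (@evolution_unique _ _ S _ hE A Afam (fun t => w t - W t (w 0))).
    by rewrite W0 subrr.
  by move=> s; rewrite linearB; apply: derB.
(* Since A r composed with U s is U s composed with A (r + s), the right-hand side solves the
   evolution equation in t with the same initial value. Applying U t gives the group law of U t \o W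
   t. *)
have Wlaw t s x : W t (U s (W s x)) = U s (W (t + s) x).
  rewrite (Wuniq (fun t => U s (W (t + s) x))) ?add0r // => r.
  have -> : A r (U s (W (r + s) x)) = U s (A (r + s) (W (r + s) x)).
    by rewrite /A /= -!UD opprD addrCA subrr addr0.
  apply: (der_linear (f := fun t => W (t + s) x)); first exact: Ufam.1.
  by apply: (der_shift (f := fun t => W t x)).
have UW_group : C0_group (fun t => U t \o W t).
  split=> [t z|x|t s x|x] /=.
  - by apply: continuous_comp; [exact: Wfam.1|exact: Ufam.1].
  - by rewrite W0 U0.
  - by rewrite Wlaw UD.
  - by apply: (family_continuous (s := id)) => // [s|]; [exact: cvg_id|exact: Wfam.2].
exists (fun t => U t \o W t) => //.
have lim x : U h ((em h)^-1 *: (W h x - x)) @[h --> 0^'+] --> P x.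
  rewrite -[P x]U0; apply: (@family_cvg _ _ S _ _ U _ _ _ id) => //.
    by apply: cvg_at_right_filter; exact: cvg_id.
  have := der_rder (WA 0 x); rewrite W0 /A /= oppr0 !U0.
  by apply: eq_fun_cvg => h; rewrite add0r W0.
have split_quotient h x : (em h)^-1 *: (U h (W h x) - x) =
    U h ((em h)^-1 *: (W h x - x)) + (em h)^-1 *: (U h x - x).
  rewrite [U h (_ *: _)]linearZ -scalerDr [U h (_ - _)]linearB.
  by congr (_ *: _); zmod.
rewrite -UG; apply/seteqP; split=> -[x y]; rewrite /C0_generator /= => xy.
  apply: eq_fun_cvg (cvgB xy (lim x)) => h.
  by rewrite -[RHS]/(_ - _) split_quotient; zmod.
rewrite -[y](subrK (P x)); apply: eq_fun_cvg (cvgD xy (lim x)) => h.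
by rewrite split_quotient addrC.
Qed.

End Perturbation.

(** * Cosine functions from reduction matrices *)

Section Kisynski.
Context {R : realType} {K : numFieldType} {S : scalars R K}.
Local Notation em := (@emb R K S).
Local Notation N := (@rnorm R K S _).
Local Notation banach := (@banach R K S).
Local Notation der := (@der R K S _).
Local Notation rder := (@rder R K S _).
Local Notation prim := (@prim R K S _).
Local Notation C0_group := (@C0_group R K _).
Local Notation generates_group := (@generates_group R K S _).

Section Taylor.
Variable E : normedModType K.

Lemma der_quadratic (c : E) (t : R) :
  der (fun t => em (t ^+ 2 / 2) *: c) t (em t *: c).
Proof.
apply/derP => e e0; have c0 : 0 < N c + 1 by rewrite ltr_wpDl ?rnorm_ge0.
exists (e / (N c + 1)) => [|h]; first by rewrite divr_gt0.
rewrite ltr_pdivlMr // => he.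
rewrite [X in N X](_ : _ = em (h ^+ 2 / 2) *: c); last first.
  by rewrite scalerA -rmorphM -!scalerBl -!rmorphB; congr (em _ *: c); field.
rewrite rnormZe ger0_norm ?divr_ge0 ?sqr_ge0 // -real_normK ?num_real //.
have cn0 := @rnorm_ge0 _ _ S _ c; have h0 := normr_ge0 h.
have : 0 <= `|h| * N c by rewrite mulr_ge0.
move=> hc; have -> : `|h| ^+ 2 / 2 * N c = (`|h| * N c / 2) * `|h| by field.
by rewrite ler_wpM2r //; lra.
Qed.

(** Used to recover the generator of a cosine function from the quotients of C t x - x by t^2/2, and
    to normalise the second primitive of its orbit. *)
Lemma taylor2 (u u1 u2 : R -> E) :
  continuous u -> continuous u1 -> {for 0, continuous u2} ->
  (forall t : R, 0 <= t -> rder u t (u1 t)) -> (forall t : R, 0 <= t -> rder u1 t (u2 t)) ->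
  u 0 = 0 -> u1 0 = 0 ->
  (em (t ^+ 2 / 2))^-1 *: u t @[t --> 0^'+] --> u2 0.
Proof.
move=> uc u1c /(@continuous_real_rnorm _ _ S) u2c uu1 u1u2 u0 u10.
apply/(@cvg_rnorm _ _ S) => e e0; have [|d d0 dP] := u2c (e / 4); first by lra.
apply/near_right; exists d => // t t0; rewrite add0r => td.
have t20 : 0 < t ^+ 2 / 2 by rewrite divr_gt0 // exprn_gt0.
have b1 (s : R) : 0 <= s -> s < d -> N (u1 s - em s *: u2 0) <= e / 4 * s.
  move=> s0 sd.
  have := @mean_value _ _ S _ (fun s => u1 s - em s *: u2 0)
    (fun s => u2 s - u2 0) (e / 4) 0 s s0.
  rewrite u10 rmorph0 scale0r !subr0; apply.
  - move=> r; apply: cvgB; first exact: u1c.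
    exact: (der_continuous (@der_line _ _ S _ (u2 0) r)).
  - move=> r /andP[r0 rs]; apply: rderB; first exact: u1u2.
    by apply: der_rder; exact: der_line.
  - by move=> r /andP[r0 rs]; apply/ltW/dP; rewrite subr0 ger0_norm //; lra.
have qc : continuous (fun s : R => em (s ^+ 2 / 2) *: u2 0).
  by move=> s; apply: der_continuous; exact: der_quadratic.
have b2 : N (u t - em (t ^+ 2 / 2) *: u2 0) <= e / 4 * t * t.
  have := @mean_value _ _ S _ (fun s => u s - em (s ^+ 2 / 2) *: u2 0)
    (fun s => u1 s - em s *: u2 0) (e / 4 * t) 0 t (ltW t0).
  rewrite u0 expr0n /= mul0r rmorph0 scale0r !subr0; apply.
  - move=> r; apply: cvgB; first exact: uc.
    exact: qc.
  - move=> r /andP[r0 rs]; apply: rderB; first exact: uu1.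
    by apply: der_rder; exact: der_quadratic.
  - move=> r /andP[r0 rs]; apply: le_trans (b1 r r0 _) _; first by lra.
    by rewrite ler_wpM2l ?ltW // divr_gt0.
rewrite quotient_dist ?gt_eqF // gtr0_norm // ltr_pdivrMl //.
apply: le_lt_trans b2 _; have : 0 < e * t * t by rewrite !mulr_gt0.
have -> : t ^+ 2 / 2 * e = e * t * t / 2 by field.
have -> : e / 4 * t * t = e * t * t / 4 by field.
by lra.
Qed.

End Taylor.

Lemma fst_continuous (E F : normedModType K) :
  continuous (mk_linear (@fst_linear K E F)).
Proof. by move=> p; exact: cvg_fst. Qed.

Lemma snd_continuous (E F : normedModType K) :
  continuous (mk_linear (@snd_linear K E F)).
Proof. by move=> p; exact: cvg_snd. Qed.

Lemma real_bound (M x c : K) : 0 <= x -> 0 <= c -> x <= M * c -> x <= `|M| * c.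
Proof.
move=> x0 c0 xM; rewrite -[c in leRHS]ger0_norm // -normrM ger0_norm //.
exact: le_trans xM.
Qed.

Section ReductionGraph.
Variables (E F : normedModType K) (hE : banach E) (hF : banach F).
Variables (j : F -> E) (D : set E) (T : E -> E).
Hypotheses (hj : continuous_embedding j) (hT : domain_embedding j D T).

(** J reverses the velocity. Conjugation by it turns the reduction matrix into its negative, so it
    implements time reversal. *)
Let J_linear : linear (fun p : F * E => (p.1, - p.2)).
Proof. by move=> a p q; congr (_, _); rewrite /= opprD scalerN. Qed.

Let J := mk_linear J_linear.

Let JK p : J (J p) = p.
Proof. by case: p => f x; rewrite /= opprK. Qed.

Let Jc : continuous J.
Proof.
move=> p; apply: pair_cvg => /=; first exact: cvg_fst.
by apply: cvgN; exact: cvg_snd.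
Qed.

Let jlin : linear j. Proof. by case: hj. Qed.
Let jl := mk_linear jlin.
Let jc : continuous jl. Proof. by case: hj. Qed.

Lemma reduction_graph_reflect p q :
  reduction_graph j D T (p, q) <-> reduction_graph j D T (J p, J (- q)).
Proof.
have jN y : j (- y) = - j y by rewrite -[j]/(jl : F -> E) linearN.
case: p => f x; case: q => g y; rewrite /reduction_graph /= jN opprK.
by split=> -[Df xg yT]; split=> //; [rewrite xg|rewrite -[x]opprK xg opprK].
Qed.

Lemma generates_group_semigroup (G : set ((F * E) * (F * E))) :
  generates_group G -> generates_C0_semigroup em G.
Proof. by move=> [U hU UG]; exists U; split=> //; exact: group_semigroup. Qed.

Lemma reduction_graph_group :
  generates_C0_semigroup em (reduction_graph j D T) ->
  generates_group (reduction_graph j D T).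
Proof.
move=> [U [hU UG]]; have hFE := banach_prod hF hE.
have [Uc U0 UD Ux] := hU.
pose V t : {linear (F * E)%type -> (F * E)%type} := J \o (U t \o J).
have VE t p : V t p = J (U t (J p)) by [].
have hV : C0_semigroup V.
  split=> [t t0 z|x|t s x t0 s0|x].
  - apply: continuous_comp; last exact: Jc.
    by apply: continuous_comp; [exact: Jc|exact: Uc].
  - by rewrite VE U0 JK.
  - by rewrite !VE JK UD.
  - apply/subspace_continuousP => t t0; have /subspace_continuousP/(_ t t0) := Ux (J x).
    by move=> /linear_cvg; apply.
have genE (W : R -> {linear (F * E)%type -> (F * E)%type}) p q :
  C0_generator em W (p, q) = ((em h)^-1 *: (W h p - p) @[h --> 0^'+] --> q) by [].
have genV p q : C0_generator em V (p, q) <-> C0_generator em U (J p, J q).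
  rewrite !genE; split=> pq.
    apply: eq_fun_cvg (linear_cvg _ Jc pq) => h.
    by rewrite [RHS]linearZ [J (_ - _)]linearB VE JK.
  have : J ((em h)^-1 *: (U h (J p) - J p)) @[h --> 0^'+] --> J (J q).
    exact: linear_cvg.
  rewrite JK; apply: eq_fun_cvg => h.
  by rewrite [RHS]linearZ [J (_ - _)]linearB JK VE.
have UV p q : C0_generator em U (p, q) <-> C0_generator em V (p, - q).
  by rewrite genV UG; exact: reduction_graph_reflect.
exists (glue_semigroups U V); first exact: glue_group.
by rewrite glue_generator.
Qed.

Variable U : R -> {linear (F * E)%type -> (F * E)%type}.
Hypotheses (hU : C0_group U) (UG : C0_generator em U = reduction_graph j D T).

Lemma group_reflect t p : J (U t p) = U (- t) (J p).
Proof.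
have hFE := banach_prod hF hE; have [Uc U0 UD Ux] := hU.
have hV : C0_group (fun t => U (- t)).
  split=> [s|x|s r x|x s]; first exact: Uc.
  - by rewrite oppr0 U0.
  - by rewrite opprD UD.
  apply: (@cvg_comp _ _ _ -%R (fun s => U s x) _ (nbhs (- s))).
    exact: continuous_opp_real.
  exact: Ux.
apply: (@group_intertwine _ _ S _ _ U (fun t => U (- t)) J hFE hFE hU hV) => // x y.
rewrite UG reduction_graph_reflect -UG => xy.
have := group_der hFE hU (t := - 0) xy; rewrite [U (- 0) _](_ : _ = J (- y)); last first.
  by rewrite oppr0 U0.
move=> /der_reflect/der_rder; rewrite linearN opprK.
by apply: eq_fun_cvg => h; rewrite add0r oppr0 U0.
Qed.

Lemma domain_graph f : D (j f) -> C0_generator em U ((f, 0), (0, T (j f))).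
Proof.
have j0 : j 0 = 0 by rewrite -[j]/(jl : F -> E) linear0.
by rewrite UG /reduction_graph /= => Df; split=> //; rewrite j0.
Qed.

Lemma velocity_graph f : C0_generator em U ((0, j f), (f, 0)).
Proof.
have : generates_group (reduction_graph j D T) by exists U.
move=> /generates_group0 [/= D0 _ T0].
by rewrite UG /reduction_graph /=; split.
Qed.

(** The linearity of T on its domain comes from that of the generator of U, whose graph contains (f,
    0) -> (0, T (j f)). *)
Lemma domain_bound : exists2 M : R, 0 <= M & forall f f', D (j f) -> D (j f') ->
  N (f - f') <= M * (N (j f - j f') + N (T (j f) - T (j f'))).
Proof.
have [_ [M hM]] := hT; exists (rabs M); first exact: rabs_ge0.
move=> f f' Df Df'.
have := generator_linear (a := -1) (domain_graph Df') (domain_graph Df).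
rewrite UG /reduction_graph => -[/=]; rewrite !scaleN1r => Dff' _ Tff'.
have jD y z : j (- y + z) = - j y + j z by rewrite -[j]/(jl : F -> E) linearD linearN.
have := hM _ Dff'; move=> /(real_bound (normr_ge0 _) _) => /(_ (addr_ge0 (normr_ge0 _) (normr_ge0 _))).
rewrite -(@emb_rabs _ _ S) -!(@emb_rnorm _ _ S) -rmorphD -rmorphM emb_le.
by rewrite -Tff' jD ![- _ + _]addrC.
Qed.

(** Approximants that are Cauchy in the graph norm converge in F by [domain_bound]; the closedness
    of the group generator at the pairs (f, 0) -> (0, T (j f)) does the rest. *)
Lemma operator_closed x y :
  (forall e : R, 0 < e -> exists f, [/\ D (j f), N (j f - x) < e & N (T (j f) - y) < e]) ->
  D x /\ y = T x.
Proof.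
move=> approx; have [M M0 hM] := domain_bound.
have /choice[f fP] (n : nat) : exists f,
    [/\ D (j f), N (j f - x) < n.+1%:R^-1 & N (T (j f) - y) < n.+1%:R^-1].
  by apply: approx; rewrite invr_gt0.
have [e e0|l fl] := @hF f.
  (* Four distances below r enter the graph norm of f p - f q: one to x and one to y for each
     index. *)
  have M1 : 0 < 4 * (M + 1) by rewrite mulr_gt0 // ltr_wpDl.
  have r0 := divr_gt0 e0 M1; set r := e / _ in r0.
  have rE : r * (4 * (M + 1)) = e by rewrite /r divfK ?gt_eqF.
  have [n nP] := small_inverse r0; exists n => p q np nq.
  have [Dp px py] := fP p; have [Dq qx qy] := fP q.
  apply: le_lt_trans (hM _ _ Dp Dq) _.
  have h : N (j (f p) - j (f q)) + N (T (j (f p)) - T (j (f q))) <= 4 * r.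
    have := nP p np; have := nP q nq; move: px py qx qy.
    have := @rdistD _ _ S _ x (j (f p)) (j (f q)); rewrite (rdistC x).
    have := @rdistD _ _ S _ y (T (j (f p))) (T (j (f q))); rewrite (rdistC y).
    move: (p.+1%:R^-1) (q.+1%:R^-1) => a b; lra.
  by apply: le_lt_trans (ler_wpM2l M0 h) _; lra.
have jl_ : j l = x.
  have jfl : jl (f n) @[n --> \oo] --> jl l by exact: linear_cvg.
  have jfx : jl (f n) @[n --> \oo] --> x.
    apply/(@cvg_seqP _ _ S) => e /small_inverse[n nP].
    by exists n => p /nP; apply: lt_trans; have [] := fP p.
  by apply: cvg_unique jfl jfx.
have hFE := banach_prod hF hE.
have : C0_generator em U ((l, 0), (0, y)).
  apply: (generator_closed hFE hU) => e e0.
  have [n nP] := small_inverse e0; have /(@cvg_seqP _ _ S)/(_ e e0)[m mP] := fl.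
  have [Df fx fy] := fP (maxn n m).
  exists ((f (maxn n m), 0), (0, T (j (f (maxn n m))))); first exact: domain_graph.
  split; rewrite rnorm_pair /= subrr rnorm0 gt_max e0 ?andbT //=.
    exact: mP (leq_maxr _ _).
  by apply: lt_trans fy _; apply: nP; exact: leq_maxl.
by rewrite UG => -[/= + _ ->]; rewrite jl_.
Qed.

Lemma domain_scale a f : D (j f) -> D (j (a *: f)) /\ T (j (a *: f)) = a *: T (j f).
Proof.
move=> Df; have G0 : C0_generator em U (0, 0).
  by apply: generates_group0; exists U.
have := generator_linear (a := a) (domain_graph Df) G0.
by rewrite !addr0 UG => -[].
Qed.

Definition group_cosine (t : R) : {linear E -> E} :=
  mk_linear (@snd_linear K F E) \o (U t \o mk_linear (@inr_linear K F E)).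

Lemma group_cosineE t x : group_cosine t x = (U t (0, x)).2. Proof. by []. Qed.

Lemma group_velocity_reflect s x :
  U (- s) (0, x) = (- (U s (0, x)).1, (U s (0, x)).2).
Proof.
have := group_reflect s (0, x); rewrite [J (0, x)](_ : _ = - (0, x)); last first.
  by congr (_, _); rewrite /= oppr0.
rewrite linearN => /(congr1 -%R); rewrite opprK => <-.
by congr (_, _); rewrite /= opprK.
Qed.

Lemma group_cosine_even t x : group_cosine (- t) x = group_cosine t x.
Proof. by rewrite !group_cosineE group_velocity_reflect. Qed.

Lemma group_cosine_continuous x : continuous (fun t => group_cosine t x).
Proof. by have [_ _ _ Ux] := hU; move=> t; exact: snd_cvg (Ux (0, x) t). Qed.

(** Reflection changes only the sign of the first component of U s (0, x), so U s (0, x) + U (- s)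
    (0, x) is twice (0, C s x). Applying U t gives d'Alembert's equation. *)
Lemma group_cosine_function : cosine_function group_cosine.
Proof.
have [Uc U0 UD Ux] := hU; split.
- move=> t x; rewrite /group_cosine; apply: continuous_comp; last exact: cvg_snd.
  apply: continuous_comp; last exact: Uc.
  by apply: pair_cvg; [exact: cvg_cst|exact: cvg_id].
- by move=> x; rewrite group_cosineE U0.
- move=> t s x; rewrite !group_cosineE !UD group_velocity_reflect.
  rewrite -[_ + _]/(U t (U s (0, x)) + U t (- (U s (0, x)).1, (U s (0, x)).2)).2.
  rewrite -linearD [U s (0, x) + _](_ : _ = 2%:R *: (0, (U s (0, x)).2)).
    by rewrite linearZ.
  case: (U s (0, x)) => a b; congr (_, _) => /=; first by rewrite scaler0 subrr.
  by rewrite scaler_nat mulr2n.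
- exact: group_cosine_continuous.
Qed.

(** Let z t be the F-component of the primitive of s -> U s (0, x). Then T (j (z t)) = C t x - x.
    Divided by t^2/2, j (z t) tends to x and C t x - x to f2 0, so [operator_closed] applies. *)
Lemma group_cosine_generator_sub x y :
  cosine_generator em group_cosine (x, y) -> graph D T (x, y).
Proof.
have [Uc U0 UD Ux] := hU; have hFE := banach_prod hF hE.
move=> [f1 [f2 [/= Cf1 f1f2 f2c ->]]]; rewrite /graph /=.
(* The orbit is even in time, so its derivative at 0 equals its own negative. *)
have f10 : f1 0 = 0.
  have d1 : der (fun s => group_cosine s x) 0 (- f1 0).
    have d0 : der (fun s => group_cosine s x) (- 0) (f1 0).
      by rewrite oppr0; exact: Cf1.
    by apply: eq_fun_cvg (der_reflect d0) => h; rewrite !group_cosine_even.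
  have : f1 0 = - f1 0 by apply: cvg_unique (Cf1 0) d1.
  move=> /eqP; rewrite -subr_eq0 opprK -mulr2n -scaler_nat scaler_eq0 pnatr_eq0.
  by move=> /eqP.
have f1c : continuous f1 by move=> t; apply: der_continuous (f1f2 t).
have lim1 : (em (t ^+ 2 / 2))^-1 *: (group_cosine t x - x) @[t --> 0^'+] --> f2 0.
  apply: (@taylor2 E (fun t => group_cosine t x - x) f1 f2) => //.
  - move=> t; apply: cvgB; last exact: cvg_cst; exact: group_cosine_continuous.
  - exact: f2c.
  - move=> t _; rewrite -[f1 t]subr0; apply: rderB; last exact: rder_cst.
    exact: der_rder (Cf1 t).
  - by move=> t _; exact: der_rder (f1f2 t).
  - by rewrite group_cosineE U0 subrr.
have [_ Ux'] := semigroup_family (S := S) (group_semigroup hU).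
pose phi t := U (Num.max 0 t) (0, x).
have phic : continuous phi by exact: Ux'.
have [p0 pf] := primP hFE phic.
have pc : continuous (prim phi) by exact: prim_continuous.
(* The second clause identifies the primitive of the cosine orbit with the F-component of U t (0,
   x); it provides the first derivative required by [taylor2]. *)
have graph_phi (t : R) : 0 <= t -> [/\ D (j (prim phi t).1),
    (prim phi t).2 = j (U t (0, x)).1 & group_cosine t x - x = T (j (prim phi t).1)].
  move=> t0; have := prim_orbit_generator hFE (group_semigroup hU) (x := (0, x)) t0.
  by rewrite UG => -[/=]; rewrite subr0.
have lim2 : (em (t ^+ 2 / 2))^-1 *: j (prim phi t).1 @[t --> 0^'+] --> x.
  have -> : x = (phi 0).2 by rewrite /phi maxxx U0.
  apply: (@taylor2 E (fun t => j (prim phi t).1) (fun t => (prim phi t).2)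
    (fun t => (phi t).2)).
  - by move=> t; apply: (linear_cvg (A := jl)) => //; exact: fst_cvg (pc t).
  - by move=> t; exact: snd_cvg (pc t).
  - exact: snd_cvg (phic 0).
  - move=> t t0; have [_ -> _] := graph_phi t t0.
    have := der_rder (pf t); rewrite {2}/phi max_r // => d.
    have d1 := rder_linear (@fst_continuous F E) d.
    exact: (rder_linear (A := jl) jc d1).
  - move=> t t0; have := der_rder (pf t) => d.
    exact: (rder_linear (@snd_continuous F E) d).
  - by rewrite p0 /= -[j]/(jl : F -> E) linear0.
  - by rewrite p0.
apply: operator_closed => e e0.
move: lim1 lim2 => /(@cvg_rnorm _ _ S)/(_ e e0)/near_right[d1 d10 dP1].
move=> /(@cvg_rnorm _ _ S)/(_ e e0)/near_right[d2 d20' dP2].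
pose d := Num.min d1 d2; have d0 : 0 < d by rewrite lt_min d10.
have dd1 : d <= d1 by rewrite ge_min lexx.
have dd2 : d <= d2 by rewrite ge_min lexx orbT.
have d20 : 0 < d / 2 by lra.
have h1 := dP1 (d / 2) d20 ltac:(lra).
have h2 := dP2 (d / 2) d20 ltac:(lra).
have [Dp _ Tp] := graph_phi (d / 2) (ltW d20).
exists ((em ((d / 2) ^+ 2 / 2))^-1 *: (prim phi (d / 2)).1).
have [Dp' Tp'] := domain_scale (em ((d / 2) ^+ 2 / 2))^-1 Dp.
split=> //; last by rewrite Tp' -Tp.
by rewrite -[j]/(jl : F -> E) linearZ.
Qed.

Lemma group_cosine_generator : cosine_generator em group_cosine = graph D T.
Proof.
have [Uc U0 UD Ux] := hU; have hFE := banach_prod hF hE.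
apply/seteqP; split=> -[x y]; first exact: group_cosine_generator_sub.
rewrite /graph /= => -[Dx ->]; have [Dj _] := hT; have [f _ fx] := Dj x Dx.
rewrite -fx in Dx *.
(* The matrix sends (0, j f) to (f, 0) and (f, 0) to (0, T (j f)). The second components of these
   three orbits are the cosine orbit of x and its first two derivatives. *)
exists (fun t => (U t (f, 0)).2), (fun t => (U t (0, T (j f))).2); split=> /=.
- move=> t; have := group_der hFE hU (t := t) (@velocity_graph f) => d.
  exact: (der_linear (@snd_continuous F E) d).
- move=> t; have := group_der hFE hU (t := t) (domain_graph Dx) => d.
  exact: (der_linear (@snd_continuous F E) d).
- by move=> t; exact: snd_cvg (Ux _ t).
- by rewrite U0.
Qed.

End ReductionGraph.

Lemma kisynski_generates_COF (E F : normedModType K) (j : F -> E) (D : set E)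
    (T : E -> E) : banach E -> banach F ->
  kisynski_space em j D T -> generates_COF em D T.
Proof.
move=> hE hF [hT hj /(reduction_graph_group hE hF hj)[U hU UG]].
exists (group_cosine U); split.

  exact (group_cosine_function hE hF hj hU UG).
exact (group_cosine_generator hE hF hj hT hU UG).
Qed.

End Kisynski.

(** * Compactness of sine functions *)

Section TotallyBounded.
Context {R : realType} {K : numFieldType} {S : scalars R K}.
Local Notation N := (@rnorm R K S _).
Local Notation banach := (@banach R K S).
Implicit Types E F : normedModType K.

Definition totally_bounded E (A : set E) := forall e : R, 0 < e ->
  exists s : seq E, forall x, A x -> exists2 y, y \in s & N (x - y) < e.

Lemma totally_boundedS E (A B : set E) :
  A `<=` B -> totally_bounded B -> totally_bounded A.
Proof. by move=> AB hB e /hB[s sP]; exists s => x /AB/sP. Qed.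

Lemma totally_bounded_approx E (A : set E) :
  (forall e : R, 0 < e -> exists2 B, totally_bounded B &
     forall x, A x -> exists2 y, B y & N (x - y) <= e) ->
  totally_bounded A.
Proof.
move=> hA e e0; have [|B hB AB] := hA (e / 2); first by lra.
have [|s sP] := hB (e / 2); first by lra.
exists s => x /AB[y /sP[z zs yz] xy]; exists z => //.
by apply: le_lt_trans (rdistD y _ _) _; lra.
Qed.

Lemma totally_bounded_image E F (A : set E) (f : {linear E -> F}) :
  continuous f -> totally_bounded A -> totally_bounded (f @` A).
Proof.
move=> /(@continuous_bounded _ _ S)[M M0 fM] hA e e0.
have M1 : 0 < M + 1 by rewrite ltr_wpDl.
have [s sP] := hA _ (divr_gt0 e0 M1).
exists (map f s) => _ [x /sP[y ys xy] <-]; exists (f y); first exact: map_f.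
rewrite ltr_pdivlMr // in xy; rewrite -linearB; apply: le_lt_trans (fM _) _.
have := @rnorm_ge0 _ _ S _ (x - y); lra.
Qed.

Lemma totally_bounded_prod E F (A : set E) (B : set F) :
  totally_bounded A -> totally_bounded B -> totally_bounded (A `*` B).
Proof.
move=> hA hB e e0; have [s sP] := hA e e0; have [r rP] := hB e e0.
exists [seq (x, y) | x <- s, y <- r] => -[x y] /= [/sP[x' x's xx'] /rP[y' y'r yy']].
exists (x', y'); first exact: allpairs_f.
by rewrite rnorm_pair gt_max; apply/andP.
Qed.

Lemma ultra_seq_cover T (F : set_system T) (I : eqType) (s : seq I) (B : I -> set T) :
  UltraFilter F -> F [set x | exists2 i, i \in s & B i x] ->
  exists i, F (B i).
Proof.
move=> FU; elim: s => [|i s IH] Fs.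
  by have [x [j]] := filter_ex Fs; rewrite in_nil.
have [Fi|Fi] := in_ultra_setVsetC (B i) FU; first by exists i.
apply: IH; apply: filterS2 Fs Fi => x [j]; rewrite in_cons => /orP[/eqP ->|js] Bj //.
by exists j.
Qed.

(** For the converse, an ultrafilter on the closure picks one of finitely many balls at each scale
    2^-n. The centres form a Cauchy sequence, and their limit is the limit of the ultrafilter. *)
Lemma precompact_totally_bounded E (A : set E) : banach E ->
  precompact A <-> totally_bounded A.
Proof.
move=> hE; split.
  rewrite precompactE compact_cover => cA e e0.
  have [||D _ AD] := cA E setT (fun y => [set x | N (x - y) < e]).
  - move=> y _; rewrite openE => x /= xy; apply/(@near_rnorm _ _ S).
    exists (e - N (x - y)); first by rewrite subr_gt0.
    move=> z zx; apply: le_lt_trans (rdistD x _ _) _; lra.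
  - by move=> x _; exists x => //=; rewrite subrr rnorm0.
  exists (finmap.enum_fset D) => x Ax.
  have [y yD xy] := AD x (subset_closure Ax); exists y => //.
move=> hA; rewrite precompactE compact_ultra => F FU FA.
have /choice[y yP] (n : nat) : exists y : E, F [set x | N (x - y) < 1 / 2 ^+ n].
  (* Half of the radius is reserved for the passage from A to its closure. *)
  have [|s sP] := hA (1 / 2 ^+ n.+1); first by rewrite divr_gt0 // exprn_gt0.
  apply: (@ultra_seq_cover _ F _ s (fun y => [set x | N (x - y) < 1 / 2 ^+ n])).
  apply: filterS FA => x clA.
  have [z [Az xz]] : A `&` [set z | N (z - x) < 1 / 2 ^+ n.+1] !=set0.
    apply: clA; apply/(@near_rnorm _ _ S); exists (1 / 2 ^+ n.+1) => //.
  have [y ys zy] := sP z Az; exists y => //.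
  rewrite /= in xz *; apply: le_lt_trans (rdistD z _ _) _; rewrite (rdistC x).
  apply: lt_le_trans (ltrD xz zy) _; rewrite exprS.
  by apply: eq_leW; field; rewrite expf_neq0.
have [n|l yl ly] := @geometric_cvg _ _ S _ y 2 hE.
  have [x [xn xn1]] := filter_ex (filterI (yP n) (yP n.+1)).
  rewrite /= in xn xn1; apply: le_trans (rdistD x _ _) _; rewrite rdistC.
  have : 1 / 2 ^+ n.+1 <= 1 / 2 ^+ n :> R.
    by rewrite ler_pM2l // lef_pV2 ?posrE ?exprn_gt0 // ler_weXn2l // ler1n.
  have -> : 2 / 2 ^+ n = 1 / 2 ^+ n + 1 / 2 ^+ n :> R by rewrite -mulrDl.
  lra.
have Fl : F --> l.
  move=> B /(@near_rnorm _ _ S)[d d0 dB].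
  have [n nd] := small_geometric 5 d0; apply: filterS (yP n) => x /= xn.
  apply: dB; apply: le_lt_trans (rdistD (y n) _ _) _; have := ly n; rewrite rdistC.
  have -> : 2 * 2 / 2 ^+ n = 5 / 2 ^+ n - 1 / 2 ^+ n :> R by rewrite -mulrBl; congr (_ / _); ring.
  lra.
exists l; split=> //; rewrite [closure A](closure_id _).1; last exact: closed_closure.
by move=> B /Fl FB; exact: filter_ex (filterI FA FB).
Qed.

End TotallyBounded.

(** * The functional equation of cosine functions and compactness of their sine functions *)

Section CosineTheory.
Context {R : realType} {K : numFieldType} {S : scalars R K}.
Local Notation em := (@emb R K S).
Local Notation N := (@rnorm R K S _).
Local Notation banach := (@banach R K S).
Local Notation der := (@der R K S _).
Local Notation prim := (@prim R K S _).
Variables (E : normedModType K) (hE : banach E) (C : R -> {linear E -> E}).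
Hypothesis hC : cosine_function C.

Let Cc t : continuous (C t). Proof. by case: hC. Qed.
Let C0 x : C 0 x = x. Proof. by case: hC. Qed.
Let CD t s x : C (t + s) x + C (t - s) x = 2%:R *: C t (C s x).
Proof. by case: hC. Qed.
Let Cx x : continuous (fun t => C t x). Proof. by case: hC. Qed.

Let Cfam : strong_family C. Proof. by case: hC. Qed.

Lemma two_inj (V : lmodType K) (x y : V) : 2%:R *: x = 2%:R *: y -> x = y.
Proof. by apply: scalerI; rewrite pnatr_eq0. Qed.

Lemma cosine_even t x : C (- t) x = C t x.
Proof.
have := CD 0 t x; rewrite C0 add0r sub0r -[_ + C (- t) x]addrC scaler_nat mulr2n.
by move=> /addIr.
Qed.

Lemma der_unique (f : R -> E) t l m : der f t l -> der f t m -> l = m.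
Proof. by move=> fl fm; apply: cvg_unique fl fm. Qed.

Lemma der_add (f g : R -> E) t l m :
  der f t l -> der g t m -> der (fun t => f t + g t) t (l + m).
Proof.
move=> fl gm; have := der_lincomb (a := 1) fl gm; rewrite scale1r.
by apply: eq_fun_cvg => h; rewrite !scale1r.
Qed.

Lemma der_scale (f : R -> E) t (a : K) l :
  der f t l -> der (fun t => a *: f t) t (a *: l).
Proof.
move=> fl; have := der_lincomb (a := a) fl (der_cst 0 t); rewrite addr0.
by apply: eq_fun_cvg => h; rewrite !addr0.
Qed.

Lemma der_reflect_shift (f : R -> E) r t l :
  der f (r - t) l -> der (fun t => f (r - t)) t (- l).
Proof.
move=> fl; apply: (der_reflect (f := fun s => f (r + s))).
have : der (fun s => f (s + r)) (- t) l by apply: der_shift; rewrite addrC.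
by apply: eq_fun_cvg => h; rewrite ![r + _]addrC.
Qed.

(** Differentiating d'Alembert's equation once and twice in its second argument gives [d1] and [d2];
    evaluating them at 0 gives both claims. *)
Lemma cosine_generator_orbit x (f1 f2 : R -> E) :
  (forall t, der (fun s => C s x) t (f1 t)) -> (forall t, der f1 t (f2 t)) ->
  f1 0 = 0 /\ forall t, f2 t = C t (f2 0).
Proof.
move=> Cf1 f1f2.
have d1 r t : f1 (r + t) - f1 (r - t) = 2%:R *: C r (f1 t).
  apply: (@der_unique (fun t => C (r + t) x + C (r - t) x) t).
    apply: der_add; last by apply: (der_reflect_shift (f := fun s => C s x)).
    have : der (fun t => C (t + r) x) t (f1 (r + t)).
      by apply: (der_shift (f := fun s => C s x)); rewrite addrC.
    by apply: eq_fun_cvg => h; rewrite ![r + _]addrC.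
  have : der (fun t => 2%:R *: C r (C t x)) t (2%:R *: C r (f1 t)).
    by apply: der_scale; apply: (der_linear (f := fun t => C t x)).
  by apply: eq_fun_cvg => h; rewrite !CD.
have d2 r t : f2 (r + t) + f2 (r - t) = 2%:R *: C r (f2 t).
  apply: (@der_unique (fun t => f1 (r + t) - f1 (r - t)) t).
    rewrite -[f2 (r - t)]opprK; apply: derB; last exact: der_reflect_shift.
    have : der (fun t => f1 (t + r)) t (f2 (r + t)).
      by apply: der_shift; rewrite addrC.
    by apply: eq_fun_cvg => h; rewrite ![r + _]addrC.
  have : der (fun t => 2%:R *: C r (f1 t)) t (2%:R *: C r (f2 t)).
    by apply: der_scale; apply: der_linear.
  by apply: eq_fun_cvg => h; rewrite !d1.
split.
  by apply: two_inj; have := d1 0 0; rewrite addr0 subr0 subrr C0 scaler0 => <-.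
by move=> t; apply: two_inj; rewrite -d2 addr0 subr0 scaler_nat.
Qed.

Lemma cosine_generator_linear a x y x' y' :
  cosine_generator em C (x, y) -> cosine_generator em C (x', y') ->
  cosine_generator em C (a *: x + x', a *: y + y').
Proof.
move=> [f1 [f2 [/= d1 d2 c2 ->]]] [g1 [g2 [/= e1 e2 c2' ->]]].
exists (fun t => a *: f1 t + g1 t), (fun t => a *: f2 t + g2 t); split=> //= [t|t|t].
- have := der_lincomb (a := a) (d1 t) (e1 t).
  by apply: eq_fun_cvg => h; rewrite !linearP.
- exact (der_lincomb (a := a) (d2 t) (e2 t)).
- exact (@cvgD _ _ _ _ _ _ _ _ _ (cvgZ (cvg_cst a) (c2 t)) (c2' t)).
Qed.

Definition sine_primitive x := prim (prim (fun s => C s x)).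

(** [formula] is d'Alembert's equation integrated twice in its second argument. Its right-hand side
    is visibly twice differentiable in r, which puts z t in the domain. *)
Lemma sine_primitive_generator x t :
  cosine_generator em C (sine_primitive x t, C t x - x).
Proof.
set s := prim (fun s => C s x); have sc : continuous s by exact: prim_continuous.
have [s0 sd] := primP hE (Cx (x := x)); rewrite -/s in s0 sd.
have [z0 zd] := primP hE sc; rewrite -/s -/(sine_primitive x) in z0 zd.
set z := sine_primitive x in z0 zd *.
have zc : continuous z by exact: prim_continuous.
have shiftD (f f' : R -> E) r : (forall t, der f t (f' t)) ->
    forall t, der (fun t => f (r + t)) t (f' (r + t)).
  move=> ff' q; have : der (fun t => f (t + r)) q (f' (r + q)).
    by apply: der_shift; rewrite addrC.
  by apply: eq_fun_cvg => h; rewrite ![r + _]addrC.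
pose half : K := 2%:R^-1.
have formula r q : C r (z q) = half *: (z (r + q) + z (r - q)) - z r.
  pose g1 q := C r (s q) - half *: (s (r + q) - s (r - q)).
  have g1d q' : der g1 q' 0.
    have -> : 0 = C r (C q' x) - half *: (C (r + q') x - - C (r - q') x).
      by rewrite opprK CD scalerA mulVf ?pnatr_eq0 // scale1r subrr.
    apply: derB; first by apply: der_linear.
    apply: der_scale; apply: derB; first by apply: (shiftD s (fun t => C t x)).
    exact: der_reflect_shift.
  have g10 q' : g1 q' = 0.
    rewrite (@rder0_const _ _ S _ g1 _ _ q' 0).
    - by rewrite /g1 s0 linear0 addr0 subr0 subrr scaler0 subrr.
    - by move=> q''; apply: der_continuous (g1d q'').
    - by move=> q''; exact: der_rder.
  pose g q := C r (z q) - (half *: (z (r + q) + z (r - q)) - z r).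
  have gd q' : der g q' 0.
    have -> : 0 = C r (s q') - (half *: (s (r + q') + - s (r - q')) - 0).
      by rewrite subr0; exact/esym/g10.
    apply: derB; first by apply: der_linear.
    apply: derB; last exact: der_cst.
    apply: der_scale; apply: der_add; first exact: shiftD.
    exact: der_reflect_shift.
  apply/eqP; rewrite -subr_eq0; apply/eqP; rewrite -/(g q).
  rewrite (@rder0_const _ _ S _ g _ _ q 0).
  - rewrite /g z0 linear0 addr0 subr0 -mulr2n -scaler_nat scalerA mulVf ?pnatr_eq0 //.
    by rewrite scale1r !subrr.
  - by move=> q''; apply: der_continuous (gd q'').
  - by move=> q''; exact: der_rder.
exists (fun r => half *: (s (r + t) + s (r - t)) - s r),
  (fun r => half *: (C (r + t) x + C (r - t) x) - C r x); split=> /=.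
- move=> r; have : der (fun r => half *: (z (r + t) + z (r - t)) - z r) r
      (half *: (s (r + t) + s (r - t)) - s r).
    by apply: derB => //; apply: der_scale; apply: der_add; apply: der_shift.
  by apply: eq_fun_cvg => h; rewrite !formula.
- move=> r; suff : der (fun r => half *: (s (r + t) + s (r - t)) - s r) r
      (half *: (C (r + t) x + C (r - t) x) - C r x) by [].
  apply: derB => //; apply: der_scale.
  by apply: der_add; apply: (der_shift (f := s)).
- have shiftc q : continuous (fun r => C (r + q) x).
    move=> r; apply: (@cvg_comp _ _ _ (fun r => r + q) (fun t => C t x) _ (nbhs (r + q))).
      by apply: cvgD; [exact: cvg_id|exact: cvg_cst].
    exact: Cx.
  move=> r; apply: cvgB; last exact: Cx.
  apply: cvgZ; first exact: cvg_cst.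
  by apply: cvgD; [exact: shiftc|exact: (shiftc (- t))].
- rewrite add0r sub0r cosine_even C0 -mulr2n -scaler_nat scalerA mulVf ?pnatr_eq0 //.
  by rewrite scale1r.
Qed.

Lemma sineE t x : sine em C t x = prim (fun s => C s x) t.
Proof. by rewrite /sine vintegral_prim //; exact: Cx. Qed.

(* [C s x - x] is of order [s ^ 2] on the unit ball of the domain, so the
   averages [S t x / t] approximate the identity uniformly there. *)
Lemma sine_average (M : R) x y (t : R) : 0 < t -> 0 <= M ->
  (forall s, `|s| <= t -> forall z, N (C s z) <= M * N z) ->
  cosine_generator em C (x, y) ->
  N (x - (em t)^-1 *: sine em C t x) <= M * N y * t ^+ 2.
Proof.
move=> t0 M0 CM [f1 [f2 [/= d1 d2 c2 ->]]].
have [f10 f2E] := cosine_generator_orbit d1 d2.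
have f1c : continuous f1 by move=> s; apply: der_continuous (d2 s).
have b1 (s : R) : 0 <= s -> s <= t -> N (f1 s) <= M * N (f2 0) * t.
  move=> s0 st; apply: le_trans (_ : M * N (f2 0) * s <= _).
    have := @mean_value _ _ S _ f1 f2 (M * N (f2 0)) 0 s s0 f1c.
    rewrite f10 !subr0; apply.
      by move=> r _; apply: der_rder; exact: d2.
    move=> r /andP[r0 rs]; rewrite f2E; apply: CM.
    by rewrite ger0_norm //; lra.
  by rewrite ler_wpM2l // mulr_ge0 ?rnorm_ge0.
have b0 (s : R) : 0 <= s -> s <= t -> N (C s x - x) <= M * N (f2 0) * t * t.
  move=> s0 st; apply: le_trans (_ : M * N (f2 0) * t * s <= _).
    have := @mean_value _ _ S _ (fun s => C s x) f1 (M * N (f2 0) * t) 0 s s0.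
    rewrite C0 subr0; apply; first exact: Cx.
      by move=> r _; apply: der_rder; exact: d1.
    by move=> r /andP[r0 rs]; apply: b1 => //; lra.
  by rewrite ler_wpM2l // !mulr_ge0 ?rnorm_ge0 // ltW.
have [p0 pd] := primP hE (Cx (x := x)).
rewrite sineE rdistC quotient_dist ?gt_eqF // gtr0_norm // ler_pdivrMl //.
have := @mean_value _ _ S _ (fun s => prim (fun s => C s x) s - em s *: x)
  (fun s => C s x - x) (M * N (f2 0) * t * t) 0 t (ltW t0).
rewrite p0 rmorph0 scale0r !subr0 => h; apply: le_trans (h _ _ _) _.
- move=> s; apply: cvgB; first exact: prim_continuous.
  by apply: der_continuous; exact: der_line.
- by move=> s _; apply: rderB; apply: der_rder; [exact: pd|exact: der_line].
- by move=> s /andP[s0 st]; apply: b0 => //; exact: ltW.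
- by apply: eq_leW; ring.
Qed.

Variables (D : set E) (T : E -> E).
Hypothesis hCT : cosine_generator em C = graph D T.

Lemma sine_compact_domain :
  (forall t, compact_operator (sine em C t)) -> compact_domain_embedding D T.
Proof.
move=> Scpt; apply/(@precompact_totally_bounded _ _ S _ _ hE).
apply: totally_bounded_approx => e e0.
have [M M0 CM] := strong_family_bound 1 hE Cfam.
(* On the unit ball of the graph norm [sine_average] has error at most M t^2; t <= 1 stays in the
   range of the bound M and reduces this to M t. *)
pose t := Num.min 1 (e / (M + 1)).
have M1 : 0 < M + 1 by rewrite ltr_wpDl.
have t0 : 0 < t by rewrite lt_min ltr01 divr_gt0.
have t1 : t <= 1 by rewrite ge_min lexx.
have te : t * (M + 1) <= e by rewrite -ler_pdivlMr // ge_min lexx orbT.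
have scale_lin : linear (fun x : E => (em t)^-1 *: x).
  by move=> a x y; rewrite scalerDr !scalerA [a * _]mulrC.
have scale_c : continuous (mk_linear scale_lin).
  by move=> x; apply: cvgZ; [exact: cvg_cst|exact: cvg_id].
exists (mk_linear scale_lin @` (sine em C t @` [set x | `|x| <= 1])).
  apply: totally_bounded_image => //.
  exact/(precompact_totally_bounded _ hE)/Scpt.
move=> x [Dx xT]; have N1 : N x + N (T x) <= 1.
  by rewrite -(@emb_le _ _ S) rmorphD !emb_rnorm rmorph1.
have x0 := @rnorm_ge0 _ _ S _ x; have y0 := @rnorm_ge0 _ _ S _ (T x).
exists ((em t)^-1 *: sine em C t x).
  exists (sine em C t x) => //; exists x => //=.
  by rewrite -(rmorph1 em) normE_le; lra.
have xTx : cosine_generator em C (x, T x) by rewrite hCT.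
apply: le_trans (sine_average t0 M0 _ xTx) _.
  by move=> s st; apply: CM; lra.
apply: le_trans te; rewrite expr2.
have : M * N (T x) <= M * 1 by rewrite ler_wpM2l //; lra.
have : 0 <= M * N (T x) by rewrite mulr_ge0.
move: (M * N (T x)) => a a0 aM.
apply: le_trans (_ : a * t <= _); first by rewrite ler_wpM2l // ler_piMr // ltW.
by rewrite mulrC ler_wpM2l ?ltW //; lra.
Qed.

Lemma prim_bound_sym (f : R -> E) (M r t : R) : continuous f -> 0 <= M ->
  (forall s, `|s| <= r -> N (f s) <= M) -> `|t| <= r -> N (prim f t) <= M * r.
Proof.
move=> fc M0 fM tr; have [p0 pd] := primP hE fc.
have := @mean_value_sym _ _ S _ (prim f) f (fun s => M * s) (fun=> M) r p0 pd.
rewrite mulr0 => h; apply: le_trans (h _ _ fM t tr) _.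
- by move=> s; apply: cvgM; [exact: cvg_cst|exact: cvg_id].
- by move=> s q _ _; lra.
- by rewrite subr0 ler_wpM2l.
Qed.

Lemma compact_domain_sine :
  compact_domain_embedding D T -> forall t, compact_operator (sine em C t).
Proof.
move=> /(@precompact_totally_bounded _ _ S _ _ hE) tbD t.
apply/(@precompact_totally_bounded _ _ S _ _ hE).
apply: totally_bounded_approx => e e0.
pose r := `|t| + 1; have r0 : 0 < r by rewrite ltr_wpDl.
have [M M0 CM] := strong_family_bound r hE Cfam.
have M1 : 0 < M + 1 by rewrite ltr_wpDl.
(* On the unit ball the sine function is M-Lipschitz up to time r, so its average over [t, t + h] is
   within M h of its value at t. *)
pose h := Num.min 1 (e / (M + 1)).
have h0 : 0 < h by rewrite lt_min ltr01 divr_gt0.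
have h1 : h <= 1 by rewrite ge_min lexx.
have he : h * (M + 1) <= e by rewrite -ler_pdivlMr // ge_min lexx orbT.
have tr : `|t| <= r by rewrite /r; lra.
have thr : `|t + h| <= r.
  by apply: le_trans (ler_normD _ _) _; rewrite (gtr0_norm h0) /r; lra.
(* B bounds the primitive of the sine function up to time r. In c, the term 2 B comes from the
   quotient z, the term 2 M from its image under the generator, and 1 is added for positivity. *)
pose B := M * r * r; have B0 : 0 <= B by rewrite !mulr_ge0 // ltW.
pose c := h^-1 * (2 * B + 2 * M) + 1.
have c0 : 0 < c by rewrite ltr_wpDl // mulr_ge0 ?invr_ge0 ?addr_ge0 ?mulr_ge0 // ltW.
have scale_lin : linear (fun x : E => em c *: x).
  by move=> a x y; rewrite scalerDr !scalerA [a * _]mulrC.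
have scale_c : continuous (mk_linear scale_lin).
  by move=> x; apply: cvgZ; [exact: cvg_cst|exact: cvg_id].
exists (mk_linear scale_lin @` [set x | D x /\ `|x| + `|T x| <= 1]).
  exact: totally_bounded_image.
move=> _ [x /= x1 <-]; have {}x1 : N x <= 1.
  by rewrite -(@normE_le _ _ S) rmorph1.
have CMx s : `|s| <= r -> N (C s x) <= M.
  move=> sr; apply: le_trans (CM s sr x) _; by rewrite ler_piMr.
have sc : continuous (prim (fun s => C s x)) by exact: prim_continuous.
have [s0 sd] := primP hE (Cx (x := x)); have [z0 zd] := primP hE sc.
have sM s : `|s| <= r -> N (prim (fun s => C s x) s) <= M * r.
  by move=> sr; apply: prim_bound_sym.
have zM s : `|s| <= r -> N (sine_primitive x s) <= B.
  by move=> sr; apply: prim_bound_sym => //; rewrite mulr_ge0 // ltW.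
pose z := (em h)^-1 *: (sine_primitive x (t + h) - sine_primitive x t).
pose y := (em h)^-1 *: (C (t + h) x - C t x).
have zy : cosine_generator em C (z, y).
  have g1 := cosine_generator_linear (-1) (sine_primitive_generator x t)
    (sine_primitive_generator x (t + h)).
  have g0 := sine_primitive_generator x 0; rewrite /sine_primitive z0 C0 subrr in g0.
  have := cosine_generator_linear ((em h)^-1) g1 g0.
  rewrite !addr0 !scaleN1r; congr (cosine_generator em C (_ *: _, _ *: _)).
    by rewrite addrC.
  by zmod.
have Nz : N z <= h^-1 * (2 * B).
  rewrite /z -fmorphV rnormZe gtr0_norm ?invr_gt0 // ler_wpM2l //.
    by rewrite invr_ge0 ltW.
  by apply: le_trans (rnormB _ _) _; have := zM _ tr; have := zM _ thr; lra.
have Ny : N y <= h^-1 * (2 * M).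
  rewrite /y -fmorphV rnormZe gtr0_norm ?invr_gt0 // ler_wpM2l //.
    by rewrite invr_ge0 ltW.
  by apply: le_trans (rnormB _ _) _; have := CMx _ tr; have := CMx _ thr; lra.
exists z.
  have g0 := sine_primitive_generator x 0; rewrite /sine_primitive z0 C0 subrr in g0.
  have := cosine_generator_linear ((em c)^-1) zy g0.
  rewrite !addr0 hCT => -[/= Dz Tz].
  exists ((em c)^-1 *: z); last by rewrite /= scalerA divff ?scale1r // fmorph_eq0 gt_eqF.
  split=> //; rewrite -Tz -[1](rmorph1 em) -!(@emb_rnorm _ _ S) -rmorphD emb_le.
  rewrite -!fmorphV !rnormZe gtr0_norm ?invr_gt0 // -mulrDr ler_pdivrMl // mulr1.
  by rewrite /c mulrDr; lra.
rewrite sineE rdistC.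
rewrite quotient_dist ?gt_eqF // gtr0_norm // ler_pdivrMl //.
apply: le_trans (_ : M * h * h <= _); last first.
  by rewrite mulrC ler_wpM2l ?ltW //; lra.
have := @mean_value _ _ S _ (fun s => sine_primitive x s -
    em s *: prim (fun s => C s x) t)
  (fun s => prim (fun s => C s x) s - prim (fun s => C s x) t) (M * h) t (t + h).
rewrite [t + h - t]addrC addKr => mv.
rewrite [X in N X](_ : _ = (sine_primitive x (t + h) -
  em (t + h) *: prim (fun s => C s x) t) - (sine_primitive x t -
  em t *: prim (fun s => C s x) t)); last by rewrite rmorphD scalerDl; zmod.
apply: mv; first by lra.
- move=> s; apply: cvgB; first exact: prim_continuous.
  by apply: der_continuous; exact: der_line.
- by move=> s _; apply: rderB; apply: der_rder; [exact: zd|exact: der_line].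
move=> s /andP[ts sth].
apply: le_trans (_ : M * (s - t) <= _); last by rewrite ler_wpM2l //; lra.
apply: (@mean_value _ _ S _ (prim (fun s => C s x)) (fun s => C s x)) => //.
- by move=> q _; apply: der_rder; exact: sd.
move=> q /andP[tq qs]; apply: CMx; rewrite /r ler_norml.
by have := ler_norm t; have := ler_norm (- t); rewrite normrN; lra.
Qed.

End CosineTheory.

(** * The operator matrix *)

Section LinearOperators.
Context {K : numFieldType}.
Variables (E F : normedModType K) (D : set E) (f : E -> F).
Hypothesis hf : linear_operator D f.

Lemma linear_operator0 : f 0 = 0.
Proof.
have [D0 /(_ (-1) 0 0 D0 D0)[_]] := hf.
by rewrite scaler0 addr0 scaleN1r addNr.
Qed.

Lemma linear_operatorZ a x : D x -> D (a *: x) /\ f (a *: x) = a *: f x.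
Proof.
move=> Dx; have [D0 /(_ a x 0 Dx D0)] := hf.
by rewrite linear_operator0 !addr0.
Qed.

Lemma linear_operatorD x y : D x -> D y -> D (x + y) /\ f (x + y) = f x + f y.
Proof. by move=> Dx Dy; have := hf.2 1 x y Dx Dy; rewrite !scale1r. Qed.

Lemma linear_operatorB x y : D x -> D y -> D (x - y) /\ f (x - y) = f x - f y.
Proof.
by move=> Dx Dy; have := hf.2 (-1) y x Dy Dx; rewrite !scaleN1r ![- _ + _]addrC.
Qed.

End LinearOperators.

(** * Extension of bounded operators from dense domains *)

Section DenseExtension.
Context {R : realType} {K : numFieldType} {S : scalars R K}.
Local Notation em := (@emb R K S).
Local Notation N := (@rnorm R K S _).
Local Notation banach := (@banach R K S).
Implicit Types E F : normedModType K.

Lemma norm_bound_real E (M : K) (c : R) (x : E) :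
  0 <= c -> `|x| <= M * em c -> N x <= @rabs R K S M * c.
Proof.
move=> c0 xM; rewrite -(@emb_le _ _ S) rmorphM emb_rnorm emb_rabs.
by apply: real_bound => //; rewrite -(rmorph0 em) emb_le.
Qed.

Lemma dense_extension E F (D : set E) (f : E -> F) (M : R) : banach F ->
  linear_operator D f -> (forall x, D x -> N (f x) <= M * N x) ->
  (forall x (e : R), 0 < e -> exists2 y, D y & N (y - x) < e) ->
  exists2 g : {linear E -> F}, continuous g & forall x, D x -> g x = f x.
Proof.
move=> hF hf fM Dd.
wlog M0 : M fM / 0 <= M.
  move=> /(_ `|M|); apply=> // x Dx; apply: le_trans (fM x Dx) _.
  by rewrite ler_wpM2r ?rnorm_ge0 // ler_norm.
have M1 : 0 < M + 1 by rewrite ltr_wpDl.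
have fB x y : D x -> D y -> N (f x - f y) <= M * N (x - y).
  by move=> Dx Dy; have [Dxy <-] := linear_operatorB hf Dx Dy; exact: fM.
(* This relation characterises the value of the extension at x without choosing a sequence;
   linearity and agreement with f both follow from uniqueness of l. *)
pose ext x l := forall y, D y -> N (f y - l) <= M * N (y - x).
have extU x l m : ext x l -> ext x m -> l = m.
  move=> xl xm; apply/eqP; rewrite -subr_eq0; apply/eqP/(@rnorm_le0 _ _ S).
  apply/ler_addgt0Pr => /= e e0; rewrite add0r.
  have [|y Dy yx] := Dd x (e / (2 * (M + 1))); first by rewrite divr_gt0 ?mulr_gt0.
  rewrite ltr_pdivlMr ?mulr_gt0 // in yx.
  apply: le_trans (rdistD (f y) _ _) _; rewrite rdistC.
  have := xl y Dy; have := xm y Dy; have := @rnorm_ge0 _ _ S _ (y - x); nra.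
have ext_ex x : exists l, ext x l.
  have /choice[u uP] (n : nat) : exists y, D y /\ N (y - x) < n.+1%:R^-1.
    by have [|y Dy yx] := Dd x n.+1%:R^-1; [rewrite invr_gt0|exists y].
  have uc : u @ \oo --> x.
    apply/(@cvg_seqP _ _ S) => e e0; have [n ne] := small_inverse e0.
    by exists n => p np; apply: lt_trans (uP p).2 (ne p np).
  have [e e0|l fl] := hF (f \o u).
    have [|n nP] := (@cvg_seqP _ _ S _ _ _).1 uc (e / (2 * (M + 1))).
      by rewrite divr_gt0 ?mulr_gt0.
    exists n => p q np nq; have := nP p np; have := nP q nq.
    rewrite !ltr_pdivlMr ?mulr_gt0 // => uq up.
    apply: le_lt_trans (fB _ _ (uP p).1 (uP q).1) _.
    have := @rdistD _ _ S _ x (u p) (u q); rewrite (rdistC x).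
    have := @rnorm_ge0 _ _ S _ (u q - x); have := @rnorm_ge0 _ _ S _ (u p - x); nra.
  exists l => y Dy; apply/ler_addgt0Pr => /= e e0.
  have [|n nP] := (@cvg_seqP _ _ S _ _ _).1 uc (e / (2 * (M + 1))).
    by rewrite divr_gt0 ?mulr_gt0.
  have [|m mP] := (@cvg_seqP _ _ S _ _ _).1 fl (e / 2); first by rewrite divr_gt0.
  have := nP _ (leq_maxl n m); have := mP _ (leq_maxr n m) => /=.
  move: (maxn n m) => k; rewrite !ltr_pdivlMr ?mulr_gt0 // => fk uk.
  apply: le_trans (rdistD (f (u k)) _ _) _.
  have := fB y (u k) Dy (uP k).1; have := @rdistD _ _ S _ x y (u k).
  rewrite (rdistC x) => /(ler_wpM2l M0) h1 h2.
  by have := @rnorm_ge0 _ _ S _ (u k - x); lra.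
have /choice[g gP] := ext_ex.
have gf x : D x -> g x = f x.
  by move=> Dx; apply: extU (gP x) _ => y Dy; exact: fB.
have glin : linear g.
  move=> a x y; apply: extU (gP _) _ => z Dz; apply/ler_addgt0Pr => /= e e0.
  pose d := e / (2 * (M + 1) * (@rabs R K S a + 1)).
  have a0 := @rabs_ge0 _ _ S a.
  have c0 : 0 < 2 * (M + 1) * (@rabs R K S a + 1).
    by rewrite !mulr_gt0 // ltr_wpDl.
  have d0 : 0 < d by rewrite divr_gt0.
  have dE : 2 * (M + 1) * (@rabs R K S a + 1) * d = e.
    by rewrite mulrC divfK ?gt_eqF.
  have [x' Dx' xx'] := Dd x d d0; have [y' Dy' yy'] := Dd y d d0.
  have [Dxy fxy] := hf.2 a x' y' Dx' Dy'.
  have := fB _ _ Dz Dxy; rewrite fxy => hz.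
  have hx := gP x x' Dx'; have hy := gP y y' Dy'.
  apply: le_trans (rdistD (a *: f x' + f y') _ _) _.
  have hzxy : N (z - (a *: x' + y')) <= N (z - (a *: x + y)) + (@rabs R K S a * N (x' - x) + N (y' - y)).
    apply: le_trans (rdistD (a *: x + y) _ _) _; rewrite lerD2l.
    rewrite [_ - _](_ : _ = a *: (x - x') + (y - y')); last by rewrite scalerBr; zmod.
    apply: le_trans (rnormD _ _) _.
    by rewrite rnormZ (rdistC x) (rdistC y).
  have hgxy : N (a *: f x' + f y' - (a *: g x + g y)) <=
      @rabs R K S a * (M * N (x' - x)) + M * N (y' - y).
    rewrite [X in N X](_ : _ = a *: (f x' - g x) + (f y' - g y)); last first.
      by rewrite scalerBr; zmod.
    apply: le_trans (rnormD _ _) _; rewrite rnormZ.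
    by apply: lerD => //; exact: ler_wpM2l.
  move: xx' yy' hz hzxy hgxy; have := @rnorm_ge0 _ _ S _ (x' - x).
  have := @rnorm_ge0 _ _ S _ (y' - y).
  move: (N (x' - x)) (N (y' - y)) (N (z - (a *: x' + y'))) (N (z - (a *: x + y)))
    (N (f z - _)) (N (_ - (a *: g x + g y))) (@rabs R K S a) a0 dE => r1 r2 q1 q2 q3 q4 al.
  move=> a0 dE r20 r10 r1d r2d h1 h2 h3.
  have h4 : al * r1 + r2 <= (al + 1) * d.
    by rewrite mulrDl mul1r lerD // ?ler_wpM2l // ltW.
  have h5 : M * q1 <= M * (q2 + (al * r1 + r2)) by rewrite ler_wpM2l.
  have h6 : M * (al * r1 + r2) <= (M + 1) * ((al + 1) * d).
    by apply: ler_pM => //; [rewrite addr_ge0 // mulr_ge0|rewrite lerDl].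
  rewrite mulrDr in h5; move: h5 h6 dE h3; rewrite mulrCA -[X in _ <= X -> _]mulrDr; lra.
exists (mk_linear glin); last exact: gf.
apply: (@bounded_continuous _ _ S _ _ _ M) => x.
have [D0 _] := hf; have := gP x 0 D0.
by rewrite (linear_operator0 hf) !sub0r !rnormN.
Qed.

End DenseExtension.

(** * The change of variables on the phase space and the resulting coupling *)

Section Decoupling.
Context {R : realType} {K : numFieldType} {S : scalars R K}.
Variables X Y dX dY : normedModType K.
Variables (i : {linear dY -> dX}) (D : {linear dX -> Y}) (e : {linear dX -> X}).
Variables (k : {linear X -> dY}) (b : {linear Y -> dX}) (d : {linear dX -> dX}).
Hypotheses (ic : continuous i) (Dc : continuous D) (ec : continuous e).
Hypotheses (kc : continuous k) (bc : continuous b) (dc : continuous d).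
Local Notation state := ((Y * dY) * (X * dX))%type.
Local Notation split_state := ((Y * X) * (dY * dX))%type.

Let pairZD (V W : lmodType K) (a : K) (x x' : V) (y y' : W) :
  a *: (x, y) + (x', y') = (a *: x + x', a *: y + y').
Proof. by []. Qed.

(** Besides the substitution, the components are regrouped: both positions and then both velocities
    become one phase space for each operator. *)
Lemma decouple_linear : linear (fun p : state =>
  ((p.1.1 - D (i p.1.2), p.2.1), (p.1.2, p.2.2 - i (k p.2.1))) : split_state).
Proof.
move=> a [[y1 w1] [v1 z1]] [[y2 w2] [v2 z2]]; rewrite /= !(linearP k, linearP i, linearP D) !pairZD.
by congr ((_, _), (_, _)); rewrite scalerBr; zmod.
Qed.

Lemma recouple_linear : linear (fun q : split_state =>
  ((q.1.1 + D (i q.2.1), q.2.1), (q.1.2, q.2.2 + i (k q.1.2))) : state).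
Proof.
move=> a [[y1 v1] [w1 z1]] [[y2 v2] [w2 z2]]; rewrite /= !(linearP k, linearP i, linearP D) !pairZD.
by congr ((_, _), (_, _)); rewrite scalerDr; zmod.
Qed.

(** With e = lam D and d = B D, the entries are: the term compensating D in the velocity of u - D w;
    the k v removed from z; A D w = lam D w; and what remains of B u + B D w once k has absorbed its
    unbounded part. *)
Lemma coupling_linear : linear (fun p : state =>
  ((D (i (k p.2.1) - p.2.2), k p.2.1),
   (e (i p.1.2), b (p.1.1 - D (i p.1.2)) + d (i p.1.2))) : state).
Proof.
move=> a [[y1 w1] [v1 z1]] [[y2 w2] [v2 z2]].
rewrite /= !(linearB D, linearB b).
rewrite !(linearP k, linearP i, linearP D, linearP e, linearP d, linearP b) !pairZD.
congr ((_, _), (_, _)); first by rewrite scalerBr; zmod.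
by rewrite scalerDr scalerBr; zmod.
Qed.

Definition decouple := mk_linear decouple_linear.
Definition recouple := mk_linear recouple_linear.
Definition coupling := mk_linear coupling_linear.

Lemma decoupleK : cancel decouple recouple.
Proof. by move=> [[y w] [v z]]; rewrite /= !subrK. Qed.

Lemma recoupleK : cancel recouple decouple.
Proof. by move=> [[y v] [w z]]; rewrite /= !addrK. Qed.

Let proj11 (E F G : normedModType K) (p : (E * F) * G) : q.1.1 @[q --> p] --> p.1.1.
Proof. exact (fst_cvg _ (fst_cvg _ (@cvg_id _ _))). Qed.
Let proj12 (E F G : normedModType K) (p : (E * F) * G) : q.1.2 @[q --> p] --> p.1.2.
Proof. exact (snd_cvg _ (fst_cvg _ (@cvg_id _ _))). Qed.
Let proj21 (E F G : normedModType K) (p : E * (F * G)) : q.2.1 @[q --> p] --> p.2.1.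
Proof. exact (fst_cvg _ (snd_cvg _ (@cvg_id _ _))). Qed.
Let proj22 (E F G : normedModType K) (p : E * (F * G)) : q.2.2 @[q --> p] --> p.2.2.
Proof. exact (snd_cvg _ (snd_cvg _ (@cvg_id _ _))). Qed.

Lemma decouple_continuous : continuous decouple.
Proof.
move=> p; apply: pair_cvg; apply: pair_cvg => /=.
- by apply: cvgB; [exact: proj11|do 2! apply: linear_cvg => //; exact: proj12].
- exact: proj21.
- exact: proj12.
- by apply: cvgB; [exact: proj22|do 2! apply: linear_cvg => //; exact: proj21].
Qed.

Lemma recouple_continuous : continuous recouple.
Proof.
move=> p; apply: pair_cvg; apply: pair_cvg => /=.
- by apply: cvgD; [exact: proj11|do 2! apply: linear_cvg => //; exact: proj21].
- exact: proj21.
- exact: proj12.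
- by apply: cvgD; [exact: proj22|do 2! apply: linear_cvg => //; exact: proj12].
Qed.

Lemma coupling_continuous : continuous coupling.
Proof.
move=> p; apply: pair_cvg; apply: pair_cvg => /=.
- apply: linear_cvg => //; apply: cvgB; last exact: proj22.
  by do 2! apply: linear_cvg => //; exact: proj21.
- by apply: linear_cvg => //; exact: proj21.
- by do 2! apply: linear_cvg => //; exact: proj12.
- apply: cvgD; last by do 2! apply: linear_cvg => //; exact: proj12.
  apply: linear_cvg => //; apply: cvgB; first exact: proj11.
  by do 2! apply: linear_cvg => //; exact: proj12.
Qed.

End Decoupling.

(** * Graph norms and compact domain embeddings *)

Section DomainEmbeddings.
Context {R : realType} {K : numFieldType} {S : scalars R K}.
Local Notation em := (@emb R K S).
Local Notation N := (@rnorm R K S _).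
Local Notation banach := (@banach R K S).
Implicit Types E F : normedModType K.

Lemma domain_embedding_real E F (j : F -> E) (D : set E) (T : E -> E) :
  domain_embedding j D T <-> D `<=` range j /\
  exists2 M : R, 0 <= M & forall f, D (j f) -> N f <= M * (N (j f) + N (T (j f))).
Proof.
split=> -[Dj [M]].
  move=> hM; split=> //; exists (@rabs R K S M); first exact: rabs_ge0.
  move=> f Df; apply: norm_bound_real; first by rewrite addr_ge0 ?rnorm_ge0.
  by rewrite rmorphD !emb_rnorm; exact: hM.
move=> _ hM; split=> //; exists (em M) => f /hM.
by rewrite -(@emb_le _ _ S) rmorphM rmorphD !emb_rnorm.
Qed.

(** The unit ball of the graph norm of T lies in the image under d f of that of T', where d = |c| +
    1 is a positive scaling factor. *)
Lemma compact_domain_image E F (D : set E) (T : E -> E) (D' : set F) (T' : F -> F)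
    (f : {linear F -> E}) (c : R) : banach E -> banach F ->
  linear_operator D' T' -> continuous f ->
  (forall x, D x -> exists2 y, f y = x &
     D' y /\ N y + N (T' y) <= c * (N x + N (T x))) ->
  compact_domain_embedding D' T' -> compact_domain_embedding D T.
Proof.
move=> hE hF hT' fc DD' /(@precompact_totally_bounded _ _ S _ _ hF) tb.
apply/(@precompact_totally_bounded _ _ S _ _ hE).
pose d := `|c| + 1; have d0 : 0 < d by rewrite ltr_wpDl.
have g_lin : linear (fun y => em d *: f y).
  by move=> a x y; rewrite linearP scalerDr !scalerA mulrC.
have gc : continuous (mk_linear g_lin).
  by move=> y; apply: cvgZ; [exact: cvg_cst|exact: fc].
apply: totally_boundedS (totally_bounded_image gc tb) => x [Dx xT].
have [y fy [Dy yT]] := DD' x Dx.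
have [Dy' Ty'] := linear_operatorZ hT' (em d)^-1 Dy.
exists ((em d)^-1 *: y).
  split=> //; rewrite Ty' -!(@emb_rnorm _ _ S) -rmorphD -(rmorph1 em) emb_le.
  rewrite -fmorphV !rnormZe gtr0_norm ?invr_gt0 // -mulrDr ler_pdivrMl // mulr1.
  have {}xT : N x + N (T x) <= 1.
    by rewrite -(@emb_le _ _ S) rmorphD !emb_rnorm rmorph1.
  apply: le_trans yT _; apply: le_trans (ler_norm _) _; rewrite normrM.
  rewrite [X in _ * X]ger0_norm ?addr_ge0 ?rnorm_ge0 //.
  by apply: le_trans (ler_wpM2l (normr_ge0 c) xT) _; rewrite mulr1 lerDl.
by rewrite /= linearZ fy scalerA divff ?scale1r // fmorph_eq0 gt_eqF.
Qed.

Lemma linear_operator_prod E F (D : set E) (T : E -> E) (D' : set F) (T' : F -> F) :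
  linear_operator D T -> linear_operator D' T' ->
  linear_operator (D `*` D') (prod_map T T').
Proof.
move=> hT hT'; split=> [|a [x x'] [y y'] [/= Dx Dx'] [/= Dy Dy']].
  by split; [exact: hT.1|exact: hT'.1].
have [Dxy Txy] := hT.2 a x y Dx Dy; have [Dxy' Txy'] := hT'.2 a x' y' Dx' Dy'.
by split=> //; rewrite /prod_map /= Txy Txy'.
Qed.

Lemma compact_domain_prod E F (D : set E) (T : E -> E) (D' : set F) (T' : F -> F) :
  banach E -> banach F ->
  compact_domain_embedding D T -> compact_domain_embedding D' T' ->
  compact_domain_embedding (D `*` D') (prod_map T T').
Proof.
move=> hE hF /(@precompact_totally_bounded _ _ S _ _ hE) tb.
move=> /(@precompact_totally_bounded _ _ S _ _ hF) tb'.
apply/(@precompact_totally_bounded _ _ S _ _ (banach_prod hE hF)).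
apply: totally_boundedS (totally_bounded_prod tb tb') => -[x y] [[/= Dx Dy]].
rewrite -!(@emb_rnorm _ _ S) -rmorphD -(rmorph1 em) emb_le => xy.
have := @rnorm_fst _ _ S _ _ (x, y); have := @rnorm_snd _ _ S _ _ (x, y).
have := @rnorm_fst _ _ S _ _ (prod_map T T' (x, y)).
have := @rnorm_snd _ _ S _ _ (prod_map T T' (x, y)).
rewrite /= => h1 h2 h3 h4.
by split; split=> //; rewrite -rmorphD emb_le; lra.
Qed.

End DomainEmbeddings.

(** * Dirichlet map, correction of B, and transfer between the matrix and the pair of operators *)

Section OperatorMatrixGeneration.
Context {R : realType} {K : numFieldType} {S : scalars R K}.
Local Notation N := (@rnorm R K S _).
Local Notation banach := (@banach R K S).
Local Notation generates_group := (@generates_group R K S _).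
Variables (X Y dX dY : normedModType K).
Hypotheses (hX : banach X) (hY : banach Y) (hdX : banach dX) (hdY : banach dY).
Variables (jY : Y -> X) (hjY : continuous_embedding jY).
Variables (jdY : dY -> dX) (hjdY : continuous_embedding jdY).
Variables (DA : set X) (A : X -> X) (L : X -> dX).
Hypotheses (hA : linear_operator DA A) (hDAY : DA `<=` range jY).
Hypotheses (hL : linear_operator DA L) (hLsurj : set_surj DA [set: dX] L).
Let DA0 := DA `&` [set u | L u = 0].
Variables (lam : K) (Q : {linear X -> X}).
Hypotheses (Qc : continuous Q)
  (QA : forall y, DA0 (Q y) /\ lam *: Q y - A (Q y) = y)
  (QK : forall x, DA0 x -> Q (lam *: x - A x) = x).
Hypothesis hALclosed : closed_operator DA (fun u => (A u, L u)).
Variables (B : X -> dX) (hB : linear_operator DA B).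
Hypothesis hBbd : exists M : K, forall u, DA u ->
  `|B u| <= M * (`|u| + `|A u| + `|L u|).

Let jYl : {linear Y -> X} := mk_linear (let: And3 l _ _ := hjY in l).
Let jdYl : {linear dY -> dX} := mk_linear (let: And3 l _ _ := hjdY in l).
Let jYc : continuous jYl. Proof. by case: hjY. Qed.
Let jdYc : continuous jdYl. Proof. by case: hjdY. Qed.
Let jYI : injective jYl. Proof. by case: hjY. Qed.
Let jdYI : injective jdYl. Proof. by case: hjdY. Qed.

Lemma domain0_linear_operator : linear_operator DA0 A.
Proof.
split=> [|a x y [Dx Lx] [Dy Ly]].
  by split; [exact: hA.1|exact: linear_operator0 hL].
have [Dxy ->] := hA.2 a x y Dx Dy; split=> //; split=> //=.
by have [_ ->] := hL.2 a x y Dx Dy; rewrite Lx Ly scaler0 addr0.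
Qed.

Lemma operator_bound : exists2 M : R, 0 <= M & forall u, DA u ->
  N (B u) <= M * (N u + N (A u) + N (L u)).
Proof.
have [M hM] := hBbd; exists (@rabs R K S M); first exact: rabs_ge0.
move=> u Du; apply: norm_bound_real; first by rewrite !addr_ge0 ?rnorm_ge0.
by rewrite !rmorphD !emb_rnorm; exact: hM.
Qed.

Lemma dirichlet_unique y y' : DA (jY y) -> DA (jY y') ->
  A (jY y) = lam *: jY y -> A (jY y') = lam *: jY y' -> L (jY y) = L (jY y') ->
  y = y'.
Proof.
move=> Dy Dy' Ay Ay' LL; apply/eqP; rewrite -subr_eq0; apply/eqP/jYI.
rewrite linear0 -(linear0 Q) -[LHS]QK; last first.
  rewrite linearB; split; first exact: (linear_operatorB hA Dy Dy').1.
  by rewrite /= (linear_operatorB hL Dy Dy').2 LL subrr.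
by rewrite [jYl (_ - _)]linearB (linear_operatorB hA Dy Dy').2 Ay Ay' -scalerBr subrr.
Qed.

Lemma dirichlet_exists : exists2 D : {linear dX -> Y}, continuous D & forall z,
  [/\ DA (jY (D z)), A (jY (D z)) = lam *: jY (D z) & L (jY (D z)) = z].
Proof.
have /choice[D DP] z : exists y, [/\ DA (jY y), A (jY y) = lam *: jY y & L (jY y) = z].
  have [v Dv Lv] := hLsurj (I : [set: dX] z).
  (* Subtracting the resolvent of the defect lam v - A v from a preimage v makes the defect vanish
     and leaves L v unchanged. *)
  have [[Dq Lq] Aq] := QA (lam *: v - A v); set q := Q _ in Dq Lq Aq.
  have [Du Au] := linear_operatorB hA Dv Dq.
  have [_ Lu] := linear_operatorB hL Dv Dq.
  have [y _ yE] := hDAY Du; exists y; rewrite yE; split=> //.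
    have -> : A (v - q) = A v - (lam *: q - (lam *: q - A q)) by rewrite Au; zmod.
    by rewrite Aq scalerBr; zmod.
  by rewrite Lu Lv Lq subr0.
have Dlin : linear D.
  move=> a x y; have [Dx Ax Lx] := DP x; have [Dy Ay Ly] := DP y.
  have [Dxy Axy Lxy] := DP (a *: x + y).
  apply: dirichlet_unique => //; rewrite -![jY (_ + _)]/(jYl _) linearP.
  - exact: (hA.2 a _ _ Dx Dy).1.
  - by rewrite (hA.2 a _ _ Dx Dy).2 Ax Ay scalerDr !scalerA mulrC.
  - by rewrite (hL.2 a _ _ Dx Dy).2 Lx Ly.
exists (mk_linear Dlin) => //.
have [M _ DM] : exists2 M : R, 0 <= M & forall x, N (mk_linear Dlin x) <= M * N x.
  apply: closed_graph => // u x y ux uy.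
  have jy : jYl (D (u n)) @[n --> \oo] --> jYl y by exact: linear_cvg.
  have : graph DA (fun u => (A u, L u)) (jY y, (lam *: jY y, x)).
    apply: (closed_cvg _ hALclosed) (_ : (fun n => (jY (D (u n)), (A (jY (D (u n))), L (jY (D (u n)))))) @ \oo --> _).
      by near=> n; split=> //; have [] := DP (u n).
    apply: pair_cvg => //=; apply: pair_cvg => /=.
      under eq_fun do rewrite (let: And3 _ e _ := DP _ in e).
      by apply: cvgZ; [exact: cvg_cst|].
    by under eq_fun do rewrite (let: And3 _ _ e := DP _ in e).
  move=> [/= Dy [Ay Ly]]; have [Dx Ax Lx] := DP x.
  by apply: dirichlet_unique; rewrite ?Lx.
exact: bounded_continuous DM.
Unshelve. all: by end_near.
Qed.

(** In the first case B u = B Q (lam u - A u), which also gives b = lam B Q; linearity of B Q as a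
    map into dY follows from injectivity of the embedding. In the second case b is the extension of
    B from D(A_0), and this is where density in the norm of Y enters. *)
Lemma correction_exists :
  (exists M : K, forall u, DA0 u ->
     exists2 v : dY, jdY v = B u & `|v| <= M * (`|u| + `|A u|))
  \/ (exists M : K, forall y : Y, DA (jY y) -> `|B (jY y)| <= M * `|y|) ->
  (forall y (e : R), 0 < e -> exists2 y', DA0 (jY y') & N (y' - y) < e) ->
  exists (k : {linear X -> dY}) (b : {linear Y -> dX}),
    [/\ continuous k, continuous b &
     forall y, DA0 (jY y) -> B (jY y) = jdY (k (A (jY y))) + b y].
Proof.
move=> + dense; case=> [[M hM]|[M hM]].
  have /choice[k kP] v : exists w, jdY w = B (Q v) /\
      `|w| <= M * (`|Q v| + `|A (Q v)|).
    by have [w wB wM] := hM _ (QA v).1; exists w.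
  have BQ a v w : B (Q (a *: v + w)) = a *: B (Q v) + B (Q w).
    by rewrite linearP (hB.2 a _ _ (QA v).1.1 (QA w).1.1).2.
  have klin : linear k.
    move=> a v w; apply: jdYI; rewrite linearP /=.
    by rewrite !(kP _).1 BQ.
  have kc : continuous (mk_linear klin).
    have [q q0 Qq] := @continuous_bounded _ _ S _ _ _ Qc.
    pose l := @rabs R K S lam; pose m := @rabs R K S M.
    have m0 : 0 <= m by exact: rabs_ge0.
    apply: (@bounded_continuous _ _ S _ _ _ (m * (q + (l * q + 1)))) => v /=.
    have : N (k v) <= m * (N (Q v) + N (A (Q v))).
      apply: norm_bound_real; first by rewrite addr_ge0 ?rnorm_ge0.
      by rewrite rmorphD !emb_rnorm (kP v).2.
    move=> /le_trans; apply; rewrite -mulrA ler_wpM2l //.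
    have -> : A (Q v) = lam *: Q v - v by rewrite -[X in _ - X](QA v).2; zmod.
    have := @rnormB _ _ S _ (lam *: Q v) v; rewrite rnormZ -/l.
    have := Qq v; have := ler_wpM2l (@rabs_ge0 _ _ S lam) (Qq v); rewrite -/l.
    by rewrite !mulrDl mul1r mulrA; lra.
  pose k' : {linear X -> dY} := \- mk_linear klin.
  have b_lin : linear (fun y => lam *: jdYl (k (jYl y))).
    by move=> a y z; rewrite linearP klin linearP scalerDr !scalerA mulrC.
  exists k', (mk_linear b_lin); split.
  - by move=> v; apply: cvgN; exact: kc.
  - move=> y /=; apply: cvgZ; first exact: cvg_cst.
    apply: (linear_cvg (A := jdYl)) => //.
    by apply: (linear_cvg (A := mk_linear klin)) => //; exact: jYc.
  move=> y Dy /=; rewrite -[jdY (- _)]/(jdYl _) linearN /= !(kP _).1.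
  rewrite -[in LHS](QK Dy).
  have [[Dq1 _] _] := QA (lam *: jY y); have [[Dq2 _] _] := QA (A (jY y)).
  rewrite linearB (linear_operatorB hB Dq1 Dq2).2 linearZ.
  by rewrite (linear_operatorZ hB _ (QA _).1.1).2 addrC.
exists (\0 : {linear X -> dY}); have D0lin : linear_operator [set y | DA0 (jY y)] (B \o jY).
  split=> [|a y z Dy Dz] /=.
    by rewrite -[jY 0]/(jYl 0) linear0; exact: domain0_linear_operator.1.
  rewrite -[jY (_ + _)]/(jYl _) linearP /=; split.
    exact: (domain0_linear_operator.2 a _ _ Dy Dz).1.
  by rewrite (hB.2 a _ _ Dy.1 Dz.1).2.
have [||b bc bP] := @dense_extension _ _ S _ _ _ _ (@rabs R K S M) hdX D0lin.
- move=> y [Dy _]; apply: norm_bound_real; first exact: rnorm_ge0.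
  by rewrite emb_rnorm; exact: hM.
- exact: dense.
exists b; split=> // [v|y /bP ->]; first exact: cvg_cst.
by rewrite -[jdY _]/(jdYl _) linear0 add0r.
Qed.

Variables (D : {linear dX -> Y}) (Dc : continuous D).
Hypothesis DP : forall z,
  [/\ DA (jY (D z)), A (jY (D z)) = lam *: jY (D z) & L (jY (D z)) = z].
Variables (DBt : set dX) (Bt : dX -> dX).
Hypotheses (hBt : linear_operator DBt Bt) (hDBtY : DBt `<=` range jdY).

Lemma dirichlet_shift u w : DA u /\ L u = w <-> DA0 (u - jY (D w)).
Proof.
have [Dw Aw Lw] := DP w; split=> [[Du Lu]|[Du /= Lu]].
  split; first exact: (linear_operatorB hA Du Dw).1.
  by rewrite /= (linear_operatorB hL Du Dw).2 Lu Lw subrr.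
have [] := linear_operatorD hA Du Dw; have [_] := linear_operatorD hL Du Dw.
by rewrite !subrK Lw Lu add0r.
Qed.

Lemma dirichlet_shiftA u w : DA u ->
  A (u - jY (D w)) = A u - lam *: jY (D w).
Proof.
by have [Dw <- _] := DP w; move=> Du; exact: (linear_operatorB hA Du Dw).2.
Qed.

Lemma dirichlet_shiftB u w : DA u -> B (u - jY (D w)) = B u - B (jY (D w)).
Proof.
by have [Dw _ _] := DP w; move=> Du; exact: (linear_operatorB hB Du Dw).2.
Qed.

Lemma BD_linear : linear (fun z => B (jY (D z))).
Proof.
move=> a z w; have [Dz _ _] := DP z; have [Dw _ _] := DP w.
by rewrite linearP -(hB.2 a _ _ Dz Dw).2 -[jY (_ + _)]/(jYl _) linearP.
Qed.

Let BD := mk_linear BD_linear.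

Lemma dirichlet_bound : exists2 c : R, 0 <= c & forall z, N (jY (D z)) <= c * N z.
Proof.
have jDc : continuous (jYl \o D).
  by move=> z; apply: (linear_cvg (A := jYl)) => //; exact: Dc.
exact: (@continuous_bounded _ _ S _ _ (jYl \o D)).
Qed.

Lemma BD_continuous : continuous BD.
Proof.
have [M M0 hM] := operator_bound; have [c c0 hc] := dirichlet_bound.
pose l := @rabs R K S lam; have l0 : 0 <= l := rabs_ge0 _.
apply: (@bounded_continuous _ _ S _ _ _ (M * (c + l * c + 1))) => z.
have [Dz Az Lz] := DP z; apply: le_trans (hM _ Dz) _.
rewrite -mulrA ler_wpM2l // Az Lz rnormZ -/l !mulrDl mul1r lerD2r.
by rewrite lerD // -mulrA ler_wpM2l.
Qed.

Variables (k : {linear X -> dY}) (b : {linear Y -> dX}).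
Hypotheses (kc : continuous k) (bc : continuous b).
Hypothesis kb : forall y, DA0 (jY y) -> B (jY y) = jdY (k (A (jY y))) + b y.

Let eD_linear : linear (fun z => lam *: jYl (D z)).
Proof. by move=> a z w; rewrite (linearP D) (linearP jYl) scalerDr !scalerA mulrC. Qed.

Let eD := mk_linear eD_linear.

Let eDc : continuous eD.
Proof.
move=> z /=; apply: cvgZ; first exact: cvg_cst.
by apply: (linear_cvg (A := jYl)) => //; exact: Dc.
Qed.

Local Notation matrix_graph := (reduction_graph (prod_map jY jdY)
  (opmx_domain DA L DBt) (opmx A B Bt)).
Local Notation split_graph :=
  (sum_graph (reduction_graph jY DA0 A) (reduction_graph jdY DBt Bt)).
Local Notation decouple := (decouple jdYl D k).
Local Notation recouple := (recouple jdYl D k).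
Local Notation coupling := (coupling jdYl D eD k b BD).

(** The coupling is subtracted in the original coordinates, before [decouple], which is the form
    that [group_perturbation] produces. *)
Lemma matrix_graph_decouple : matrix_graph =
  [set p | [set q | split_graph (decouple q.1, decouple q.2)] (p.1, p.2 - coupling p.1)].
Proof.
apply/funext => -[[[y w] [v z]] [[y' w'] [v' z']]].
rewrite /reduction_graph /sum_graph /opmx_domain /prod_map /opmx /=; apply/propext.
set u := y - D (jdY w).
have uE : jY u = jY y - jY (D (jdY w)) by rewrite -[LHS]/(jYl _) linearB.
have zE : z - jdY (k v) = jdY (w' - k v) <-> z = jdY w'.
  by rewrite -[jdY (_ - _)]/(jdYl _) linearB; split=> [/addIr|->].
(* Once z is the velocity w', the Dirichlet terms of the coupling and of [decouple] cancel. *)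
have vE : z = jdY w' ->
    y' - D (jdY (k v) - z) - D (jdY (w' - k v)) = y'.
  by move=> ->; rewrite -[jdY (_ - _)]/(jdYl _) !linearB /=; zmod.
have BE : DA (jY y) -> DA0 (jY u) ->
    B (jY y) = jdY (k (A (jY y) - lam *: jY (D (jdY w)))) + (b u + B (jY (D (jdY w)))).
  move=> Dy Du; have := kb Du; rewrite {1 2}uE dirichlet_shiftA // dirichlet_shiftB //.
  by move=> /eqP; rewrite subr_eq -addrA => /eqP.
split=> [[[Dy Dw Lw] [= vy zw] [= -> ->]]|[[Du vy v'E] [Dw /zE zw z'E]]].
  have Du : DA0 (jY u) by rewrite uE; exact: (dirichlet_shift _ _).1 (conj Dy Lw).
  rewrite vE //; split; split=> //; [by rewrite uE dirichlet_shiftA|exact: zE.2|].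
  by rewrite (BE Dy Du); zmod.
have [Dy Lw] : DA (jY y) /\ L (jY y) = jdY w.
  by apply: (dirichlet_shift _ _).2; rewrite -uE.
rewrite vE // in vy; rewrite uE dirichlet_shiftA // in v'E.
split=> //; first by rewrite vy zw.
move: v'E z'E => /= /addIr ->; rewrite (BE Dy Du) => <-.
by congr (_, _); zmod.
Qed.

(** Forwards, the coupling is removed by the perturbation of opposite sign and then the variables
    are changed; backwards, the two operations are undone in the reverse order. [group_retract]
    serves as similarity, its two maps being mutually inverse. *)
Lemma matrix_group : generates_group matrix_graph <->
  generates_group (reduction_graph jY DA0 A) /\
  generates_group (reduction_graph jdY DBt Bt).
Proof.
have hS := banach_prod (banach_prod hY hdY) (banach_prod hX hdX).
have hS' := banach_prod (banach_prod hY hX) (banach_prod hdY hdX).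
have dc := decouple_continuous jdYc Dc kc.
have rc := recouple_continuous jdYc Dc kc.
have cc := coupling_continuous jdYc Dc eDc kc bc BD_continuous.
apply: iff_trans (group_sum _ _ (banach_prod hY hX) (banach_prod hdY hdX)).
split=> [matrixG|splitG].
  pose coupling' : {linear ((Y * dY) * (X * dX))%type -> _} := \- coupling.
  have c'c : continuous coupling' by move=> p; apply: cvgN; exact: cc.
  pose G := [set p | matrix_graph (p.1, p.2 - coupling' p.1)].
  rewrite (_ : split_graph = [set p | G (recouple p.1, recouple p.2)]); last first.
    apply/funext => -[p q]; rewrite /G matrix_graph_decouple /mkset.
    by rewrite [coupling' _]/(- coupling _) opprK addrK !recoupleK.
  apply: (group_retract hS dc rc (@recoupleK _ _ _ _ _ _ _ _)).
    by move=> p q; rewrite !decoupleK.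
  exact: group_perturbation.
have := group_retract (Phi := recouple) (Psi := decouple) hS' rc dc
  (@decoupleK _ _ _ _ _ _ _ _) _ splitG.
rewrite matrix_graph_decouple => h; apply: group_perturbation => //.
by apply: h => p q; rewrite !recoupleK.
Qed.

(** Supplies the density that [correction_exists] asks for, as the first component of the density of
    the generator domain in Y * X. *)
Lemma split_graph_dense : generates_group (reduction_graph jY DA0 A) ->
  forall y (e : R), 0 < e -> exists2 y', DA0 (jY y') & N (y' - y) < e.
Proof.
move=> [U hU UG] y e e0.
have [p] := generator_dense (banach_prod hY hX) (group_semigroup hU) (y, 0) e0.
rewrite UG => -[Dp _ _] pe; exists p.1.1 => //.
by apply: le_lt_trans pe; exact: (rnorm_fst (p.1 - (y, 0))).
Qed.

(** Approximate (y, 0) by (y', w') from the domain of the matrix. Since w' is close to 0, so is D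
    w', and y' - D w' lies in D(A_0). *)
Lemma matrix_graph_dense : generates_group matrix_graph ->
  forall y (e : R), 0 < e -> exists2 y', DA0 (jY y') & N (y' - y) < e.
Proof.
have hS := banach_prod (banach_prod hY hdY) (banach_prod hX hdX).
move=> [U hU UG] y e e0.
have [M M0 DM] : exists2 M : R, 0 <= M & forall w, N (D (jdYl w)) <= M * N w.
  have c : continuous (D \o jdYl).
    by move=> w; apply: (linear_cvg (A := D)) => //; exact: jdYc.
  exact: (@continuous_bounded _ _ S _ _ (D \o jdYl)).
have M1 : 0 < M + 1 by rewrite ltr_wpDl.
have [[[[y' w'] v'] q]] := generator_dense hS (group_semigroup hU) ((y, 0), 0) (divr_gt0 e0 M1).
rewrite UG => -[/= [Dp _ Lp] _ _]; rewrite ltr_pdivlMr // => pe.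
exists (y' - D (jdY w')).
  rewrite -[jY _]/(jYl _) linearB; exact: (dirichlet_shift _ _).1 (conj Dp Lp).
have := @rnorm_fst _ _ S _ _ (((y', w'), v') - ((y, 0), 0)); rewrite /=.
have := @rnorm_fst _ _ S _ _ ((y', w') - (y, 0)).
have := @rnorm_snd _ _ S _ _ ((y', w') - (y, 0)); rewrite /= subr0.
have := DM w'; have := @rnormB _ _ S _ (y' - y) (D (jdY w')).
rewrite addrAC => h1 h2 h3 h4 h5; apply: le_lt_trans h1 _; rewrite /= in h2.
have := ler_wpM2l M0 (le_trans h3 h5); lra.
Qed.

(** With [matrix_domain_bound] this compares graph norms across the shift u - D w, which transfers
    both the embeddings of the domains and their compactness. *)
Lemma split_domain_bound : exists2 c : R, 0 <= c & forall u w,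
  opmx_domain DA L DBt (u, w) ->
  let n := N (u, w) + N (opmx A B Bt (u, w)) in
  N (u - jY (D w)) + N (A (u - jY (D w))) <= c * n /\ N w + N (Bt w) <= c * n.
Proof.
have [M M0 hM] := operator_bound; have [c c0 hc] := dirichlet_bound.
pose l := @rabs R K S lam; have l0 : 0 <= l := rabs_ge0 _.
exists (2 + c + l * c + 3 * M); first by rewrite !addr_ge0 // mulr_ge0.
move=> u w [Du Dw Lu] n; rewrite /= in Du Dw Lu.
have n1 : N u <= N (u, w) by exact: (@rnorm_fst _ _ S _ _ (u, w)).
have n2 : N w <= N (u, w) by exact: (@rnorm_snd _ _ S _ _ (u, w)).
have n3 : N (A u) <= N (opmx A B Bt (u, w)).
  exact: (@rnorm_fst _ _ S _ _ (opmx A B Bt (u, w))).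
have n4 : N (B u + Bt w) <= N (opmx A B Bt (u, w)).
  exact: (@rnorm_snd _ _ S _ _ (opmx A B Bt (u, w))).
have n5 := @rnorm_ge0 _ _ S _ (u, w).
have n6 := @rnorm_ge0 _ _ S _ (opmx A B Bt (u, w)).
have nD : N (jY (D w)) <= c * n.
  by apply: le_trans (hc w) _; rewrite ler_wpM2l // /n; lra.
have nlD := ler_wpM2l l0 nD; have nB := hM u Du; rewrite Lu in nB.
have nBn : N (B u) <= M * (3 * n).
  by apply: le_trans nB _; rewrite ler_wpM2l // /n; lra.
have nBt : N (Bt w) <= N (B u + Bt w) + N (B u).
  rewrite [X in N X <= _](_ : _ = (B u + Bt w) - B u); last by zmod.
  exact: rnormB.
have nu := @rnormB _ _ S _ u (jY (D w)).
have nA := @rnormB _ _ S _ (A u) (lam *: jY (D w)); rewrite rnormZ -/l in nA.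
rewrite dirichlet_shiftA //.
have cn : 0 <= c * n by rewrite mulr_ge0 // /n; lra.
have lcn : 0 <= l * (c * n) by rewrite mulr_ge0.
have Mn : 0 <= M * (3 * n) by rewrite !mulr_ge0 // /n; lra.
rewrite !mulrDl -!mulrA.
move: nD nlD nBn cn lcn Mn; rewrite /n; lra.
Qed.

(** D(A_0) sits in the domain of the matrix as the pairs with w = 0, and D(Bt) as the pairs (D w,
    w). *)
Lemma matrix_domain_bound : exists2 c : R, 0 <= c &
  (forall u, DA0 u -> opmx_domain DA L DBt (u, 0) /\
     N (u, 0 : dX) + N (opmx A B Bt (u, 0)) <= c * (N u + N (A u))) /\
  (forall w, DBt w -> opmx_domain DA L DBt (jY (D w), w) /\
     N (jY (D w), w) + N (opmx A B Bt (jY (D w), w)) <= c * (N w + N (Bt w))).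
Proof.
have [M M0 hM] := operator_bound; have [c c0 hc] := dirichlet_bound.
pose l := @rabs R K S lam; have l0 : 0 <= l := rabs_ge0 _.
exists (2 + c + l * c + M * (1 + c + l * c)).
  by rewrite !addr_ge0 // mulr_ge0 // !addr_ge0 // mulr_ge0.
have [lc0 Mc0] : 0 <= l * c /\ 0 <= M * (c + l * c).
  by rewrite !mulr_ge0 // addr_ge0 // mulr_ge0.
split=> [u [Du /= Lu]|w Dw].
  split; first by split=> //; exact: hBt.1.
  rewrite /opmx /= (linear_operator0 hBt) addr0.
  apply: le_trans (lerD (rnorm_pair_le _) (rnorm_pair_le _)) _ => /=.
  rewrite rnorm0 addr0; have := hM u Du; rewrite Lu rnorm0 addr0.
  have := @rnorm_ge0 _ _ S _ u; have := @rnorm_ge0 _ _ S _ (A u).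
  move: (N u) (N (A u)) (N (B u)) => a a' b' a0 a'0 hb.
  have h1 : 0 <= (1 + c + l * c + M * (c + l * c)) * (a + a').
    by rewrite mulr_ge0 // ?addr_ge0.
  have -> : (2 + c + l * c + M * (1 + c + l * c)) * (a + a') =
    (a + a') + M * (a + a') + (1 + c + l * c + M * (c + l * c)) * (a + a') by ring.
  by lra.
have [Dz Az Lz] := DP w; split; first by [].
rewrite /opmx /=; apply: le_trans (lerD (rnorm_pair_le _) (rnorm_pair_le _)) _ => /=.
have := hM _ Dz; rewrite Az Lz rnormZ -/l.
have := @rnormD _ _ S _ (B (jY (D w))) (Bt w).
have := hc w; have := ler_wpM2l l0 (hc w).
have := @rnorm_ge0 _ _ S _ (Bt w); have := @rnorm_ge0 _ _ S _ w.
move: (N (B _ + _)) (N w) (N (Bt w)) (N (jY _)) (N (B _)) => s a a' d b' a0 a'0 hld hd hs hb.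
have hb' : b' <= M * (c * a + l * (c * a) + a).
  by apply: le_trans hb _; rewrite ler_wpM2l //; lra.
have h1 : 0 <= (1 + c + l * c + M * (1 + c + l * c)) * a'.
  by rewrite mulr_ge0 // !addr_ge0 // mulr_ge0 // !addr_ge0.
have -> : (2 + c + l * c + M * (1 + c + l * c)) * (a + a') =
  2 * a + a' + c * a + l * (c * a) + M * (c * a + l * (c * a) + a) +
  (1 + c + l * c + M * (1 + c + l * c)) * a' by ring.
by lra.
Qed.

Lemma matrix_domain_embedding :
  domain_embedding (prod_map jY jdY) (opmx_domain DA L DBt) (opmx A B Bt) <->
  domain_embedding jY DA0 A /\ domain_embedding jdY DBt Bt.
Proof.
have DA0Y : DA0 `<=` range jY by move=> u [/hDAY].
split.
  move=> /(@domain_embedding_real _ _ S)[_ [M M0 hM]].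
  have [c c0 [hc1 hc2]] := matrix_domain_bound.
  split; apply/(@domain_embedding_real _ _ S); split=> //; exists (M * c);
    rewrite ?mulr_ge0 //.
    move=> y Dy; have [Du uc] := hc1 _ Dy.
    have := hM (y, 0); rewrite /prod_map /= -[jdY 0]/(jdYl 0) linear0 => /(_ Du) h.
    apply: le_trans (@rnorm_fst _ _ S _ _ (y, 0)) _; apply: le_trans h _.
    by rewrite -mulrA ler_wpM2l.
  move=> w Dw; have [Du uc] := hc2 _ Dw.
  have h := hM (D (jdY w), w) Du.
  apply: le_trans (@rnorm_snd _ _ S _ _ (D (jdY w), w)) _; apply: le_trans h _.
  by rewrite -mulrA ler_wpM2l.
move=> [/(@domain_embedding_real _ _ S)[_ [M M0 hM]]].
move=> /(@domain_embedding_real _ _ S)[_ [M' M'0 hM']].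
have [c c0 hc] := split_domain_bound.
have [m m0 hm] := @continuous_bounded _ _ S _ _ _ Dc.
apply/(@domain_embedding_real _ _ S); split.
  by move=> [u w] [/= /hDAY[y _ <-] /hDBtY[w' _ <-] _]; exists (y, w').
exists (M * c + m + M' * c); first by rewrite !addr_ge0 // mulr_ge0.
move=> [y w] Dyw; have [Dy Dw Ly] := Dyw; rewrite /= in Dy Dw Ly.
have [h1 h2] := hc _ _ Dyw; apply: le_trans (rnorm_pair_le _) _; rewrite /=.
have jB : jY (y - D (jdY w)) = jY y - jY (D (jdY w)).
  by rewrite -[LHS]/(jYl _) linearB.
have Dyw0 : DA0 (jY (y - D (jdY w))).
  by rewrite jB; exact: (dirichlet_shift _ _).1 (conj Dy Ly).
have h3 := hM _ Dyw0; rewrite jB in h3.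
have h4 := le_trans h3 (ler_wpM2l M0 h1).
have h5 := le_trans (hM' _ Dw) (ler_wpM2l M'0 h2).
have h6 : N y <= N (y - D (jdY w)) + N (D (jdY w)).
  by rewrite -[X in N X <= _](subrK (D (jdY w))) rnormD.
have h7 : N (D (jdY w)) <= m * (N (jY y, jdY w) + N (opmx A B Bt (jY y, jdY w))).
  apply: le_trans (hm _) _; rewrite ler_wpM2l //.
  apply: le_trans (@rnorm_snd _ _ S _ _ (jY y, jdY w)) _.
  by rewrite lerDl rnorm_ge0.
rewrite /prod_map /= in h4 h5 h7 *; rewrite !mulrDl -!mulrA.
move: h4 h5 h7; rewrite !mulrDr => h4 h5 h7; lra.
Qed.

Lemma matrix_compact_domain :
  compact_domain_embedding (opmx_domain DA L DBt) (opmx A B Bt) <->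
  compact_domain_embedding DA0 A /\ compact_domain_embedding DBt Bt.
Proof.
have hXdX := banach_prod hX hdX.
have matrix_lin : linear_operator (opmx_domain DA L DBt) (opmx A B Bt).
  split=> [|a [u w] [u' w'] [/= Du Dw Lu] [/= Du' Dw' Lu']].
    by split; [exact: hA.1|exact: hBt.1|exact: linear_operator0 hL].
  rewrite /opmx_domain /opmx /= (hA.2 a u u' Du Du').2 (hB.2 a u u' Du Du').2.
  rewrite (hL.2 a u u' Du Du').2 (hBt.2 a w w' Dw Dw').2 Lu Lu'; split.
    by split=> //; [exact: (hA.2 a u u' Du Du').1|exact: (hBt.2 a w w' Dw Dw').1].
  by congr (_, _); rewrite /= scalerDr; zmod.
split=> [cpt|[cptA cptB]].
  have [c c0 [hc1 hc2]] := matrix_domain_bound; split.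
    apply: (compact_domain_image hX hXdX matrix_lin (@fst_continuous _ X dX) (c := c)) cpt.
    by move=> u /hc1[Du uc]; exists (u, 0).
  apply: (compact_domain_image hdX hXdX matrix_lin (@snd_continuous _ X dX) (c := c)) cpt.
  by move=> w /hc2[Du uc]; exists (jY (D w), w).
have [c c0 hc] := split_domain_bound.
have f_lin : linear (fun p : X * dX => (p.1 + jYl (D p.2), p.2)).
  move=> a [u w] [u' w']; rewrite /= (linearP D) -[jY (_ + _)]/(jYl _) (linearP jYl).
  by congr (_, _); rewrite /= scalerDr; zmod.
have fc : continuous (mk_linear f_lin).
  move=> p; apply: pair_cvg => /=; last exact: cvg_snd.
  apply: cvgD; first exact: cvg_fst.
  apply: (linear_cvg (A := jYl)) => //; apply: (linear_cvg (A := D)) => //.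
  exact: cvg_snd.
apply: (compact_domain_image hXdX hXdX
  (linear_operator_prod domain0_linear_operator hBt) fc (c := c + c)).
  move=> [u w] Duw; have [Du Dw Lu] := Duw; rewrite /= in Du Dw Lu.
  have [h1 h2] := hc _ _ Duw.
  exists (u - jY (D w), w); first by rewrite /= subrK.
  split; first by split=> //=; exact: (dirichlet_shift _ _).1 (conj Du Lu).
  apply: le_trans (lerD (rnorm_pair_le _) (rnorm_pair_le _)) _.
  by rewrite /= mulrDl; lra.
exact: compact_domain_prod.
Qed.

End OperatorMatrixGeneration.

Theorem theorem5p4 (R : realType) (K : numFieldType) (iota : R -> K)
  (hK : scalar_field iota)
  (X Y dX dY : completeNormedModType K)
  (jY : Y -> X) (hjY : continuous_embedding jY)
  (jdY : dY -> dX) (hjdY : continuous_embedding jdY)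
  (DA : set X) (A : X -> X)
  (hA : linear_operator DA A) (hDAY : DA `<=` range jY)
  (L : X -> dX)
  (hL : linear_operator DA L) (hLsurj : set_surj DA [set: dX] L)
  (DA0 : set X) (hDA0 : DA0 = DA `&` [set u | L u = 0])
  (hA0dense : dense DA0) (hA0res : resolvent_set DA0 A !=set0)
  (hALclosed : closed_operator DA (fun u => (A u, L u)))
  (B : X -> dX) (hB : linear_operator DA B)
  (hBbd : exists M : K, forall u, DA u ->
     `|B u| <= M * (`|u| + `|A u| + `|L u|))
  (hBbd' :
     (exists M : K, forall u, DA0 u ->
        exists2 v : dY, jdY v = B u & `|v| <= M * (`|u| + `|A u|))
     \/ (exists M : K, forall y : Y, DA (jY y) -> `|B (jY y)| <= M * `|y|))
  (DBt : set dX) (Bt : dX -> dX)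
  (hBt : linear_operator DBt Bt) (hBtclosed : closed_operator DBt Bt)
  (hDBtY : DBt `<=` range jdY) :
  (generates_COF_with_phase_space iota (prod_map jY jdY)
     (opmx_domain DA L DBt) (opmx A B Bt)
   <->
   generates_COF_with_phase_space iota jY DA0 A
   /\ generates_COF_with_phase_space iota jdY DBt Bt)
  /\
  (generates_COF_with_phase_space iota (prod_map jY jdY)
     (opmx_domain DA L DBt) (opmx A B Bt) ->
   forall C : R -> {linear (X * dX)%type -> (X * dX)%type},
     cosine_generated_by iota (opmx_domain DA L DBt) (opmx A B Bt) C ->
     ((forall t : R, compact_operator (sine iota C t))
      <->
      compact_domain_embedding DA0 A /\ compact_domain_embedding DBt Bt)).
Proof.
have [S iotaE] := scalar_field_scalars hK; subst iota DA0.
have hX := @complete_banach R K S X; have hY := @complete_banach R K S Y.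
have hdX := @complete_banach R K S dX; have hdY := @complete_banach R K S dY.
have hYdY := banach_prod hY hdY; have hXdX := banach_prod hX hdX.
have [lam [Q [Qc QA QK]]] := hA0res.
have [D Dc DP] := @dirichlet_exists R K S X Y dX hY hdX jY hjY DA A L hA hDAY hL
  hLsurj lam Q QA QK hALclosed.
have hj : continuous_embedding (prod_map jY jdY).
  have [jl jI jc] := hjY; have [kl kI kc] := hjdY; split.
  - by move=> a p q; rewrite /prod_map /= jl kl.
  - by move=> [y w] [y' w'] [= /jI -> /kI ->].
  - move=> p; apply: pair_cvg => /=.
      by apply: (linear_cvg (A := mk_linear jl)) => //; exact: cvg_fst.
    by apply: (linear_cvg (A := mk_linear kl)) => //; exact: cvg_snd.
(* Kept as a function of the density proof: each direction below supplies it from its own group. *)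
have correction dense := correction_exists hdX hjY hjdY hA hL Qc QA QK hB hBbd' dense.
have kisynski_matrix :
    kisynski_space (@emb R K S) (prod_map jY jdY) (opmx_domain DA L DBt) (opmx A B Bt)
    <-> kisynski_space (@emb R K S) jY (DA `&` [set u | L u = 0]) A
      /\ kisynski_space (@emb R K S) jdY DBt Bt.
  have demb := @matrix_domain_embedding R K S _ _ _ _ _ hjY _ hjdY _ _ _ hA hDAY hL
    _ _ hBbd _ Dc DP _ _ hBt hDBtY.
  split.
    move=> [/demb[dA dB] _ /(reduction_graph_group hXdX hYdY hj) G].
    have [k [b [kc bc kb]]] := correction (matrix_graph_dense hX hY hdX hdY hjY hjdY hA hL Dc DP G).
    have [/generates_group_semigroup ? /generates_group_semigroup ?] :=
      (matrix_group hX hY hdX hdY hjY hjdY hA hL hB hBbd Dc DP DBt Bt kc bc kb).1 G.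
    by [].
  move=> [[dA _ /(reduction_graph_group hX hY hjY) GA]].
  move=> [dB _ /(reduction_graph_group hdX hdY hjdY) GB].
  have [k [b [kc bc kb]]] := correction (split_graph_dense hX hY GA).
  split=> //; first exact: demb.2 (conj dA dB).
  apply: generates_group_semigroup.
  by apply: (matrix_group hX hY hdX hdY hjY hjdY hA hL hB hBbd Dc DP DBt Bt kc bc kb).2.
split; last first.
  move=> _ C [hC CG].
  have cpt := matrix_compact_domain hX hdX hjY hA hL hB hBbd Dc DP hBt.
  split=> [sineC|/cpt cptD]; last exact: (compact_domain_sine hXdX hC CG cptD).
  by apply: cpt.1; exact: (sine_compact_domain hXdX hC CG sineC).
(* The given cosine functions are discarded, and those of the conclusion are rebuilt from the
   reduction groups. *)
split=> [[_ /kisynski_matrix[kA kB]]|[[_ kA] [_ kB]]].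
  split; split=> //; first exact: (kisynski_generates_COF hX hY kA).
  exact: (kisynski_generates_COF hdX hdY kB).
have kM := kisynski_matrix.2 (conj kA kB).
by split=> //; exact: (kisynski_generates_COF hXdX hYdY kM).
Qed.
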